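(* Let $K\ge3$ and consider the $K$-receiver DM BC with message index set $\mathsf{E}=\{\overline{\{K\}},\overline{\{K-1\}}\}$, $S_p=[1:K-2]$. Suppose the channel belongs to one of the classes (A) $Y_j$ is more capable than $Y_{K-1}$ for all $j\in S_p$, and $Y_{K-1}$ is more capable than $Y_K$; (B) $Y_i$ is less noisy than $Y_K$ for all $i\in S_p\cup\{K-1\}$. Then the capacity region is the set of rate pairs $(R_{\overline{K}},R_{\overline{K-1}})$ such that for some pmf $p(u,x)$ (with $U$ finite and $U\to X\to(Y_1,\dots,Y_K)$ a Markov chain) $R_{\overline{K-1}}\le I(U;Y_K)$, $R_{\overline{K-1}}+R_{\overline{K}}\le I(X;Y_j|U)+I(U;Y_K)$ for all $j\in S_p\cup\{K-1\}$, $R_{\overline{K-1}}+R_{\overline{K}}\le I(X;Y_{K-1})$.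
   Context: DM BC with finite alphabets and transition pmf $W(y_1,\dots,y_K|x)$ used memorylessly without feedback; message $M_S$ required by all receivers in $S$; achievability and capacity region in the usual sense (error probability: some receiver mis-decodes a required message). $M_{\overline{K}}$ is the message required by receivers $1,\dots,K-1$ and $M_{\overline{K-1}}$ the message required by receivers in $[1:K]\setminus\{K-1\}$. Receiver $Y_s$ is less noisy than $Y_c$ if $I(U;Y_s)\ge I(U;Y_c)$ for all $p(u,x)$ with $U\to X\to(Y_s,Y_c)$. Receiver $Y_s$ is more capable than $Y_c$ if $I(X;Y_s)\ge I(X;Y_c)$ for all $p(x)$. *)

(* Defs.v *)
From Stdlib Require Import Reals.
From mathcomp Require Import all_boot.

Set Implicit Arguments.
Unset Strict Implicit.
Unset Printing Implicit Defensive.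

Local Open Scope R_scope.

Definition rsum (T : finType) (f : T -> R) : R := \big[Rplus/0]_(t : T) f t.
Definition rprod (T : finType) (f : T -> R) : R := \big[Rmult/1]_(t : T) f t.

Definition log2 (x : R) : R := ln x / ln 2.

Definition plogq (p q : R) : R :=
  if Req_EM_T p 0 then 0 else p * log2 (p / q).

Definition is_pmf (A : finType) (p : A -> R) : Prop :=
  (forall a, 0 <= p a) /\ rsum p = 1.
Definition is_pmf2 (A B : finType) (p : A -> B -> R) : Prop :=
  (forall a b, 0 <= p a b) /\ rsum (fun a => rsum (fun b => p a b)) = 1.

Definition mutinf (A B : finType) (p : A -> B -> R) : R :=
  rsum (fun a => rsum (fun b =>
    plogq (p a b) (rsum (fun b' => p a b') * rsum (fun a' => p a' b)))).

Definition cmutinf (C A B : finType) (p : C -> A -> B -> R) : R :=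
  rsum (fun c => rsum (fun a => rsum (fun b =>
    let pc  := rsum (fun a' => rsum (fun b' => p c a' b')) in
    let pca := rsum (fun b' => p c a b') in
    let pcb := rsum (fun a' => p c a' b) in
    plogq (p c a b) (pca * pcb / pc)))).

(* Receivers are numbered 1..K; receiver r is the ordinal r-1 : 'I_K. *)
Definition rcv (K : nat) (i : 'I_K) : nat := (nat_of_ord i).+1.

Definition outT (K : nat) (Y : 'I_K -> finType) : finType :=
  {dffun forall i : 'I_K, Y i}.

Definition is_channel (K : nat) (X : finType) (Y : 'I_K -> finType)
  (W : X -> outT Y -> R) : Prop :=
  forall x, is_pmf (W x).

Definition marg (K : nat) (X : finType) (Y : 'I_K -> finType)
  (W : X -> outT Y -> R) (j : 'I_K) (x : X) (y : Y j) : R :=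
  rsum (fun ya : outT Y => if ya j == y then W x ya else 0).
Arguments marg {K X Y} W j x y.

Definition I_UY (K : nat) (X : finType) (Y : 'I_K -> finType)
  (W : X -> outT Y -> R) (U : finType) (p : U -> X -> R) (j : 'I_K) : R :=
  mutinf (fun (u : U) (y : Y j) => rsum (fun x => p u x * marg W j x y)).
Definition I_XY_given_U (K : nat) (X : finType) (Y : 'I_K -> finType)
  (W : X -> outT Y -> R) (U : finType) (p : U -> X -> R) (j : 'I_K) : R :=
  cmutinf (fun (u : U) (x : X) (y : Y j) => p u x * marg W j x y).
Definition I_XY (K : nat) (X : finType) (Y : 'I_K -> finType)
  (W : X -> outT Y -> R) (px : X -> R) (j : 'I_K) : R :=
  mutinf (fun (x : X) (y : Y j) => px x * marg W j x y).

Definition less_noisy (K : nat) (X : finType) (Y : 'I_K -> finType)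
  (W : X -> outT Y -> R) (s c : 'I_K) : Prop :=
  forall (U : finType) (p : U -> X -> R), is_pmf2 p ->
    I_UY W p c <= I_UY W p s.

Definition more_capable (K : nat) (X : finType) (Y : 'I_K -> finType)
  (W : X -> outT Y -> R) (s c : 'I_K) : Prop :=
  forall px : X -> R, is_pmf px -> I_XY W px c <= I_XY W px s.

(* Two messages: M1 = M_{bar K} (required by receivers 1..K-1) with N1
   values, M2 = M_{bar (K-1)} (required by receivers in [1:K] \ {K-1})
   with N2 values. Each decoder outputs a pair of estimates; only the
   components of the messages the receiver requires are checked. *)
Record code (K : nat) (X : finType) (Y : 'I_K -> finType) (n N1 N2 : nat) :=
  Code {
    enc : 'I_N1 -> 'I_N2 -> 'I_n -> X;
    dec : forall i : 'I_K, ('I_n -> Y i) -> 'I_N1 * 'I_N2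
  }.
Arguments enc {K X Y n N1 N2} c m1 m2 t.
Arguments dec {K X Y n N1 N2} c i yi.

Definition req1 (K : nat) (i : 'I_K) : bool := rcv i != K.
Definition req2 (K : nat) (i : 'I_K) : bool := rcv i != K.-1.

Definition err_event (K : nat) (X : finType) (Y : 'I_K -> finType)
  (n N1 N2 : nat) (c : code X Y n N1 N2) (m1 : 'I_N1) (m2 : 'I_N2)
  (yn : {ffun 'I_n -> outT Y}) : bool :=
  [exists i : 'I_K,
     (req1 i && ((dec c i (fun t => yn t i)).1 != m1))
  || (req2 i && ((dec c i (fun t => yn t i)).2 != m2))].

Definition Pe (K : nat) (X : finType) (Y : 'I_K -> finType)
  (W : X -> outT Y -> R) (n N1 N2 : nat) (c : code X Y n N1 N2) : R :=
  rsum (fun m1 : 'I_N1 => rsum (fun m2 : 'I_N2 =>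
    rsum (fun yn : {ffun 'I_n -> outT Y} =>
      rprod (fun t : 'I_n => W (enc c m1 m2 t) (yn t)) *
      (if err_event c m1 m2 yn then 1 else 0))))
  / (INR N1 * INR N2).

(* (R1,R2) = (R_{bar K}, R_{bar (K-1)}) achievable: a sequence of
   (2^{nR1}, 2^{nR2}, n) codes with error probability -> 0 *)
Definition achievable (K : nat) (X : finType) (Y : 'I_K -> finType)
  (W : X -> outT Y -> R) (R1 R2 : R) : Prop :=
  0 <= R1 /\ 0 <= R2 /\
  exists (N1 N2 : nat -> nat) (c : forall n, code X Y n (N1 n) (N2 n)),
    (forall n, Rpower 2 (INR n * R1) <= INR (N1 n)) /\
    (forall n, Rpower 2 (INR n * R2) <= INR (N2 n)) /\
    Un_cv (fun n => Pe W (c n)) 0.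

Definition capacity_region (K : nat) (X : finType) (Y : 'I_K -> finType)
  (W : X -> outT Y -> R) (R1 R2 : R) : Prop :=
  forall eps, 0 < eps ->
    exists a b, achievable W a b /\ Rabs (a - R1) < eps /\ Rabs (b - R2) < eps.

Definition classA (K : nat) (X : finType) (Y : 'I_K -> finType)
  (W : X -> outT Y -> R) : Prop :=
  (forall j jK1 : 'I_K, (rcv j <= K - 2)%N -> rcv jK1 = K.-1 ->
     more_capable W j jK1) /\
  (forall jK1 jK : 'I_K, rcv jK1 = K.-1 -> rcv jK = K ->
     more_capable W jK1 jK).

Definition classB (K : nat) (X : finType) (Y : 'I_K -> finType)
  (W : X -> outT Y -> R) : Prop :=
  forall i jK : 'I_K, (rcv i <= K.-1)%N -> rcv jK = K -> less_noisy W i jK.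

Definition region (K : nat) (X : finType) (Y : 'I_K -> finType)
  (W : X -> outT Y -> R) (R1 R2 : R) : Prop :=
  0 <= R1 /\ 0 <= R2 /\
  exists (U : finType) (p : U -> X -> R), is_pmf2 p /\
    (forall jK : 'I_K, rcv jK = K -> R2 <= I_UY W p jK) /\
    (forall j jK : 'I_K, (rcv j <= K.-1)%N -> rcv jK = K ->
       R2 + R1 <= I_XY_given_U W p j + I_UY W p jK) /\
    (forall jK1 : 'I_K, rcv jK1 = K.-1 ->
       R2 + R1 <= I_XY W (fun x => rsum (fun u => p u x)) jK1).

(* Main.v *)
Require Import Defs.
From Stdlib Require Import Reals Lra FunctionalExtensionality ClassicalEpsilon.
From mathcomp Require Import all_boot all_algebra.
From mathcomp Require Import Rstruct.

Set Implicit Arguments.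
Unset Strict Implicit.
Unset Printing Implicit Defensive.

Local Open Scope R_scope.

(** Achievability: superposition coding with rate splitting. The cloud centre carries the
message of rate [R2] together with a part of the message of rate [R1], receiver [K] decodes the
cloud only, and all other receivers decode both layers; either class of channels makes
[R1 + R2 <= I(X;Y_j)] hold for each of them.  A one-shot random coding bound with threshold
tests on information densities is combined with Chebyshev's inequality.

Converse: conditional entropies of the outputs are sums of the concave, homogeneous functional
[ent].  For class A take [U_i = (M2, Y_K^{i-1}, Y_{K-1,i+1}^n)]; exchanging the outputs of
receiver [K-1] for those of receiver [K] one at a time telescopes (Csiszár's sum identity).  For
class B take [U_i = (M2, Y_K^{i-1})]; the same exchange shows that the less noisy past of [Y_j]
is more informative than that of [Y_K].  The single-letter region is closed because
Carathéodory's theorem bounds the alphabet of [U]. *)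

(** [ent] is homogeneous of degree one, so H(Y|U) is the sum of [ent] over the unnormalised slices
    p(u,.): null slices cost nothing, and both channel orders extend from pmfs to finite measures by
    scaling. The obstacle in the converse is that receiver K-1 requires only the first message and
    receiver K only the second, so neither alone bounds the sum rate through Fano's inequality. In
    class A their Fano inequalities are added and the n-letter entropies of Y_K and Y_{K-1} are
    compared given one message: given M2 for the bounds that involve U, given M1 for the bound
    I(X;Y_{K-1}). In class B the last bound follows from the one for j = K-1, because I(U;Y_K) <=
    I(U;Y_{K-1}). The capacity region is a closure. In the direct part all rates may therefore be
    shrunk by a factor below 1, which makes the inequalities strict except at rate zero; that case
    is met by codebooks with exactly one entry. In the converse every code yields only approximate
    bounds, with an auxiliary alphabet that grows with the block length, and a limit exists only
    after the alphabets have been reduced to a common size. *)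

Local Notation "\sum_ ( i | P ) F" := (\big[Rplus/0]_(i | P%B) F) : R_scope.
Local Notation "\sum_ ( i : t | P ) F" := (\big[Rplus/0]_(i : t | P%B) F) : R_scope.
Local Notation "\sum_ ( i : t ) F" := (\big[Rplus/0]_(i : t) F) : R_scope.
Local Notation "\sum_ ( i < n ) F" := (\big[Rplus/0]_(i < n) F) : R_scope.
Local Notation "\sum_ i F" := (\big[Rplus/0]_i F) : R_scope.
Local Notation "\prod_ i F" := (\big[Rmult/1]_i F) : R_scope.

(** * Finite sums and products of reals *)

Section BigR.
Variables (I J : finType).
Implicit Types (P : pred I) (F G : I -> R).

Lemma sumR_ge0 P F : (forall i, P i -> 0 <= F i) -> 0 <= \sum_(i | P i) F i.
Proof. by move=> H; apply: big_ind => // [|x y]; lra. Qed.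

Lemma leR_sum P F G : (forall i, P i -> F i <= G i) ->
  \sum_(i | P i) F i <= \sum_(i | P i) G i.
Proof. by move=> H; apply: big_ind2 => // [|x1 x2 y1 y2]; lra. Qed.

Lemma sumRN P F : \sum_(i | P i) - F i = - \sum_(i | P i) F i.
Proof. by symmetry; apply: (big_morph Ropp) => [x y|]; lra. Qed.

Lemma sumRB P F G :
  \sum_(i | P i) (F i - G i) = \sum_(i | P i) F i - \sum_(i | P i) G i.
Proof. by rewrite /Rminus big_split /= sumRN. Qed.

Lemma sumR_mull P c F : \sum_(i | P i) c * F i = c * \sum_(i | P i) F i.
Proof. by rewrite big_distrr. Qed.

Lemma sumR_mulr P c F : \sum_(i | P i) F i * c = (\sum_(i | P i) F i) * c.
Proof. by rewrite big_distrl. Qed.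

Lemma sumR_const c : \sum_(i : I) c = INR #|I| * c.
Proof.
rewrite big_const; elim: #|I| => [|n IH]; first by rewrite /=; lra.
by rewrite iterS IH S_INR; lra.
Qed.

Lemma le_sumR P F i : P i -> (forall k, P k -> 0 <= F k) -> F i <= \sum_(k | P k) F k.
Proof.
move=> Pi F0; rewrite (bigD1 i) //=.
by have := @sumR_ge0 (fun k => P k && (k != i)) F (fun k Hk => F0 k (proj1 (andP Hk))); lra.
Qed.

Lemma sumR_eq0 P F : (forall k, P k -> 0 <= F k) -> \sum_(k | P k) F k = 0 ->
  forall i, P i -> F i = 0.
Proof. by move=> F0 S0 i Pi; have := le_sumR Pi F0; have := F0 i Pi; lra. Qed.

Lemma sumR_if P F : \sum_i (if P i then F i else 0) = \sum_(i | P i) F i.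
Proof. by rewrite [RHS]big_mkcond. Qed.

Lemma sumR_fiber (f : I -> J) F : \sum_i F i = \sum_j \sum_(i | f i == j) F i.
Proof. by rewrite (partition_big f xpredT). Qed.

Lemma sumR_subset P F : (forall i, 0 <= F i) -> \sum_(i | P i) F i <= \sum_i F i.
Proof.
move=> F0; rewrite big_mkcond; apply: leR_sum => i _.
by case: (P i); [lra | apply: F0].
Qed.

Lemma prodR_ge0 F : (forall i, 0 <= F i) -> 0 <= \prod_i F i.
Proof. by move=> H; apply: big_ind => [|x y|i _]; [lra | apply: Rmult_le_pos | apply: H]. Qed.

Lemma prodR_gt0 F : (forall i, 0 < F i) -> 0 < \prod_i F i.
Proof. by move=> H; apply: big_ind => [|x y|i _]; [lra | apply: Rmult_lt_0_compat | apply: H]. Qed.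

Lemma prodR_eq0 F i : F i = 0 -> \prod_k F k = 0.
Proof. by move=> H; rewrite (bigD1 i) //= H Rmult_0_l. Qed.

End BigR.

Lemma sumR_pair (A B : finType) (F : A * B -> R) :
  \sum_w F w = \sum_a \sum_b F (a, b).
Proof. by rewrite pair_bigA; apply: eq_bigr => -[]. Qed.

Lemma sum_prod_ffun (I T : finType) (mu : I -> T -> R) :
  \sum_(f : {ffun I -> T}) \prod_i mu i (f i) = \prod_i \sum_t mu i t.
Proof. by rewrite bigA_distr_bigA. Qed.

Lemma sum_prod_ffun1 (I T : finType) (mu : I -> T -> R) :
  (forall i, \sum_t mu i t = 1) -> \sum_(f : {ffun I -> T}) \prod_i mu i (f i) = 1.
Proof. by move=> H; rewrite sum_prod_ffun big1. Qed.

(** * Resampling one coordinate of a product law *)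

Definition upd (I T : finType) (f : {ffun I -> T}) (i : I) (z : T) : {ffun I -> T} :=
  [ffun k => if k == i then z else f k].

Lemma upd_eq (I T : finType) (f : {ffun I -> T}) i z : upd f i z i = z.
Proof. by rewrite ffunE eqxx. Qed.

Lemma upd_neq (I T : finType) (f : {ffun I -> T}) i z k : k != i -> upd f i z k = f k.
Proof. by rewrite ffunE => /negbTE ->. Qed.

(* The map exchanging [f i] with a fresh sample [b] is a measure-preserving involution. *)
Lemma prod_resample (I T : finType) (mu : I -> T -> R) (i : I)
    (F : {ffun I -> T} -> T -> R) :
  (forall k, \sum_t mu k t = 1) ->
  (forall f z b, F (upd f i z) b = F f b) ->
  \sum_(f : {ffun I -> T}) (\prod_k mu k (f k)) * F f (f i) =
  \sum_(f : {ffun I -> T}) (\prod_k mu k (f k)) * \sum_b mu i b * F f b.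
Proof.
move=> Hmu HF.
have -> : \sum_(f : {ffun I -> T}) (\prod_k mu k (f k)) * F f (f i) =
   \sum_(f : {ffun I -> T}) \sum_b (\prod_k mu k (f k)) * mu i b * F f (f i).
  apply: eq_bigr => f _; rewrite sumR_mulr sumR_mull Hmu; ring.
have -> : \sum_(f : {ffun I -> T}) (\prod_k mu k (f k)) * (\sum_b mu i b * F f b) =
   \sum_(f : {ffun I -> T}) \sum_b (\prod_k mu k (f k)) * mu i b * F f b.
  by apply: eq_bigr => f _; rewrite -sumR_mull; apply: eq_bigr => b _; ring.
rewrite !pair_bigA /=.
pose sw (x : {ffun I -> T} * T) := (upd x.1 i x.2, x.1 i).
have swK : involutive sw.
  case=> f b; rewrite /sw /= upd_eq; congr pair.
  by apply/ffunP => k; rewrite !ffunE; case: eqP => // ->.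
rewrite [RHS](reindex_inj (inv_inj swK)) /=; apply: eq_bigr => -[f b] _ /=.
rewrite HF (bigD1 i) //= [in RHS](bigD1 i) //= upd_eq.
have -> : \big[Rmult/1]_(k | k != i) mu k (upd f i b k) =
          \big[Rmult/1]_(k | k != i) mu k (f k).
  by apply: eq_bigr => k ki; rewrite upd_neq.
ring.
Qed.

(** * Logarithms and Gibbs' inequality *)

Definition xlog (x : R) : R := x * log2 x.

Lemma ln2_gt0 : 0 < ln 2.
Proof. by rewrite -ln_1; apply: ln_increasing; lra. Qed.

Lemma xlog0 : xlog 0 = 0.
Proof. by rewrite /xlog Rmult_0_l. Qed.

Lemma log2_1 : log2 1 = 0.
Proof. by rewrite /log2 ln_1 /Rdiv Rmult_0_l. Qed.

Lemma xlog1 : xlog 1 = 0.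
Proof. by rewrite /xlog log2_1; lra. Qed.

Lemma log2_mult x y : 0 < x -> 0 < y -> log2 (x * y) = log2 x + log2 y.
Proof. by move=> x0 y0; rewrite /log2 ln_mult //; have := ln2_gt0 => ?; field; lra. Qed.

Lemma log2_div x y : 0 < x -> 0 < y -> log2 (x / y) = log2 x - log2 y.
Proof.
move=> x0 y0; rewrite /log2 /Rdiv ln_mult ?ln_Rinv //; last exact: Rinv_0_lt_compat.
by have := ln2_gt0 => ?; field; lra.
Qed.

Lemma log2_inv x : 0 < x -> log2 (/ x) = - log2 x.
Proof. by move=> x0; rewrite /log2 ln_Rinv //; have := ln2_gt0 => ?; field; lra. Qed.

Lemma log2_le x y : 0 < x -> x <= y -> log2 x <= log2 y.
Proof.
move=> x0 xy; rewrite /log2; apply: Rmult_le_compat_r.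
  by apply/Rlt_le/Rinv_0_lt_compat/ln2_gt0.
by case: xy => [xy|->]; [apply/Rlt_le/ln_increasing | lra].
Qed.

Lemma log2_Rpower a : log2 (Rpower 2 a) = a.
Proof.
by rewrite /log2 /Rpower ln_exp; have := ln2_gt0 => ?; field; lra.
Qed.

Lemma xlogM a b : 0 <= a -> 0 <= b -> xlog (a * b) = b * xlog a + a * xlog b.
Proof.
rewrite /xlog; case=> [a0|<-]; last by rewrite Rmult_0_l; lra.
case=> [b0|<-]; last by rewrite Rmult_0_r; lra.
by rewrite log2_mult //; ring.
Qed.

Lemma ln_le_sub1 x : 0 < x -> ln x <= x - 1.
Proof.
move=> x0; have := exp_ineq1_le (ln x); rewrite exp_ln //; lra.
Qed.

(** The bound ln z <= z - 1 at z = q / p. The linear left-hand side is kept because it cancels, or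
    has a known sign, once summed over two measures. *)
Lemma gibbs p q : 0 <= p -> 0 <= q -> (q = 0 -> p = 0) ->
  (p - q) / ln 2 <= p * (log2 p - log2 q).
Proof.
have l0 := ln2_gt0.
have i0 : 0 < / ln 2 by apply: Rinv_0_lt_compat.
case=> [p0|<-] q0 H.
  have {}q0 : 0 < q by case: q0 => // q0; have := H (esym q0); lra.
  have e : p * (log2 p - log2 q) = - (p * ln (q / p)) / ln 2.
    rewrite /log2 /Rdiv ln_mult ?ln_Rinv //; last exact: Rinv_0_lt_compat.
    by field; lra.
  rewrite e; apply: Rmult_le_compat_r; first lra.
  have qp : 0 < q / p by apply: Rdiv_lt_0_compat.
  have h := ln_le_sub1 qp.
  have : p * ln (q / p) <= p * (q / p - 1) by apply: Rmult_le_compat_l; lra.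
  have -> : p * (q / p - 1) = q - p by field; lra.
  lra.
by rewrite Rmult_0_l /Rdiv; nra.
Qed.

Lemma plogqE p q : plogq p q = p * log2 (p / q).
Proof. by rewrite /plogq; case: Req_dec_T => [h|_] /=; rewrite ?h; lra. Qed.

(** Nonnegativity of mutual information for a measure of any mass: Gibbs' inequality against the
    product of the marginals divided by the total mass, a measure with the same mass as [a]. *)
Lemma xlog_mutinf_ge0 (A B : finType) (a : A -> B -> R) :
  (forall s t, 0 <= a s t) ->
  \sum_s xlog (\sum_t a s t) + \sum_t xlog (\sum_s a s t) <=
  \sum_s \sum_t xlog (a s t) + xlog (\sum_s \sum_t a s t).
Proof.
move=> a0; set m := \sum_s \sum_t a s t.
pose r s := \sum_t a s t; pose c t := \sum_s a s t.
have r0 s : 0 <= r s by apply: sumR_ge0.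
have c0 t : 0 <= c t by apply: sumR_ge0.
have m0 : 0 <= m by apply: sumR_ge0 => s _; apply: r0.
have mc : m = \sum_t c t by rewrite /m exchange_big.
have ar s t : a s t <= r s by apply: (@le_sumR _ xpredT (a s)).
have ac s t : a s t <= c t by apply: (@le_sumR _ xpredT (fun s => a s t)).
(* At mass zero the reference measure is undefined, but then every term vanishes. *)
case: m0 => [m0|m0]; last first.
  have rz s : r s = 0 by apply: (@sumR_eq0 _ xpredT r) => //; rewrite -m0.
  have az s t : a s t = 0 by have := ar s t; have := a0 s t; have := rz s; lra.
  have cz t : c t = 0 by apply: big1 => s _.
  rewrite -m0 xlog0 big1 ?big1 => [|s _|t _|s _]; first lra.
  - by rewrite big1 // => t _; rewrite az xlog0.
  - by rewrite -/(c t) cz xlog0.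
  - by rewrite -/(r s) rz xlog0.
have rm s : r s <= m by apply: (@le_sumR _ xpredT r).
have key s t : (a s t - r s * c t / m) / ln 2 <=
    xlog (a s t) - a s t * log2 (r s) - a s t * log2 (c t) + a s t * log2 m.
  have q0 : 0 <= r s * c t / m.
    by apply: Rmult_le_pos; [apply: Rmult_le_pos | apply/Rlt_le/Rinv_0_lt_compat].
  have hz : r s * c t / m = 0 -> a s t = 0.
    move=> h; have : r s * c t = 0.
      by have -> : r s * c t = (r s * c t / m) * m; [field; lra | rewrite h Rmult_0_l].
    by case/Rmult_integral => h'; [have := ar s t | have := ac s t]; have := a0 s t; lra.
  have := gibbs (a0 s t) q0 hz.
  case: (a0 s t) => [ap|az]; last by rewrite -az xlog0; lra.
  have rp : 0 < r s by have := ar s t; lra.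
  have cp : 0 < c t by have := ac s t; lra.
  rewrite log2_div ?log2_mult //; last exact: Rmult_lt_0_compat.
  by rewrite /xlog; lra.
have S : \sum_s \sum_t (a s t - r s * c t / m) / ln 2 <=
   \sum_s \sum_t (xlog (a s t) - a s t * log2 (r s) - a s t * log2 (c t) + a s t * log2 m).
  by apply: leR_sum => s _; apply: leR_sum => t _; apply: key.
have L : \sum_s \sum_t (a s t - r s * c t / m) / ln 2 = 0.
  transitivity (\sum_s (r s - r s) / ln 2).
    apply: eq_bigr => s _; rewrite sumR_mulr sumRB; congr (_ / _).
    have -> : \sum_t r s * c t / m = r s * / m * \sum_t c t.
      by rewrite -sumR_mull; apply: eq_bigr => t _; rewrite /Rdiv; ring.
    by rewrite -mc; rewrite /r; field; lra.
  by apply: big1 => s _; rewrite Rminus_diag /Rdiv Rmult_0_l.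
have E : \sum_s \sum_t (xlog (a s t) - a s t * log2 (r s) - a s t * log2 (c t) + a s t * log2 m)
  = \sum_s \sum_t xlog (a s t) - \sum_s xlog (r s) - \sum_t xlog (c t) + xlog m.
  have -> : \sum_s xlog (r s) = \sum_s \sum_t a s t * log2 (r s).
    by apply: eq_bigr => s _; rewrite sumR_mulr.
  have -> : \sum_t xlog (c t) = \sum_s \sum_t a s t * log2 (c t).
    by rewrite exchange_big; apply: eq_bigr => t _; rewrite sumR_mulr.
  have -> : xlog m = \sum_s \sum_t a s t * log2 m.
    by rewrite /xlog {1}/m -sumR_mulr; apply: eq_bigr => s _; rewrite sumR_mulr.
  by rewrite -!sumRB -big_split; apply: eq_bigr => s _; rewrite -!sumRB -big_split.
by rewrite -/m; move: S; rewrite L E /r /c; lra.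
Qed.

(** * The homogeneous output entropy of a channel *)

Section Entropy.
Variables (X B : finType) (V : X -> B -> R).
Hypothesis V0 : forall x y, 0 <= V x y.
Hypothesis V1 : forall x, \sum_y V x y = 1.

(* For a finite measure [q] on the inputs, mass times output entropy. *)
Definition ent (q : X -> R) : R :=
  xlog (\sum_x q x) - \sum_y xlog (\sum_x q x * V x y).

(** H(Y | X = x), the noise entropy of one row of the channel. *)
Definition rowent (x : X) : R := - \sum_y xlog (V x y).

Lemma out_mass (q : X -> R) : \sum_y \sum_x q x * V x y = \sum_x q x.
Proof.
by rewrite exchange_big; apply: eq_bigr => x _; rewrite sumR_mull V1 Rmult_1_r.
Qed.

Lemma out_ge0 (q : X -> R) : (forall x, 0 <= q x) -> forall y, 0 <= \sum_x q x * V x y.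
Proof. by move=> q0 y; apply: sumR_ge0 => x _; apply: Rmult_le_pos. Qed.

Lemma eq_ent (q q' : X -> R) : q =1 q' -> ent q = ent q'.
Proof.
move=> h; rewrite /ent; congr (xlog _ - _); first exact: eq_bigr.
by apply: eq_bigr => y _; congr xlog; apply: eq_bigr => x _; rewrite h.
Qed.

(** The corrections in [xlog c] carry the input mass and the output mass respectively, and these
    agree. *)
Lemma ent_scale c (q : X -> R) : 0 <= c -> (forall x, 0 <= q x) ->
  ent (fun x => c * q x) = c * ent q.
Proof.
move=> c0 q0; rewrite /ent sumR_mull.
have s0 : 0 <= \sum_x q x by apply: sumR_ge0.
have o0 := out_ge0 q0.
rewrite xlogM //.
have -> : \sum_y xlog (\sum_x c * q x * V x y) =
          \sum_y ((\sum_x q x * V x y) * xlog c + c * xlog (\sum_x q x * V x y)).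
  apply: eq_bigr => y _; rewrite -xlogM // -sumR_mull; congr xlog.
  by apply: eq_bigr => x _; ring.
by rewrite big_split /= sumR_mulr sumR_mull out_mass; ring.
Qed.

(** H(Y|T) <= H(Y), being nonnegativity of I(T;Y) for the unnormalised law of [t] and the output.
    Together with [ent_scale] this is concavity. *)
Lemma ent_superadd (T : finType) (p : T -> X -> R) : (forall t x, 0 <= p t x) ->
  \sum_t ent (p t) <= ent (fun x => \sum_t p t x).
Proof.
move=> p0; rewrite /ent sumRB.
have := @xlog_mutinf_ge0 T B (fun t y => \sum_x p t x * V x y)
  (fun t y => @out_ge0 (p t) (p0 t) y).
have -> : \sum_s xlog (\sum_t \sum_x p s x * V x t) = \sum_t xlog (\sum_x p t x).
  by apply: eq_bigr => t _; rewrite out_mass.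
have -> : \sum_t \sum_y \sum_x p t x * V x y = \sum_x \sum_t p t x.
  by rewrite [RHS]exchange_big; apply: eq_bigr => t _; rewrite out_mass.
have -> : \sum_y xlog (\sum_x (\sum_t p t x) * V x y) =
          \sum_y xlog (\sum_t \sum_x p t x * V x y).
  apply: eq_bigr => y _; congr xlog; rewrite exchange_big; apply: eq_bigr => x _.
  by rewrite sumR_mulr.
lra.
Qed.

Lemma ent_point (x : X) (q : X -> R) : (forall x', 0 <= q x') ->
  (forall x', x' != x -> q x' = 0) -> ent q = \sum_x' q x' * rowent x'.
Proof.
move=> q0 qx.
have S (F : X -> R) : \sum_x' q x' * F x' = q x * F x.
  by rewrite (bigD1 x) //= big1 ?Rplus_0_r // => x' /qx ->; rewrite Rmult_0_l.
have S1 : \sum_x' q x' = q x.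
  by rewrite -[RHS]Rmult_1_r -(S (fun=> 1)); apply: eq_bigr => i _; ring.
rewrite /ent S1 S /rowent.
have -> : \sum_y xlog (\sum_x' q x' * V x' y) =
   \sum_y (V x y * xlog (q x) + q x * xlog (V x y)).
  by apply: eq_bigr => y _; rewrite S xlogM.
by rewrite big_split /= sumR_mulr sumR_mull V1; ring.
Qed.

Lemma mass_xlog_pair (q : X -> R) : (forall x, 0 <= q x) ->
  \sum_x \sum_y xlog (q x * V x y) = \sum_x xlog (q x) - \sum_x q x * rowent x.
Proof.
move=> q0; rewrite -sumRB; apply: eq_bigr => x _.
have -> : \sum_y xlog (q x * V x y) = \sum_y (V x y * xlog (q x) + q x * xlog (V x y)).
  by apply: eq_bigr => y _; rewrite xlogM.
by rewrite big_split /= sumR_mulr sumR_mull V1 /rowent; ring.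
Qed.

(** Nonnegativity of I(X;Y) for an unnormalised input law. *)
Lemma rowent_le_ent (q : X -> R) : (forall x, 0 <= q x) ->
  \sum_x q x * rowent x <= ent q.
Proof.
move=> q0; rewrite /ent.
have := @xlog_mutinf_ge0 X B (fun x y => q x * V x y)
  (fun x y => Rmult_le_pos _ _ (q0 x) (V0 x y)).
rewrite mass_xlog_pair //.
have -> : \sum_x \sum_y q x * V x y = \sum_x q x.
  by apply: eq_bigr => x _; rewrite sumR_mull V1 Rmult_1_r.
have -> : \sum_s xlog (\sum_t q s * V s t) = \sum_x xlog (q x).
  by apply: eq_bigr => x _; rewrite sumR_mull V1 Rmult_1_r.
lra.
Qed.

End Entropy.

Lemma mutinfE (A B : finType) (p : A -> B -> R) : (forall a b, 0 <= p a b) ->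
  mutinf p = \sum_a \sum_b xlog (p a b) - \sum_a xlog (\sum_b p a b)
             - \sum_b xlog (\sum_a p a b).
Proof.
move=> p0; rewrite /mutinf /rsum.
have -> : \sum_a xlog (\sum_b p a b) = \sum_a \sum_b p a b * log2 (\sum_b p a b).
  by apply: eq_bigr => a _; rewrite sumR_mulr.
have -> : \sum_b xlog (\sum_a p a b) = \sum_a \sum_b p a b * log2 (\sum_a p a b).
  by rewrite exchange_big; apply: eq_bigr => b _; rewrite sumR_mulr.
rewrite -!sumRB; apply: eq_bigr => a _; rewrite -!sumRB; apply: eq_bigr => b _.
rewrite plogqE /xlog; case: (p0 a b) => [h|<-]; last by rewrite !Rmult_0_l; lra.
have h1 : p a b <= \sum_b p a b by apply: (@le_sumR _ xpredT).
have h2 : p a b <= \sum_a p a b by apply: (@le_sumR _ xpredT (fun a => p a b)).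
rewrite log2_div ?log2_mult //; try lra.
by apply: Rmult_lt_0_compat; lra.
Qed.

Lemma cmutinfE (C A B : finType) (p : C -> A -> B -> R) : (forall c a b, 0 <= p c a b) ->
  cmutinf p = \sum_c (\sum_a \sum_b xlog (p c a b) - \sum_a xlog (\sum_b p c a b)
             - \sum_b xlog (\sum_a p c a b) + xlog (\sum_a \sum_b p c a b)).
Proof.
move=> p0; rewrite /cmutinf /rsum; apply: eq_bigr => c _.
set m := \sum_a \sum_b p c a b.
have -> : \sum_a xlog (\sum_b p c a b) = \sum_a \sum_b p c a b * log2 (\sum_b p c a b).
  by apply: eq_bigr => a _; rewrite sumR_mulr.
have -> : \sum_b xlog (\sum_a p c a b) = \sum_a \sum_b p c a b * log2 (\sum_a p c a b).
  by rewrite exchange_big; apply: eq_bigr => b _; rewrite sumR_mulr.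
have -> : xlog m = \sum_a \sum_b p c a b * log2 m.
  by rewrite /xlog {1}/m -sumR_mulr; apply: eq_bigr => s _; rewrite sumR_mulr.
rewrite -!sumRB -big_split; apply: eq_bigr => a _; rewrite -!sumRB -big_split.
apply: eq_bigr => b _ /=.
rewrite plogqE /xlog; case: (p0 c a b) => [h|<-]; last by rewrite !Rmult_0_l; lra.
have h1 : p c a b <= \sum_b p c a b by apply: (@le_sumR _ xpredT).
have h2 : p c a b <= \sum_a p c a b by apply: (@le_sumR _ xpredT (fun a => p c a b)).
have h3 : \sum_b p c a b <= m.
  by apply: (@le_sumR _ xpredT (fun a => \sum_b p c a b)) => // k _; apply: sumR_ge0.
have h4 : 0 < (\sum_b p c a b) * \sum_a p c a b by apply: Rmult_lt_0_compat; lra.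
rewrite log2_div ?log2_div ?log2_mult //; try lra.
by apply: Rdiv_lt_0_compat => //; lra.
Qed.

(** * The single-letter informations as differences of entropies *)

Section Channel.
Variables (K : nat) (X : finType) (Y : 'I_K -> finType) (W : X -> outT Y -> R).
Hypothesis HW : is_channel W.

Lemma margE j x (y : Y j) : marg W j x y = \sum_(ya : outT Y | ya j == y) W x ya.
Proof. by rewrite /marg /rsum -big_mkcond. Qed.

Lemma marg_ge0 j x y : 0 <= marg W j x y.
Proof. by rewrite margE; apply: sumR_ge0 => ya _; apply: (proj1 (HW x)). Qed.

Lemma marg_sum1 j x : \sum_y marg W j x y = 1.
Proof.
under eq_bigr do rewrite margE.
by rewrite -(sumR_fiber (fun ya : outT Y => ya j)); apply: (proj2 (HW x)).
Qed.

Lemma I_XYE (px : X -> R) j : is_pmf px ->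
  I_XY W px j = ent (marg W j) px - \sum_x px x * rowent (marg W j) x.
Proof.
case=> p0 p1; rewrite /I_XY mutinfE; last first.
  by move=> a b; apply: Rmult_le_pos => //; apply: marg_ge0.
rewrite mass_xlog_pair //; [|exact: marg_ge0|exact: marg_sum1].
have -> : \sum_x xlog (\sum_b px x * marg W j x b) = \sum_x xlog (px x).
  by apply: eq_bigr => x _; rewrite sumR_mull marg_sum1 Rmult_1_r.
by move: p1; rewrite /ent /rsum => ->; rewrite xlog1; lra.
Qed.

Lemma I_UYE (U : finType) (p : U -> X -> R) j : is_pmf2 p ->
  I_UY W p j = ent (marg W j) (fun x => \sum_u p u x) - \sum_u ent (marg W j) (p u).
Proof.
case=> p0 p1; rewrite /I_UY /rsum mutinfE; last first.
  by move=> a b; apply: sumR_ge0 => x _; apply: Rmult_le_pos => //; apply: marg_ge0.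
rewrite /ent sumRB.
have -> : \sum_x \sum_u p u x = 1 by rewrite exchange_big -[RHS]p1.
rewrite xlog1.
have -> : \sum_a xlog (\sum_b \sum_x p a x * marg W j x b) = \sum_t xlog (\sum_x p t x).
  by apply: eq_bigr => a _; rewrite out_mass //; apply: marg_sum1.
have -> : \sum_y xlog (\sum_x (\sum_u p u x) * marg W j x y) =
          \sum_y xlog (\sum_t \sum_x p t x * marg W j x y).
  apply: eq_bigr => y _; congr xlog; rewrite exchange_big; apply: eq_bigr => x _.
  by rewrite sumR_mulr.
lra.
Qed.

(** I(X;Y|U) = H(Y|U) - H(Y|X), where U drops out of the last term because the output depends on U
    only through X. *)
Lemma I_XY_given_UE (U : finType) (p : U -> X -> R) j : is_pmf2 p ->
  I_XY_given_U W p j =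
  \sum_u ent (marg W j) (p u) - \sum_x (\sum_u p u x) * rowent (marg W j) x.
Proof.
case=> p0 p1; rewrite /I_XY_given_U cmutinfE; last first.
  by move=> c a b; apply: Rmult_le_pos => //; apply: marg_ge0.
have -> : \sum_x (\sum_u p u x) * rowent (marg W j) x =
          \sum_u \sum_x p u x * rowent (marg W j) x.
  by rewrite exchange_big; apply: eq_bigr => x _; rewrite sumR_mulr.
rewrite -sumRB; apply: eq_bigr => u _.
rewrite mass_xlog_pair //; [|exact: marg_ge0|exact: marg_sum1].
have -> : \sum_x xlog (\sum_b p u x * marg W j x b) = \sum_x xlog (p u x).
  by apply: eq_bigr => x _; rewrite sumR_mull marg_sum1 Rmult_1_r.
have -> : \sum_x \sum_b p u x * marg W j x b = \sum_x p u x.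
  by apply: eq_bigr => x _; rewrite sumR_mull marg_sum1 Rmult_1_r.
by rewrite /ent; lra.
Qed.

End Channel.

(** * Carathéodory's theorem for cones *)

(** A matrix with more rows than columns has a nonzero left kernel vector; it is extended by zero
    outside [S]. *)
Lemma linear_dependence (U I : finType) (S : {set U}) (a : U -> I -> R) :
  (#|I| < #|S|)%N ->
  exists c : U -> R, (forall u, u \notin S -> c u = 0) /\ (exists u, c u <> 0) /\
    forall i, \sum_u c u * a u i = 0.
Proof.
move=> lt.
pose A : 'M[R]_(#|S|, #|I|) := (\matrix_(s, i) a (enum_val s) (enum_val i))%R.
have /rowV0Pn [v vK vn0] : kermx A != 0%R.
  by rewrite -mxrank_eq0 mxrank_ker subn_eq0 -ltnNge (leq_ltn_trans (rank_leq_col A)).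
have {}vK : (v *m A = 0)%R by apply/sub_kermxP.
have [s0 vs0] : exists s, v ord0 s <> 0.
  case: (pickP (fun s => v ord0 s != 0%R)) => [s /eqP h|h]; first by exists s.
  by case/eqP: vn0; apply/rowP => s; rewrite mxE; apply/eqP; move: (h s) => /negbFE.
exists (fun u => \sum_s (if enum_val s == u then v ord0 s else 0)); split; [|split].
- move=> u uS; apply: big1 => s _; case: eqP => // e.
  by move: uS; rewrite -e enum_valP.
- exists (enum_val s0); rewrite (bigD1 s0) //= eqxx big1 ?Rplus_0_r // => s ns.
  by case: eqP => // /enum_val_inj e; rewrite e eqxx in ns.
- move=> i; have := congr1 (fun M : 'M[R]_(1, #|I|) => M ord0 (enum_rank i)) vK.
  rewrite !mxE => h; rewrite -[RHS]h.
  under eq_bigr => u _ do rewrite -sumR_mulr.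
  rewrite exchange_big; apply: eq_bigr => s _.
  rewrite (bigD1 (enum_val s)) //= eqxx big1 ?Rplus_0_r => [|u nu]; last first.
    by rewrite eq_sym (negbTE nu) Rmult_0_l.
  by rewrite mxE enum_rankK.
Qed.

Lemma finite_min (T : finType) (P : pred T) (f : T -> R) (t0 : T) : P t0 ->
  exists2 t, P t & forall s, P s -> f t <= f s.
Proof.
move=> P0; have [t Pt tm] : exists2 t, t \in enum P & forall s, s \in enum P -> f t <= f s.
  have: enum P != [::] by apply/eqP => h; have := mem_enum P t0; rewrite h in_nil unfold_in P0.
  elim: (enum P) => // a l IH _; case: l IH => [|b l] IH.
    by exists a => [|s]; rewrite ?inE // => /eqP ->; lra.
  have [//|t tl tm] := IH.
  case: (Rle_dec (f a) (f t)) => h.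
    exists a => [|s]; rewrite ?inE ?eqxx // => /orP[/eqP ->|sl]; first lra.
    by have := tm s; rewrite inE sl => /(_ isT); lra.
  exists t => [|s]; first by rewrite inE tl orbT.
  by rewrite inE => /orP[/eqP ->|/tm //]; lra.
by exists t => [|s Ps]; [move: Pt; rewrite mem_enum | apply: tm; rewrite mem_enum].
Qed.

Definition supp (U : finType) (w : U -> R) : {set U} := [set u | w u != 0].

(** While the support exceeds [#|I|], the vectors on it are dependent. Moving the weights along a
    dependence until one of them reaches zero keeps all sums and shrinks the support. The initial
    weights are 1. *)
Lemma conic_caratheodory (U I : finType) (a : U -> I -> R) :
  exists w : U -> R, (forall u, 0 <= w u) /\
    (#|supp w| <= #|I|)%N /\
    forall i, \sum_u w u * a u i = \sum_u a u i.
Proof.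
suff H m : forall w : U -> R, (forall u, 0 <= w u) -> (#|supp w| <= m)%N ->
    exists w' : U -> R, (forall u, 0 <= w' u) /\ (#|supp w'| <= #|I|)%N /\
      forall i, \sum_u w' u * a u i = \sum_u w u * a u i.
  have [||w [w0 [wc wi]]] := H #|U| (fun=> 1); [by move=> u; lra | exact: max_card |].
  by exists w; split=> //; split=> // i; rewrite wi; apply: eq_bigr => u _; rewrite Rmult_1_l.
elim: m => [|m IH] w w0 wm.
  by exists w; split=> //; split=> //; apply: leq_trans wm _.
case: (leqP #|supp w| #|I|) => [h|h]; first by exists w.
have [c0 [c0S [[u1 c0u] c0a]]] := linear_dependence a h.
(* The sign of the dependence is chosen so that some coefficient is positive; the minimum ratio
   below needs a candidate. *)
have [c [cS [[u2 cu] ca]]] : exists c : U -> R, (forall u, w u = 0 -> c u = 0) /\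
   (exists u, 0 < c u) /\ forall i, \sum_u c u * a u i = 0.
  have z u : w u = 0 -> c0 u = 0 by move=> e; apply: c0S; rewrite inE e eqxx.
  case: (Rlt_le_dec 0 (c0 u1)) => hu.
    by exists c0; split=> //; split=> //; exists u1.
  exists (fun u => - c0 u); split; first by move=> u /z ->; lra.
  split; first by exists u1; lra.
  move=> i; under eq_bigr => u _ do rewrite Ropp_mult_distr_l_reverse.
  by rewrite sumRN c0a; lra.
have [t ct tm] := @finite_min U (fun u => Rlt_dec 0 (c u)) (fun u => w u / c u) u2
  (introT (sumboolP _) cu).
have {}ct : 0 < c t by case: (Rlt_dec 0 (c t)) ct.
(* The largest step that leaves every weight nonnegative; it cancels the weight of [t]. *)
pose r := w t / c t.
have r0 : 0 <= r by apply: Rmult_le_pos => //; apply/Rlt_le/Rinv_0_lt_compat.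
have w'0 u : 0 <= w u - r * c u.
  case: (Rlt_le_dec 0 (c u)) => hu; last by have := w0 u; nra.
  have h1 : r <= w u / c u by apply: (tm u (introT (sumboolP _) hu)).
  have : r * c u <= w u / c u * c u by apply: Rmult_le_compat_r; lra.
  have -> : w u / c u * c u = w u by field; lra.
  lra.
have [|w' [w'1 [w'2 w'3]]] := IH (fun u => w u - r * c u) w'0.
  rewrite -ltnS; apply: leq_trans wm; apply: proper_card; apply/properP; split.
    apply/subsetP => u; rewrite !inE; apply: contra => /eqP e.
    by rewrite e (cS _ e); apply/eqP; lra.
  exists t; rewrite !inE.
    by apply/eqP => e; move: ct; rewrite (cS _ e); lra.
  by have -> : w t - r * c t = 0; [rewrite /r; field; lra | rewrite eqxx].
exists w'; split=> //; split=> // i; rewrite w'3.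
transitivity (\sum_u (w u * a u i - r * (c u * a u i))).
  by apply: eq_bigr => u _; ring.
by rewrite sumRB sumR_mull ca; lra.
Qed.

(** Moves a sum from a small support to the first [d] ordinals, padded by zeros, so that all reduced
    laws share one alphabet. *)
Lemma sum_support_ord (U : finType) (S : {set U}) (u0 : U) (d : nat) (F : U -> R) :
  (#|S| <= d)%N -> (forall u, u \notin S -> F u = 0) ->
  \sum_(k < d) (if (k < #|S|)%N then F (nth u0 (enum S) k) else 0) = \sum_u F u.
Proof.
move=> le F0; rewrite sumR_if.
rewrite -(big_ord_widen _ (fun k => F (nth u0 (enum S) k)) le).
have -> : #|S| = size (enum S) by rewrite cardE.
rewrite -(big_mkord xpredT (fun k => F (nth u0 (enum S) k))) -(big_nth u0 xpredT F).
rewrite big_enum /= [RHS](bigID (mem S)) /= [X in _ = _ + X]big1 ?Rplus_0_r //.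
Qed.

(** When each slice p(u,.) is reweighted, the [#|X|] input masses and, by homogeneity, the [K]
    output entropies are linear in the weights. They determine every information in the region, and
    the new alphabet does not depend on [p]. *)
Lemma reduce_cardinality (K : nat) (X : finType) (Y : 'I_K -> finType)
    (W : X -> outT Y -> R) (HW : is_channel W) (U : finType) (p : U -> X -> R) :
  is_pmf2 p -> exists p' : 'I_(#|X| + K) -> X -> R, is_pmf2 p' /\
    (forall x, \sum_u p' u x = \sum_u p u x) /\
    forall j, \sum_u ent (marg W j) (p' u) = \sum_u ent (marg W j) (p u).
Proof.
case=> p0 p1.
have [u0 _] : exists u : U, true.
  case: (pickP (fun=> true) : pick_spec (fun _ : U => true) _) => [u _|h]; first by exists u.
  by exfalso; move: p1; rewrite /rsum big_pred0 //; lra.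
have [w [w0 [wc wi]]] := @conic_caratheodory U (X + 'I_K)%type
  (fun u i => match i with inl x => p u x | inr j => ent (marg W j) (p u) end).
rewrite card_sum card_ord in wc.
set S := supp w in wc.
pose p' (k : 'I_(#|X| + K)) x :=
  if (k < #|S|)%N then w (nth u0 (enum S) k) * p (nth u0 (enum S) k) x else 0.
have wS u : u \notin S -> w u = 0 by rewrite inE negbK => /eqP.
have px x : \sum_k p' k x = \sum_u p u x.
  rewrite -[RHS](wi (inl x)) -(@sum_support_ord _ S u0 (#|X| + K)) //.
  by move=> u /wS ->; rewrite Rmult_0_l.
have V0 j := @marg_ge0 _ _ _ _ HW j; have V1 j := @marg_sum1 _ _ _ _ HW j.
exists p'; split; [split|split=> // j].
- move=> k x; rewrite /p'; case: ifP => _; last lra.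
  exact: Rmult_le_pos.
- rewrite /rsum exchange_big /=; transitivity (\sum_x \sum_u p u x).
    by apply: eq_bigr => x _; apply: px.
  by rewrite exchange_big.
rewrite -[RHS](wi (inr j)) -(@sum_support_ord _ S u0 (#|X| + K)) //; last first.
  by move=> u /wS ->; rewrite Rmult_0_l.
apply: eq_bigr => k _; rewrite /p'; case: ifP => _; first by rewrite ent_scale.
have -> : ent (marg W j) (fun=> 0) = ent (marg W j) (fun x : X => 0 * 0).
  by apply: eq_ent => x; rewrite Rmult_0_l.
by rewrite ent_scale //=; [rewrite Rmult_0_l | lra | move=> _; lra].
Qed.

(** * Compactness and continuity *)

(** Domination of the identity replaces monotonicity of [phi]: it suffices for limits and is stable
    under composition. *)
Lemma Un_cv_sub (u : nat -> R) l (phi : nat -> nat) :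
  (forall n, (n <= phi n)%N) -> Un_cv u l -> Un_cv (fun n => u (phi n)) l.
Proof.
move=> h cv e e0; have [N HN] := cv e e0; exists N => n nN; apply: HN.
by apply/leP; apply: leq_trans (h n); apply/leP.
Qed.

Lemma cluster_subseq (u : nat -> R) : (forall n, 0 <= u n <= 1) ->
  exists (phi : nat -> nat) (l : R), (forall n, (n <= phi n)%N) /\ Un_cv (fun n => u (phi n)) l.
Proof.
move=> h; have [l Hl] := Bolzano_Weierstrass u _ (compact_P3 0 1) h.
have H n : exists m, (n <= m)%N /\ Rabs (u m - l) < / (INR n + 1).
  have i0 : 0 < / (INR n + 1) by apply: Rinv_0_lt_compat; have := pos_INR n; lra.
  have [|m [nm Hm]] := Hl (disc l (mkposreal _ i0)) n.
    by exists (mkposreal _ i0).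
  by exists m; split=> //; apply/leP.
exists (fun n => proj1_sig (constructive_indefinite_description _ (H n))), l.
split=> [n|e e0]; first by case: constructive_indefinite_description => m [].
have [N [HN N0]] := archimed_cor1 e e0; exists N => n nN.
case: constructive_indefinite_description => m [_ /= Hm].
rewrite /Rdist; apply: Rlt_trans Hm _; apply: Rle_lt_trans HN.
apply: Rinv_le_contravar; first exact: lt_0_INR.
by have := le_INR _ _ nN; lra.
Qed.

Lemma cluster_subseq_fin (T : finType) (v : nat -> T -> R) :
  (forall n t, 0 <= v n t <= 1) ->
  exists (phi : nat -> nat) (l : T -> R),
    (forall n, (n <= phi n)%N) /\ forall t, Un_cv (fun n => v (phi n) t) (l t).
Proof.
move=> h; suff [phi [l [H1 H2]]] : exists (phi : nat -> nat) (l : T -> R),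
    (forall n, (n <= phi n)%N) /\
    forall t, t \in enum T -> Un_cv (fun n => v (phi n) t) (l t).
  by exists phi, l; split=> // t; apply: H2; rewrite mem_enum.
elim: (enum T) => [|a s [phi [l [H1 H2]]]].
  by exists id, (fun=> 0); split.
have [psi [la [H3 H4]]] := cluster_subseq (fun n => h (phi n) a).
exists (fun n => phi (psi n)), (fun t => if t == a then la else l t); split.
  by move=> n; apply: leq_trans (H3 n) (H1 _).
move=> t; rewrite inE; case: eqP => [->|_] //= ts.
exact: (Un_cv_sub H3 (H2 t ts)).
Qed.

Lemma Un_cv_sum (T : finType) (u : nat -> T -> R) (l : T -> R) :
  (forall t, Un_cv (fun n => u n t) (l t)) ->
  Un_cv (fun n => \sum_t u n t) (\sum_t l t).
Proof.
move=> h; elim: (index_enum T) => [|a s IH].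
  rewrite big_nil => e e0; exists 0%N => n _; rewrite big_nil /Rdist Rminus_diag Rabs_R0 //.
rewrite big_cons => e e0; have [N HN] := CV_plus _ _ _ _ (h a) IH e e0.
by exists N => n nN; rewrite big_cons; apply: HN.
Qed.

Lemma Un_cv_const c : Un_cv (fun=> c) c.
Proof. by move=> e e0; exists 0%N => n _; rewrite /Rdist Rminus_diag Rabs_R0. Qed.

Lemma Un_cv_mulr u l c : Un_cv u l -> Un_cv (fun n => u n * c) (l * c).
Proof. by move=> h; apply: CV_mult h (Un_cv_const c). Qed.

(** From ln x = -2 ln (1 / sqrt x) and ln z <= z - 1. It serves as a modulus of continuity of [xlog]
    at 0, where ln is unbounded. *)
Lemma xlog_sqrt_bound x : 0 < x <= 1 -> Rabs (xlog x) <= 2 / ln 2 * sqrt x.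
Proof.
move=> [x0 x1]; have l0 := ln2_gt0; have i0 : 0 < / ln 2 by apply: Rinv_0_lt_compat.
have s0 := sqrt_lt_R0 x x0; have ss := sqrt_sqrt x (Rlt_le _ _ x0).
have e : ln x = - (2 * ln (/ sqrt x)).
  by rewrite ln_Rinv // -{1}ss ln_mult //; ring.
have h := ln_le_sub1 (Rinv_0_lt_compat _ s0).
have lx : ln x <= 0 by have := ln_le_sub1 x0; lra.
have -> : Rabs (xlog x) = x * - ln x * / ln 2.
  rewrite /xlog /log2 Rabs_left1; first by rewrite /Rdiv; ring.
  have : 0 <= x * (- ln x * / ln 2).
    by apply: Rmult_le_pos; [lra | apply: Rmult_le_pos; lra].
  by rewrite /Rdiv; lra.
have -> : 2 / ln 2 * sqrt x = 2 * sqrt x * / ln 2 by rewrite /Rdiv; ring.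
apply: Rmult_le_compat_r; first lra.
have : x * (- ln x) <= x * (2 * / sqrt x) by apply: Rmult_le_compat_l; lra.
have -> : x * (2 * / sqrt x) = 2 * sqrt x by rewrite -{1}ss; field; lra.
lra.
Qed.

Lemma Un_cv_xlog u l : (forall n, 0 <= u n) -> Un_cv u l ->
  Un_cv (fun n => xlog (u n)) (xlog l).
Proof.
move=> u0 cv.
have l0 : 0 <= l.
  case: (Rlt_le_dec l 0) => // h; have [|N HN] := cv (- l); first lra.
  have := HN N (le_n N); rewrite /Rdist => /Rabs_def2 [_ _]; have := u0 N => ?.
  by have := HN N (le_n N); rewrite /Rdist Rabs_right; lra.
case: l0 => [l0|l0].
  apply: CV_mult => //; apply: Un_cv_mulr.
  apply: (continuity_seq ln) => //; apply: derivable_continuous_pt.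
  by exists (/ l); apply: derivable_pt_lim_ln.
rewrite -l0 xlog0 => e e0.
have c0 : 0 < 2 / ln 2 by apply: Rdiv_lt_0_compat; [lra | exact: ln2_gt0].
pose d := e / (2 / ln 2).
have d0 : 0 < d by apply: Rdiv_lt_0_compat.
have [|N HN] := cv (Rmin 1 (d * d)).
  by apply: Rmin_Rgt_r; split; [lra | apply: Rmult_lt_0_compat].
exists N => n nN; have := HN n nN; rewrite /Rdist -l0 !Rminus_0_r.
rewrite Rabs_right; last by apply/Rle_ge/u0.
move=> h; have h1 := Rmin_l 1 (d * d); have h2 := Rmin_r 1 (d * d).
case: (u0 n) => [un0|<-]; last by rewrite xlog0 Rabs_R0.
apply: Rle_lt_trans (xlog_sqrt_bound _) _; first by lra.
have hs : sqrt (u n) < d.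
  by rewrite -(sqrt_square d); [apply: sqrt_lt_1_alt; lra | lra].
have -> : e = 2 / ln 2 * d by rewrite /d; have := ln2_gt0 => ?; field; lra.
exact: Rmult_lt_compat_l.
Qed.

Lemma Un_cv_ent (X B : finType) (V : X -> B -> R) (q : nat -> X -> R) (l : X -> R) :
  (forall x y, 0 <= V x y) -> (forall n x, 0 <= q n x) ->
  (forall x, Un_cv (fun n => q n x) (l x)) ->
  Un_cv (fun n => ent V (q n)) (ent V l).
Proof.
move=> V0 q0 cv; apply: CV_minus.
  by apply: Un_cv_xlog; [move=> n; apply: sumR_ge0 | apply: Un_cv_sum].
apply: Un_cv_sum => y; apply: Un_cv_xlog.
  by move=> n; apply: out_ge0.
by apply: Un_cv_sum => x; apply: Un_cv_mulr.
Qed.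

Lemma Un_cv_ge u l a : Un_cv u l -> (forall n, a - / (INR n + 1) <= u n) -> a <= l.
Proof.
move=> cv h; case: (Rle_lt_dec a l) => // la.
pose e := (a - l) / 2; have e0 : 0 < e by rewrite /e; lra.
have [N HN] := cv e e0; have [M [HM M0]] := archimed_cor1 e e0.
pose n := maxn N M; have nN : (n >= N)%coq_nat by apply/leP/leq_maxl.
have nM : (n >= M)%coq_nat by apply/leP/leq_maxr.
have i : / (INR n + 1) <= / INR M.
  by apply: Rinv_le_contravar; [apply: lt_0_INR | have := le_INR _ _ nM; lra].
have := HN n nN; rewrite /Rdist => /Rabs_def2 [h1 h2]; have := h n.
by rewrite /e in h1 h2 HM; lra.
Qed.

(** * Closedness of the single-letter bounds *)

Section Closed.
Variables (K : nat) (X : finType) (Y : 'I_K -> finType) (W : X -> outT Y -> R).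
Hypothesis HW : is_channel W.

Definition rate_bounds (U : finType) (p : U -> X -> R) (r2 r12 : R) : Prop :=
  (forall jK : 'I_K, rcv jK = K -> r2 <= I_UY W p jK) /\
  (forall j jK : 'I_K, (rcv j <= K.-1)%N -> rcv jK = K ->
     r12 <= I_XY_given_U W p j + I_UY W p jK) /\
  (forall jK1 : 'I_K, rcv jK1 = K.-1 -> r12 <= I_XY W (fun x => \sum_u p u x) jK1).

Lemma pmf2_marg (U : finType) (p : U -> X -> R) : is_pmf2 p ->
  is_pmf (fun x => \sum_u p u x).
Proof.
by case=> p0 p1; split=> [x|]; [apply: sumR_ge0 | rewrite /rsum exchange_big].
Qed.

(** The approximating laws may have alphabets of any size. Reduced to one alphabet they lie in a
    compact cube, and a cluster point inherits the bounds because the informations are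
    continuous. *)
Lemma rate_bounds_closed r2 r12 :
  (forall d, 0 < d -> exists (U : finType) (p : U -> X -> R),
     is_pmf2 p /\ rate_bounds p (r2 - d) (r12 - d)) ->
  exists (U : finType) (p : U -> X -> R), is_pmf2 p /\ rate_bounds p r2 r12.
Proof.
move=> H.
have V0 j := @marg_ge0 _ _ _ _ HW j.
have H' n : exists p : 'I_(#|X| + K) -> X -> R,
    is_pmf2 p /\ rate_bounds p (r2 - / (INR n + 1)) (r12 - / (INR n + 1)).
  have i0 : 0 < / (INR n + 1) by apply: Rinv_0_lt_compat; have := pos_INR n; lra.
  have [U [p [hp [h1 [h2 h3]]]]] := H _ i0.
  have [p' [hp' [hx he]]] := reduce_cardinality HW hp.
  have hx' : (fun x => \sum_u p' u x) = (fun x => \sum_u p u x).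
    exact: functional_extensionality.
  exists p'; split=> //; split=> [jK e|]; last split=> [j jK e e'|jK1 e].
  - by rewrite I_UYE // he hx' -I_UYE //; apply: h1.
  - rewrite I_UYE // I_XY_given_UE // !he hx'.
    under [\sum_x _ * _]eq_bigr => x _ do rewrite hx.
    by rewrite -I_UYE // -I_XY_given_UE //; apply: h2.
  - by rewrite hx'; apply: h3.
pose P n := proj1_sig (constructive_indefinite_description _ (H' n)).
have HP n : is_pmf2 (P n) /\ rate_bounds (P n) (r2 - / (INR n + 1)) (r12 - / (INR n + 1)).
  by rewrite /P; case: constructive_indefinite_description.
have P0 n u x : 0 <= P n u x by case: (HP n) => -[].
have Pbnd n (t : 'I_(#|X| + K) * X) : 0 <= P n t.1 t.2 <= 1.
  split; first exact: P0.
  have [[_ <-] _] := HP n; rewrite /rsum.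
  apply: Rle_trans (@le_sumR _ xpredT (fun u => \sum_x P n u x) t.1 isT _).
    by apply: (@le_sumR _ xpredT (P n t.1)).
  by move=> u _; apply: sumR_ge0.
have [phi [l [Hphi Hl]]] := cluster_subseq_fin Pbnd.
pose p u x := l (u, x).
have cv u x : Un_cv (fun n => P (phi n) u x) (p u x) by apply: (Hl (u, x)).
have cvX x : Un_cv (fun n => \sum_u P (phi n) u x) (\sum_u p u x).
  by apply: Un_cv_sum => u; apply: cv.
have hp : is_pmf2 p.
  split=> [u x|].
    have c := Rle_cv_lim (fun n => P0 (phi n) u x) (Un_cv_const 0) (cv u x).
    exact: c.
  apply: (UL_sequence (fun n => \sum_u \sum_x P (phi n) u x)).
    by apply: Un_cv_sum => u; apply: Un_cv_sum.
  have -> : (fun n => \sum_u \sum_x P (phi n) u x) = (fun=> 1).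
    by apply: functional_extensionality => n; case: (HP (phi n)) => -[].
  exact: Un_cv_const.
have cvE j : Un_cv (fun n => \sum_u ent (marg W j) (P (phi n) u)) (\sum_u ent (marg W j) (p u)).
  by apply: Un_cv_sum => u; apply: Un_cv_ent.
have cvEX j : Un_cv (fun n => ent (marg W j) (fun x => \sum_u P (phi n) u x))
                    (ent (marg W j) (fun x => \sum_u p u x)).
  by apply: Un_cv_ent => // n x; apply: sumR_ge0.
have cvF j : Un_cv (fun n => \sum_x (\sum_u P (phi n) u x) * rowent (marg W j) x)
                   (\sum_x (\sum_u p u x) * rowent (marg W j) x).
  by apply: Un_cv_sum => x; apply: Un_cv_mulr.
have HPp n := proj1 (HP (phi n)).
have cvUY j : Un_cv (fun n => I_UY W (P (phi n)) j) (I_UY W p j).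
  rewrite I_UYE // (functional_extensionality (fun n => I_UY W (P (phi n)) j) _
    (fun n => I_UYE HW j (HPp n))); exact: CV_minus.
have cvXYU j : Un_cv (fun n => I_XY_given_U W (P (phi n)) j) (I_XY_given_U W p j).
  rewrite I_XY_given_UE // (functional_extensionality (fun n => I_XY_given_U W (P (phi n)) j) _
    (fun n => I_XY_given_UE HW j (HPp n))); exact: CV_minus.
have cvXY j : Un_cv (fun n => I_XY W (fun x => \sum_u P (phi n) u x) j)
                    (I_XY W (fun x => \sum_u p u x) j).
  rewrite I_XYE; [|exact: HW|exact: pmf2_marg].
  rewrite (functional_extensionality (fun n => I_XY W (fun x => \sum_u P (phi n) u x) j) _
    (fun n => I_XYE HW j (pmf2_marg (HPp n)))); exact: CV_minus.
have slack n : / (INR (phi n) + 1) <= / (INR n + 1).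
  apply: Rinv_le_contravar; first by have := pos_INR n; lra.
  by have := le_INR _ _ (elimT leP (Hphi n)); lra.
exists 'I_(#|X| + K), p; split=> //; split=> [jK e|]; last split=> [j jK e e'|jK1 e].
- apply: (Un_cv_ge (cvUY jK)) => n.
  by have [_ [/(_ jK e) h _]] := HP (phi n); have := slack n; lra.
- apply: (Un_cv_ge (CV_plus _ _ _ _ (cvXYU j) (cvUY jK))) => n.
  by have [_ [_ [/(_ j jK e e') h _]]] := HP (phi n); have := slack n; lra.
- apply: (Un_cv_ge (cvXY jK1)) => n.
  by have [_ [_ [_ /(_ jK1 e) h]]] := HP (phi n); have := slack n; lra.
Qed.

End Closed.

(** * Entropy of finite random variables *)

Section Prob.
Variables (Om : finType) (P : Om -> R).
Hypothesis P0 : forall w, 0 <= P w.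
Hypothesis P1 : \sum_w P w = 1.

Definition pr (T : finType) (f : Om -> T) (t : T) : R := \sum_(w | f w == t) P w.
Definition entropy (T : finType) (f : Om -> T) : R := - \sum_t xlog (pr f t).

Lemma pr_ge0 (T : finType) (f : Om -> T) t : 0 <= pr f t.
Proof. exact: sumR_ge0. Qed.

Lemma sum_pr (T : finType) (f : Om -> T) (F : T -> R) :
  \sum_t pr f t * F t = \sum_w P w * F (f w).
Proof.
rewrite [RHS](sumR_fiber f); apply: eq_bigr => t _; rewrite -sumR_mulr.
by apply: eq_bigr => w /eqP ->.
Qed.

(** Entropy depends only on the partition that a variable induces. Tuples can thus be regrouped
    without bijections between their codomains. *)
Lemma H_kernel (T T' : finType) (f : Om -> T) (g : Om -> T') :
  (forall w w', (f w == f w') = (g w == g w')) -> entropy f = entropy g.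
Proof.
move=> h; rewrite /entropy /xlog; congr (- _).
rewrite (sum_pr f (fun t => log2 (pr f t))) (sum_pr g (fun t => log2 (pr g t))).
by apply: eq_bigr => w _; congr (_ * log2 _); apply: eq_bigl => w'; apply: h.
Qed.

Lemma H_uniform (T : finType) (f : Om -> T) : (0 < #|T|)%N ->
  (forall t, pr f t = / INR #|T|) -> entropy f = log2 (INR #|T|).
Proof.
move=> T0 h; have N0 : 0 < INR #|T| by apply: lt_0_INR; apply/leP.
rewrite /entropy; under eq_bigr => t _ do rewrite h.
by rewrite sumR_const /xlog log2_inv //; field; lra.
Qed.

(* Gibbs' inequality against the conditional law which gives mass 1/2 to the estimate and
   spreads the other half uniformly. *)
Lemma fano (M T : finType) (f : Om -> M) (V : Om -> T) (g : Om -> M) :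
  (forall w w', V w = V w' -> g w = g w') ->
  entropy (fun w => (f w, V w)) - entropy V <=
  1 + (\sum_(w | g w != f w) P w) * log2 (INR #|M|).
Proof.
move=> gV.
(* The estimate as a function of the observed value; it is [None] only at values that are never
   taken. *)
pose h v := omap g [pick w | V w == v].
have hV w : h (V w) = Some (g w).
  rewrite /h; case: pickP => [w' /eqP /gV e|/(_ w)] /=; by rewrite ?e ?eqxx.
pose N := INR #|M|.
pose q m v := if h v == Some m then / 2 else / (2 * N).
pose a m v := pr (fun w => (f w, V w)) (m, v).
have a0 m v : 0 <= a m v by apply: pr_ge0.
have bE v : pr V v = \sum_m a m v.
  rewrite /pr (partition_big f xpredT) //=; apply: eq_bigr => m _.
  by apply: eq_bigl => w; rewrite xpair_eqE andbC.
have ab m v : a m v <= pr V v.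
  by rewrite bE; apply: (@le_sumR _ xpredT (fun m => a m v)).
have Npos (m : M) : 0 < N by apply: lt_0_INR; apply/leP/card_gt0P; exists m.
have qpos m v : 0 < q m v.
  rewrite /q; have := Npos m; case: ifP => _ ?; [lra|].
  by apply: Rinv_0_lt_compat; lra.
have qsum v : \sum_m q m v <= 1.
  apply: (@Rle_trans _ (\sum_m ((if h v == Some m then / 2 else 0) + / (2 * N)))).
    apply: leR_sum => m _; rewrite /q; have Nm := Npos m.
    have : 0 < / (2 * N) by apply: Rinv_0_lt_compat; lra.
    by case: ifP => _; lra.
  rewrite big_split /= sumR_const.
  have l1 : \sum_m (if h v == Some m then / 2 else 0) <= / 2.
    case: (h v) => [m0|]; last by rewrite big1 //; lra.
    rewrite (bigD1 m0) //= eqxx big1 => [|m nm]; first lra.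
    by case: eqP => // -[e]; rewrite e eqxx in nm.
  have l2 : INR #|M| * / (2 * N) <= / 2.
    rewrite -/N; case: (Rle_lt_dec N 0) => Nn.
      have -> : N = 0 by have : 0 <= N := pos_INR _; lra.
      by lra.
    by have -> : N * / (2 * N) = / 2; [field; lra | lra].
  lra.
have key m v : (a m v - q m v * pr V v) / ln 2 <=
    xlog (a m v) - a m v * log2 (q m v) - a m v * log2 (pr V v).
  have b0 := pr_ge0 V v; have qm := qpos m v; have am := ab m v.
  have qb0 : 0 <= q m v * pr V v by apply: Rmult_le_pos; lra.
  have hz : q m v * pr V v = 0 -> a m v = 0.
    by case/Rmult_integral => e; [lra | have := a0 m v; lra].
  have := gibbs (a0 m v) qb0 hz.
  case: (a0 m v) => [ap|<-]; last by rewrite xlog0; lra.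
  by rewrite log2_mult //; [rewrite /xlog; lra | lra].
have S : \sum_v \sum_m (a m v - q m v * pr V v) / ln 2 <=
    \sum_v \sum_m (xlog (a m v) - a m v * log2 (q m v) - a m v * log2 (pr V v)).
  by apply: leR_sum => v _; apply: leR_sum => m _; apply: key.
have L : 0 <= \sum_v \sum_m (a m v - q m v * pr V v) / ln 2.
  apply: sumR_ge0 => v _; rewrite sumR_mulr sumRB -bE sumR_mulr.
  apply: Rmult_le_pos; last by apply/Rlt_le/Rinv_0_lt_compat/ln2_gt0.
  by have := qsum v; have := pr_ge0 V v; nra.
have E : \sum_v \sum_m (xlog (a m v) - a m v * log2 (q m v) - a m v * log2 (pr V v)) =
   - entropy (fun w => (f w, V w)) - \sum_w P w * log2 (q (f w) (V w)) + entropy V.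
  have -> : entropy (fun w => (f w, V w)) = - \sum_v \sum_m xlog (a m v).
    by rewrite /entropy exchange_big pair_bigA; congr (- _); apply: eq_bigr => -[].
  have -> : entropy V = - \sum_v \sum_m a m v * log2 (pr V v).
    by rewrite /entropy; congr (- _); apply: eq_bigr => v _; rewrite sumR_mulr -bE.
  have -> : \sum_w P w * log2 (q (f w) (V w)) = \sum_v \sum_m a m v * log2 (q m v).
    rewrite -(sum_pr (fun w => (f w, V w)) (fun mv => log2 (q mv.1 mv.2))).
    by rewrite exchange_big pair_bigA; apply: eq_bigr => -[].
  have -> : \sum_v \sum_m (xlog (a m v) - a m v * log2 (q m v) - a m v * log2 (pr V v)) =
     \sum_v (\sum_m xlog (a m v) - \sum_m a m v * log2 (q m v) - \sum_m a m v * log2 (pr V v)).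
    by apply: eq_bigr => v _; rewrite !sumRB.
  by rewrite !sumRB; lra.
(* The reference law costs one bit where the estimate is right and 1 + log2 N bits where it is
   wrong. *)
have Q : - \sum_w P w * log2 (q (f w) (V w)) =
   1 + (\sum_(w | g w != f w) P w) * log2 N.
  rewrite -P1 -sumR_mulr [X in _ = _ + X]big_mkcond -big_split -sumRN.
  apply: eq_bigr => w _ /=; rewrite /q hV (inj_eq (@Some_inj _)).
  have l2 : log2 2 = 1 by rewrite /log2; have := ln2_gt0 => ?; field; lra.
  have Nw := Npos (f w).
  case: eqP => _ /=; first by rewrite log2_inv ?l2; lra.
  by rewrite log2_inv ?log2_mult ?l2; lra.
by rewrite -/N; move: S L; rewrite E; lra.
Qed.

End Prob.

(** * Conditional forms of the two channel orders *)

Section Orders.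
Variables (K : nat) (X : finType) (Y : 'I_K -> finType) (W : X -> outT Y -> R).
Hypothesis HW : is_channel W.
Let V0 j := @marg_ge0 _ _ _ _ HW j.
Let V1 j := @marg_sum1 _ _ _ _ HW j.

Lemma ent_zero j (q : X -> R) : (forall x, q x = 0) -> ent (marg W j) q = 0.
Proof.
move=> h; have -> : ent (marg W j) q = ent (marg W j) (fun x : X => 0 * 0).
  by apply: eq_ent => x; rewrite h Rmult_0_l.
by rewrite ent_scale //; [rewrite Rmult_0_l | lra | move=> _; lra].
Qed.

(** The order speaks of pmfs only; both sides are homogeneous, so division by the total mass reduces
    to that case. *)
Lemma less_noisy_ent s k (T : finType) (p : T -> X -> R) :
  less_noisy W s k -> (forall t x, 0 <= p t x) ->
  ent (marg W k) (fun x => \sum_t p t x) - \sum_t ent (marg W k) (p t) <=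
  ent (marg W s) (fun x => \sum_t p t x) - \sum_t ent (marg W s) (p t).
Proof.
move=> ln p0; pose m := \sum_t \sum_x p t x.
have m0 : 0 <= m by apply: sumR_ge0 => t _; apply: sumR_ge0.
case: m0 => [m0|m0]; last first.
  have pz t x : p t x = 0.
    have h : \sum_x p t x = 0.
      apply: (@sumR_eq0 _ xpredT (fun t => \sum_x p t x)) => // t' _.
      exact: sumR_ge0.
    exact: (@sumR_eq0 _ xpredT (p t)).
  have z j : \sum_t ent (marg W j) (p t) = 0.
    by apply: big1 => t _; apply: ent_zero.
  have z' j : ent (marg W j) (fun x => \sum_t p t x) = 0.
    by apply: ent_zero => x; apply: big1.
  by rewrite !z !z'; lra.
have i0 : 0 < / m by apply: Rinv_0_lt_compat.
have hp : is_pmf2 (fun t x => / m * p t x).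
  split=> [t x|]; first by apply: Rmult_le_pos => //; lra.
  rewrite /rsum; under eq_bigr => t _ do rewrite sumR_mull.
  by rewrite sumR_mull -/m; field; lra.
have := ln T _ hp; rewrite !I_UYE //.
have e j : ent (marg W j) (fun x => \sum_t / m * p t x) - \sum_t ent (marg W j) (fun x => / m * p t x)
   = / m * (ent (marg W j) (fun x => \sum_t p t x) - \sum_t ent (marg W j) (p t)).
  rewrite Rmult_minus_distr_l -sumR_mull; congr (_ - _).
    rewrite -ent_scale //; [|lra|by move=> x; apply: sumR_ge0].
    by apply: eq_ent => x; rewrite sumR_mull.
  by apply: eq_bigr => t _; rewrite ent_scale //; lra.
by rewrite !e => /Rmult_le_reg_l; apply.
Qed.

Lemma more_capable_ent s k (q : X -> R) :
  more_capable W s k -> (forall x, 0 <= q x) ->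
  ent (marg W k) q - \sum_x q x * rowent (marg W k) x <=
  ent (marg W s) q - \sum_x q x * rowent (marg W s) x.
Proof.
move=> mc q0; pose m := \sum_x q x.
have m0 : 0 <= m by apply: sumR_ge0.
case: m0 => [m0|m0]; last first.
  have qz x : q x = 0 by apply: (@sumR_eq0 _ xpredT q).
  by rewrite !ent_zero // !big1 //; [lra | |] => x _; rewrite qz Rmult_0_l.
have i0 : 0 < / m by apply: Rinv_0_lt_compat.
have hq : is_pmf (fun x => / m * q x).
  split=> [x|]; first by apply: Rmult_le_pos => //; lra.
  by rewrite /rsum sumR_mull -/m; field; lra.
have := mc _ hq; rewrite !I_XYE //.
have e j : ent (marg W j) (fun x => / m * q x) - \sum_x / m * q x * rowent (marg W j) x
   = / m * (ent (marg W j) q - \sum_x q x * rowent (marg W j) x).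
  rewrite Rmult_minus_distr_l -sumR_mull ent_scale //; [congr (_ - _)|lra].
  by apply: eq_bigr => x _; ring.
by rewrite !e => /Rmult_le_reg_l; apply.
Qed.

Section Coarsen.
Variables (T T' : finType) (phi : T' -> T) (p : T' -> X -> R).
Hypothesis p0 : forall t x, 0 <= p t x.

Let split_p (v : T) (v' : T') x := if phi v' == v then p v' x else 0.

Let split_ge0 v v' x : 0 <= split_p v v' x.
Proof. by rewrite /split_p; case: ifP => _; [apply: p0 | lra]. Qed.

Let fiber_sum v : (fun x => \sum_(v' | phi v' == v) p v' x) = (fun x => \sum_v' split_p v v' x).
Proof. by apply: functional_extensionality => x; rewrite big_mkcond. Qed.

Let ent_split j : \sum_v' ent (marg W j) (p v') = \sum_v \sum_v' ent (marg W j) (split_p v v').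
Proof.
rewrite (sumR_fiber phi); apply: eq_bigr => v _; rewrite big_mkcond; apply: eq_bigr => v' _.
rewrite /split_p; case: ifP => // _; by rewrite ent_zero.
Qed.

(** H(Y|V') <= H(Y|V) when V is the function [phi] of V': superadditivity on each fiber. *)
Lemma ent_coarsen j : \sum_v' ent (marg W j) (p v') <=
  \sum_v ent (marg W j) (fun x => \sum_(v' | phi v' == v) p v' x).
Proof.
rewrite ent_split; apply: leR_sum => v _; rewrite fiber_sum; exact: ent_superadd.
Qed.

(** The conditional form I(V';Y_k|V) <= I(V';Y_s|V), obtained by applying the order on each fiber of
    [phi], that is, for each value of V. *)
Lemma less_noisy_coarsen s k : less_noisy W s k ->
  \sum_v ent (marg W k) (fun x => \sum_(v' | phi v' == v) p v' x)
    - \sum_v' ent (marg W k) (p v') <=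
  \sum_v ent (marg W s) (fun x => \sum_(v' | phi v' == v) p v' x)
    - \sum_v' ent (marg W s) (p v').
Proof.
move=> ln; rewrite !ent_split -!sumRB; apply: leR_sum => v _; rewrite fiber_sum.
exact: less_noisy_ent.
Qed.

End Coarsen.
End Orders.

(** * The law induced by a code *)

Section Converse.
Variables (K : nat) (X : finType) (Y : 'I_K -> finType) (W : X -> outT Y -> R).
Hypothesis HW : is_channel W.
Variables (n N1 N2 : nat) (c : code X Y n N1 N2).
Hypotheses (N1pos : (0 < N1)%N) (N2pos : (0 < N2)%N).

Local Notation Om := ('I_N1 * 'I_N2 * {ffun 'I_n -> outT Y})%type.

(** Joint law of uniform messages and all outputs. The inputs are functions of the messages and need
    no coordinate of their own. *)
Definition law (w : Om) : R :=
  / (INR N1 * INR N2) * \prod_t W (enc c w.1.1 w.1.2 t) (w.2 t).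
Definition inp (i : 'I_n) (w : Om) : X := enc c w.1.1 w.1.2 i.

Local Notation Hc := (entropy law).
Let V0 j := @marg_ge0 _ _ _ _ HW j.
Let V1 j := @marg_sum1 _ _ _ _ HW j.

Let N1r : 0 < INR N1. Proof. by apply: lt_0_INR; apply/leP. Qed.
Let N2r : 0 < INR N2. Proof. by apply: lt_0_INR; apply/leP. Qed.
Let NN0 : 0 < INR N1 * INR N2. Proof. exact: Rmult_lt_0_compat. Qed.

Lemma law_ge0 w : 0 <= law w.
Proof.
apply: Rmult_le_pos; first by apply/Rlt_le/Rinv_0_lt_compat.
by apply: prodR_ge0 => t; apply: (proj1 (HW _)).
Qed.

Let W_sum1 (x : X) : \sum_(y : outT Y) W x y = 1.
Proof. exact: (proj2 (HW x)). Qed.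

Lemma pr_messages m : pr law (fun w => w.1) m = / (INR N1 * INR N2).
Proof.
rewrite /pr (eq_bigl (fun w : Om => (w.1 == m) && true)); last by move=> w; rewrite andbT.
rewrite -(pair_big (pred1 m) xpredT (fun m' (y : {ffun 'I_n -> outT Y}) => law (m', y))) /=.
rewrite big_pred1_eq /law /= sumR_mull.
by rewrite (@sum_prod_ffun1 _ _ (fun t y => W (enc c m.1 m.2 t) y)) // Rmult_1_r.
Qed.

Lemma law_sum1 : \sum_w law w = 1.
Proof.
rewrite (sumR_fiber (fun w : Om => w.1)).
under eq_bigr => m _ do rewrite -/(pr law (fun w => w.1) m) pr_messages.
have h1 := N1r; have h2 := N2r.
by rewrite sumR_const card_prod !card_ord mult_INR; field; lra.
Qed.

Lemma H_messages : Hc (fun w => w.1) = log2 (INR N1) + log2 (INR N2).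
Proof.
rewrite H_uniform; first last.
- by move=> m; rewrite pr_messages card_prod !card_ord mult_INR.
- by rewrite card_prod !card_ord muln_gt0 N1pos.
by rewrite card_prod !card_ord mult_INR log2_mult //; apply: lt_0_INR; apply/leP.
Qed.

Lemma H_message2 : Hc (fun w => w.1.2) = log2 (INR N2).
Proof.
have h1 := N1r; have h2 := N2r.
rewrite H_uniform ?card_ord // => m2; rewrite ?card_ord.
transitivity (\sum_(m : 'I_N1 * 'I_N2 | m.2 == m2) pr law (fun w => w.1) m).
  rewrite /pr (partition_big (fun w : Om => w.1) (fun m => m.2 == m2)) //=.
  apply: eq_bigr => m /eqP mm; apply: eq_bigl => w.
  by case: (w.1 =P m) => [-> |]; rewrite ?andbF // mm eqxx.
under eq_bigr => m _ do rewrite pr_messages.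
rewrite -(pair_big xpredT (pred1 m2) (fun _ _ => / (INR N1 * INR N2))) /=.
under eq_bigr => m _ do rewrite big_pred1_eq.
by rewrite sumR_const card_ord; field; lra.
Qed.

(** Without feedback, this makes V - X_i - Y_i a Markov chain for a memoryless channel. *)
Definition ignores (T : finType) (V : Om -> T) (i : 'I_n) : Prop :=
  forall m y z, V (m, upd y i z) = V (m, y).

(** Given the messages, outputs at different times are independent, so the output at time [i] may be
    redrawn when nothing else in the integrand sees it. *)
Lemma law_resample (i : 'I_n) (F : Om -> outT Y -> R) :
  (forall m y z b, F (m, upd y i z) b = F (m, y) b) ->
  \sum_w law w * F w (w.2 i) = \sum_w law w * \sum_b W (inp i w) b * F w b.
Proof.
move=> hF.
rewrite !(sumR_pair (A := ('I_N1 * 'I_N2)%type)) /=; apply: eq_bigr => m _; rewrite /law /inp /=.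
under eq_bigr => y _ do rewrite Rmult_assoc.
under [RHS]eq_bigr => y _ do rewrite Rmult_assoc.
rewrite !sumR_mull; congr (_ * _).
apply: (@prod_resample _ _ (fun t y => W (enc c m.1 m.2 t) y) i (fun y b => F (m, y) b)) => //.
Qed.

Definition pvx (T : finType) (V : Om -> T) (i : 'I_n) (v : T) (x : X) : R :=
  \sum_(w | (V w == v) && (inp i w == x)) law w.
Definition pX (i : 'I_n) (x : X) : R := \sum_(w | inp i w == x) law w.
(** H(Y_{j,i} | V) whenever V ignores the outputs at time [i]; the formula involves only the joint
    law of V and X_i. *)
Definition cond_ent (j : 'I_K) (T : finType) (V : Om -> T) (i : 'I_n) : R :=
  \sum_v ent (marg W j) (pvx V i v).

Lemma pvx_ge0 (T : finType) (V : Om -> T) i v x : 0 <= pvx V i v x.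
Proof. by apply: sumR_ge0 => w _; apply: law_ge0. Qed.

Lemma pX_ge0 i x : 0 <= pX i x.
Proof. by apply: sumR_ge0 => w _; apply: law_ge0. Qed.

Lemma pX_sum1 i : \sum_x pX i x = 1.
Proof. by rewrite -law_sum1 [RHS](sumR_fiber (inp i)). Qed.

Lemma sum_pvx (T : finType) (V : Om -> T) i x : \sum_v pvx V i v x = pX i x.
Proof.
rewrite /pX (partition_big V xpredT) //=; apply: eq_bigr => v _.
by apply: eq_bigl => w; rewrite andbC.
Qed.

Lemma pr_pvx (T : finType) (V : Om -> T) i v : pr law V v = \sum_x pvx V i v x.
Proof. by rewrite /pr (partition_big (inp i) xpredT). Qed.

Lemma pr_output (T : finType) (V : Om -> T) i j v (y : Y j) : ignores V i ->
  pr law (fun w : Om => (V w, w.2 i j)) (v, y) = \sum_x pvx V i v x * marg W j x y.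
Proof.
move=> hV.
pose F (w : Om) (b : outT Y) := (if V w == v then 1 else 0) * (if b j == y then 1 else 0).
transitivity (\sum_w law w * F w (w.2 i)).
  rewrite /pr big_mkcond; apply: eq_bigr => w _; rewrite xpair_eqE /F.
  by case: (V w == v); case: (_ == y) => /=; ring.
rewrite law_resample; last by move=> m f z b; rewrite /F hV.
transitivity (\sum_w (if V w == v then law w else 0) * marg W j (inp i w) y).
  apply: eq_bigr => w _; rewrite margE [in RHS]big_mkcond /F.
  have -> : \sum_(b : outT Y) W (inp i w) b * ((if V w == v then 1 else 0) * (if b j == y then 1 else 0))
    = (if V w == v then 1 else 0) * \sum_(b : outT Y) (if b j == y then W (inp i w) b else 0).
    by rewrite -sumR_mull; apply: eq_bigr => b _; case: (V w == v); case: (_ == y); ring.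
  by rewrite /=; case: (V w == v); ring.
rewrite (sumR_fiber (inp i)); apply: eq_bigr => x _; rewrite /pvx -sumR_mulr.
rewrite [RHS](eq_bigl (fun w => (inp i w == x) && (V w == v))); last by move=> w; rewrite andbC.
rewrite [RHS]big_mkcondr; apply: eq_bigr => w /eqP ->.
by case: (V w == v); rewrite ?Rmult_0_l.
Qed.

Lemma H_output (T : finType) (V : Om -> T) i j : ignores V i ->
  Hc (fun w : Om => (V w, w.2 i j)) = Hc V + cond_ent j V i.
Proof.
move=> hV; rewrite /entropy /cond_ent /ent sumRB.
have -> : \sum_t xlog (pr law V t) = \sum_t xlog (\sum_x pvx V i t x).
  by apply: eq_bigr => v _; rewrite (pr_pvx V i).
have -> : \sum_t xlog (pr law (fun w : Om => (V w, w.2 i j)) t) =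
   \sum_v \sum_y xlog (\sum_x pvx V i v x * marg W j x y).
  by rewrite pair_bigA; apply: eq_bigr => -[v y] _; rewrite pr_output.
lra.
Qed.

(** Once V reveals the input, only the channel noise is left, and each slice p(v,.) sits on one
    point. *)
Lemma cond_ent_determined (T : finType) (V : Om -> T) i j (phi : T -> X) :
  (forall w, inp i w = phi (V w)) -> cond_ent j V i = \sum_x pX i x * rowent (marg W j) x.
Proof.
move=> h; rewrite /cond_ent.
transitivity (\sum_v \sum_x pvx V i v x * rowent (marg W j) x).
  apply: eq_bigr => v _; apply: (@ent_point _ _ _ _ _ (phi v)) => //.
    by move=> x; apply: pvx_ge0.
  move=> x xn; apply: big_pred0 => w; case: eqP => //= e.
  by rewrite h e eq_sym; apply/negbTE.
by rewrite exchange_big; apply: eq_bigr => x _; rewrite sumR_mulr sum_pvx.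
Qed.

Lemma pvx_coarsen (T T' : finType) (phi : T' -> T) (V : Om -> T) (V' : Om -> T') i v x :
  (forall w, V w = phi (V' w)) -> pvx V i v x = \sum_(v' | phi v' == v) pvx V' i v' x.
Proof.
move=> h; rewrite /pvx (partition_big V' (fun v' => phi v' == v)) /=; last first.
  by move=> w /andP [/eqP <- _]; rewrite h.
apply: eq_bigr => v' /eqP e; apply: eq_bigl => w; rewrite h.
by case: (V' w =P v') => [-> |]; rewrite ?andbF // e eqxx andbT.
Qed.

Section CoarsenCH.
Variables (T T' : finType) (phi : T' -> T) (V : Om -> T) (V' : Om -> T') (i : 'I_n).
Hypothesis hV : forall w, V w = phi (V' w).

Let CHE j : cond_ent j V i = \sum_v ent (marg W j) (fun x => \sum_(v' | phi v' == v) pvx V' i v' x).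
Proof. by apply: eq_bigr => v _; apply: eq_ent => x; apply: pvx_coarsen. Qed.

Lemma cond_ent_coarsen j : cond_ent j V' i <= cond_ent j V i.
Proof. by rewrite CHE; apply: ent_coarsen => // *; apply: pvx_ge0. Qed.

Lemma cond_ent_less_noisy s k : less_noisy W s k ->
  cond_ent k V i - cond_ent k V' i <= cond_ent s V i - cond_ent s V' i.
Proof. by move=> ln; rewrite !CHE; apply: less_noisy_coarsen => // *; apply: pvx_ge0. Qed.

End CoarsenCH.

Lemma cond_ent_unit j i : cond_ent j (fun=> tt) i = ent (marg W j) (pX i).
Proof.
rewrite /cond_ent (big_pred1 tt); last by case.
by apply: eq_ent => x; apply: eq_bigl => w.
Qed.

Lemma cond_ent_le_ent j (T : finType) (V : Om -> T) i : cond_ent j V i <= ent (marg W j) (pX i).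
Proof. by rewrite -cond_ent_unit; apply: (@cond_ent_coarsen _ _ (fun=> tt)). Qed.

(** I(X;Y_k|V) <= I(X;Y_s|V), by the order applied to each slice p(v,.). *)
Lemma cond_ent_more_capable s k (T : finType) (V : Om -> T) i : more_capable W s k ->
  cond_ent k V i - \sum_x pX i x * rowent (marg W k) x <=
  cond_ent s V i - \sum_x pX i x * rowent (marg W s) x.
Proof.
move=> mc.
have e j : \sum_x pX i x * rowent (marg W j) x =
   \sum_v \sum_x pvx V i v x * rowent (marg W j) x.
  by rewrite exchange_big; apply: eq_bigr => x _; rewrite sumR_mulr sum_pvx.
rewrite !e /cond_ent -!sumRB; apply: leR_sum => v _.
by apply: more_capable_ent => // x; apply: pvx_ge0.
Qed.

(** * Partial observations and telescoping *)

(** Outputs tagged by their receiver put all mixtures of receivers, with hidden times, into a single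
    type. *)
Local Notation zT := {ffun 'I_n -> option {j : 'I_K & Y j}}.

(* [obs s] reveals at time [t] the output of the receiver [s t], or nothing. *)
Definition obs (s : 'I_n -> option 'I_K) (w : Om) : zT :=
  [ffun t => omap (fun j => Tagged (fun j => Y j) (w.2 t j)) (s t)].

Definition supd (s : 'I_n -> option 'I_K) (i : 'I_n) (o : option 'I_K) : 'I_n -> option 'I_K :=
  fun t => if t == i then o else s t.

Lemma H_observe (T : finType) (A : 'I_N1 * 'I_N2 -> T) s i j : s i = None ->
  Hc (fun w => (A w.1, obs (supd s i (Some j)) w)) =
  Hc (fun w => (A w.1, obs s w)) + cond_ent j (fun w => (A w.1, obs s w)) i.
Proof.
move=> si; rewrite -H_output; last first.
  move=> m y z; congr pair; apply/ffunP => t; rewrite !ffunE.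
  by case: (eqVneq t i) => [->|ti] /=; [rewrite si | case: (s t) => //= a; rewrite ?ffunE ?(negbTE ti)].
apply: H_kernel => w w'; rewrite !xpair_eqE -andbA; congr (_ && _).
apply/eqP/andP => [h|[/eqP h1 /eqP h2]].
  split; apply/eqP.
    apply/ffunP => t; move/ffunP/(_ t): h; rewrite !ffunE /supd.
    by case: (eqVneq t i) => [->|]; first by rewrite si.
  move/ffunP/(_ i): h; rewrite !ffunE /supd eqxx /= => -[/eqP].
  by rewrite eq_Tagged => /eqP.
apply/ffunP => t; rewrite !ffunE /supd; case: (eqVneq t i) => [->|ti] /=.
  by rewrite h2.
by move/ffunP/(_ t): h1; rewrite !ffunE.
Qed.

Definition past (j : 'I_K) (r : nat) (t : 'I_n) : option 'I_K :=
  if (t < r)%N then Some j else None.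
Definition allof (j : 'I_K) (t : 'I_n) : option 'I_K := Some j.
(** Past of [k], future of [s], present hidden: the observation at which two consecutive mixtures of
    the outputs of [k] and [s] agree. *)
Definition hybrid (k s : 'I_K) (i t : 'I_n) : option 'I_K :=
  if (t < i)%N then Some k else if t == i then None else Some s.

Lemma telescope (f : nat -> R) m : \sum_(i < m) (f i.+1 - f i) = f m - f 0%N.
Proof.
by elim: m => [|m IH]; [rewrite big_ord0; lra | rewrite big_ord_recr /= IH; lra].
Qed.

Lemma H_noobs (T : finType) (A : 'I_N1 * 'I_N2 -> T) s : (forall t, s t = None) ->
  Hc (fun w => (A w.1, obs s w)) = Hc (fun w => A w.1).
Proof.
move=> h; apply: H_kernel => w w'; rewrite xpair_eqE.
suff -> : obs s w = obs s w' by rewrite eqxx andbT.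
by apply/ffunP => t; rewrite !ffunE h.
Qed.

Lemma chain_rule (T : finType) (A : 'I_N1 * 'I_N2 -> T) j :
  Hc (fun w => (A w.1, obs (allof j) w)) - Hc (fun w => A w.1) =
  \sum_(i < n) cond_ent j (fun w => (A w.1, obs (past j i) w)) i.
Proof.
pose f r := Hc (fun w => (A w.1, obs (past j r) w)).
have -> : Hc (fun w => (A w.1, obs (allof j) w)) = f n.
  rewrite /f; suff -> : past j n = allof j by [].
  by apply: functional_extensionality => t; rewrite /past ltn_ord.
have -> : Hc (fun w => A w.1) = f 0%N by rewrite /f H_noobs.
rewrite -telescope; apply: eq_bigr => i _; rewrite /f.
have -> : past j i.+1 = supd (past j i) i (Some j).
  apply: functional_extensionality => t; rewrite /past /supd ltnS leq_eqVlt -val_eqE /=.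
  by case: eqP.
by rewrite H_observe /past ?ltnn //; lra.
Qed.

(* Csiszár's sum identity, obtained by replacing one output at a time. *)
Lemma hybrid_rule (T : finType) (A : 'I_N1 * 'I_N2 -> T) k s :
  Hc (fun w => (A w.1, obs (allof k) w)) - Hc (fun w => (A w.1, obs (allof s) w)) =
  \sum_i (cond_ent k (fun w => (A w.1, obs (hybrid k s i) w)) i
          - cond_ent s (fun w => (A w.1, obs (hybrid k s i) w)) i).
Proof.
(* The first [r] outputs come from [k], the others from [s]; raising [r] by one exchanges a single
   output on top of a [hybrid] observation. *)
pose sg r (t : 'I_n) := if (t < r)%N then Some k else Some s.
pose f r := Hc (fun w => (A w.1, obs (sg r) w)).
have -> : Hc (fun w => (A w.1, obs (allof k) w)) = f n.
  rewrite /f; suff -> : sg n = allof k by [].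
  by apply: functional_extensionality => t; rewrite /sg ltn_ord.
have -> : Hc (fun w => (A w.1, obs (allof s) w)) = f 0%N by [].
rewrite -telescope; apply: eq_bigr => i _; rewrite /f.
have -> : sg i.+1 = supd (hybrid k s i) i (Some k).
  apply: functional_extensionality => t; rewrite /sg /hybrid /supd ltnS leq_eqVlt -val_eqE /=.
  by case: eqP.
have -> : sg i = supd (hybrid k s i) i (Some s).
  apply: functional_extensionality => t; rewrite /sg /hybrid /supd -val_eqE /=.
  by case: eqP => [->|]; rewrite ?ltnn.
by rewrite !H_observe /hybrid ?ltnn ?eqxx //; lra.
Qed.

Definition restrict (T : finType) (s : 'I_n -> option 'I_K) (v : T * zT) : T * zT :=
  (v.1, [ffun t => if s t is None then None else v.2 t]).

Lemma obs_restrict (T : finType) (a : T) s s' w : (forall t, s t = None \/ s t = s' t) ->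
  (a, obs s w) = restrict s (a, obs s' w).
Proof.
by move=> h; congr pair; apply/ffunP => t; rewrite !ffunE; case: (h t) => e; rewrite e //; case: (s' t).
Qed.

Lemma cond_ent_restrict j (T : finType) (A : 'I_N1 * 'I_N2 -> T) s s' i :
  (forall t, s t = None \/ s t = s' t) ->
  cond_ent j (fun w => (A w.1, obs s' w)) i <= cond_ent j (fun w => (A w.1, obs s w)) i.
Proof.
by move=> h; apply: (@cond_ent_coarsen _ _ (@restrict T s)) => w; apply: obs_restrict.
Qed.

Lemma cond_ent_less_noisy_restrict a b (T : finType) (A : 'I_N1 * 'I_N2 -> T) s s' i :
  less_noisy W a b -> (forall t, s t = None \/ s t = s' t) ->
  cond_ent b (fun w => (A w.1, obs s w)) i - cond_ent b (fun w => (A w.1, obs s' w)) i <=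
  cond_ent a (fun w => (A w.1, obs s w)) i - cond_ent a (fun w => (A w.1, obs s' w)) i.
Proof.
by move=> ln h; apply: (@cond_ent_less_noisy _ _ (@restrict T s)) => // w; apply: obs_restrict.
Qed.

Lemma supdC s i i' o o' : i != i' -> supd (supd s i o) i' o' = supd (supd s i' o') i o.
Proof.
move=> ne; apply: functional_extensionality => t; rewrite /supd.
by case: (eqVneq t i') => // ->; rewrite eq_sym (negbTE ne).
Qed.

(* The past outputs of [k] are replaced by those of [j] one at a time. *)
Lemma cond_ent_past_less_noisy j k (T : finType) (A : 'I_N1 * 'I_N2 -> T) (i : 'I_n) :
  less_noisy W j k ->
  cond_ent j (fun w => (A w.1, obs (past j i) w)) i <= cond_ent j (fun w => (A w.1, obs (past k i) w)) i.
Proof.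
move=> ln.
pose tau r (t : 'I_n) := if (t < r)%N then Some j else if (t < i)%N then Some k else None.
have -> : past j i = tau i.
  by apply: functional_extensionality => t; rewrite /past /tau; case: ifP.
have -> : past k i = tau 0%N by [].
suff step r : (r <= i)%N ->
    cond_ent j (fun w => (A w.1, obs (tau r) w)) i <= cond_ent j (fun w => (A w.1, obs (tau 0%N) w)) i.
  exact: step.
elim: r => [|r IH] ri; first lra.
apply: Rle_trans (IH (ltnW ri)).
have rn : (r < n)%N by apply: ltn_trans (ltn_ord i).
pose r' := Ordinal rn; have r'i : r' != i by rewrite -val_eqE /= neq_ltn ri.
(* What two consecutive mixtures share: time [r] is hidden. *)
pose rho := supd (tau r) r' None.
have e1 : tau r.+1 = supd rho r' (Some j).
  apply: functional_extensionality => t; rewrite /rho /tau /supd ltnS leq_eqVlt -val_eqE /=.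
  by case: eqP.
have e2 : tau r = supd rho r' (Some k).
  apply: functional_extensionality => t; rewrite /rho /tau /supd -val_eqE /=.
  by case: eqP => // ->; rewrite ltnn ri.
have rhor : rho r' = None by rewrite /rho /supd eqxx.
have tni r0 : (r0 <= i)%N -> tau r0 i = None by rewrite /tau ltnn ltnNge => ->.
have rhoi : rho i = None by rewrite /rho /supd eq_sym (negbTE r'i) tni // ltnW.
(* The outputs at times [r] and [i] are adjoined to [rho] in both orders. This turns the claim about
   the entropy at time [i] into one about entropies at time [r]. *)
have f1 := @H_observe _ A (tau r.+1) i j (tni _ ri).
have f2 := @H_observe _ A (tau r) i j (tni _ (ltnW ri)).
rewrite e1 supdC // in f1; rewrite e2 supdC // in f2.
have rho'r : supd rho i (Some j) r' = None by rewrite /supd (negbTE r'i).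
rewrite -e1 -e2 in f1 f2.
have g1 := @H_observe _ A rho r' j rhor.
have g2 := @H_observe _ A rho r' k rhor.
have g3 := @H_observe _ A (supd rho i (Some j)) r' j rho'r.
have g4 := @H_observe _ A (supd rho i (Some j)) r' k rho'r.
rewrite -e1 in g1; rewrite -e2 in g2.
(* The output of [j] at the later time [i] plays the auxiliary variable: I(Y_{j,i};Y_{k,r}|rho) <=
   I(Y_{j,i};Y_{j,r}|rho). *)
have := @cond_ent_less_noisy_restrict j k _ A rho (supd rho i (Some j)) r' ln.
case.
  move=> t; rewrite /supd; case: (eqVneq t i) => [->|_]; [by left | by right].
all: by lra.
Qed.

(** * Single-letter bounds *)

Lemma H_trivial s : Hc (fun w => (tt, obs s w)) = Hc (obs s).
Proof. by apply: H_kernel => w w'; rewrite xpair_eqE eqxx. Qed.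

Lemma H_all_le j : Hc (obs (allof j)) <= \sum_i ent (marg W j) (pX i).
Proof.
have := @chain_rule _ (fun=> tt) j; rewrite H_trivial.
have -> : Hc (fun w => tt) = 0.
  rewrite /entropy (big_pred1 tt); last by case.
  by rewrite /pr law_sum1 xlog1; lra.
rewrite Rminus_0_r => ->; apply: leR_sum => i _; exact: cond_ent_le_ent.
Qed.

(** Both messages determine the codeword, so each term of the chain rule is a noise entropy. *)
Lemma H_all_messages j :
  Hc (fun w => (w.1, obs (allof j) w)) = log2 (INR N1) + log2 (INR N2) +
  \sum_i \sum_x pX i x * rowent (marg W j) x.
Proof.
rewrite -H_messages; have := @chain_rule _ id j.
have -> : \sum_(i < n) cond_ent j (fun w => (id w.1, obs (past j i) w)) i =
   \sum_i \sum_x pX i x * rowent (marg W j) x.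
  by apply: eq_bigr => i _; apply: (@cond_ent_determined _ _ _ _ (fun v => enc c v.1.1 v.1.2 i)).
by rewrite /=; lra.
Qed.

Lemma Pe_law : Pe W c = \sum_(w : Om | err_event c w.1.1 w.1.2 w.2) law w.
Proof.
rewrite big_mkcond !sumR_pair /=.
rewrite /Pe /rsum /Rdiv -sumR_mulr; apply: eq_bigr => m1 _.
rewrite -sumR_mulr; apply: eq_bigr => m2 _.
rewrite -sumR_mulr; apply: eq_bigr => y _; rewrite /law /rprod /=.
by case: ifP => _; ring.
Qed.

Lemma same_outputs i w w' : obs (allof i) w = obs (allof i) w' ->
  (fun t => w.2 t i) = (fun t => w'.2 t i).
Proof.
move=> h; apply: functional_extensionality => t; move/ffunP/(_ t): h; rewrite !ffunE /=.
by case=> /eqP; rewrite eq_Tagged => /eqP.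
Qed.

(** [A] is side information that the decoder ignores. A wrong estimate at [i] lies in the error
    event because receiver [i] requires the message. *)
Lemma fano_message1 i (T : finType) (A : 'I_N1 * 'I_N2 -> T) : req1 i ->
  Hc (fun w => (w.1.1, (A w.1, obs (allof i) w))) - Hc (fun w => (A w.1, obs (allof i) w))
  <= 1 + Pe W c * log2 (INR N1).
Proof.
move=> ri.
have := @fano _ law law_ge0 law_sum1 _ _ (fun w => w.1.1) (fun w => (A w.1, obs (allof i) w))
  (fun w => (dec c i (fun t => w.2 t i)).1).
move/(_ _)/Rle_trans; apply; first by move=> w w' [_ /same_outputs ->].
rewrite card_ord; apply: Rplus_le_compat_l; apply: Rmult_le_compat_r.
  rewrite -log2_1; apply: log2_le; first lra.
  by rewrite -[1]/(INR 1); apply: le_INR; apply/leP.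
rewrite Pe_law big_mkcond [X in _ <= X]big_mkcond; apply: leR_sum => w _.
case: ifP => h; last by case: ifP => _; [apply: law_ge0 | lra].
suff -> : err_event c w.1.1 w.1.2 w.2 by lra.
by apply/existsP; exists i; rewrite ri h.
Qed.

Lemma fano_message2 i (T : finType) (A : 'I_N1 * 'I_N2 -> T) : req2 i ->
  Hc (fun w => (w.1.2, (A w.1, obs (allof i) w))) - Hc (fun w => (A w.1, obs (allof i) w))
  <= 1 + Pe W c * log2 (INR N2).
Proof.
move=> ri.
have := @fano _ law law_ge0 law_sum1 _ _ (fun w => w.1.2) (fun w => (A w.1, obs (allof i) w))
  (fun w => (dec c i (fun t => w.2 t i)).2).
move/(_ _)/Rle_trans; apply; first by move=> w w' [_ /same_outputs ->].
rewrite card_ord; apply: Rplus_le_compat_l; apply: Rmult_le_compat_r.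
  rewrite -log2_1; apply: log2_le; first lra.
  by rewrite -[1]/(INR 1); apply: le_INR; apply/leP.
rewrite Pe_law big_mkcond [X in _ <= X]big_mkcond; apply: leR_sum => w _.
case: ifP => h; last by case: ifP => _; [apply: law_ge0 | lra].
suff -> : err_event c w.1.1 w.1.2 w.2 by lra.
by apply/existsP; exists i; rewrite ri h orbT.
Qed.

(** * Time sharing *)

Section TimeSharing.
Variables (T : finType) (V : 'I_n -> Om -> T).
Hypothesis npos : (0 < n)%N.

(** Law of U = (Q, V_Q) and X = X_Q for a uniform time Q. With Q inside U, conditional entropies
    average exactly. *)
Definition ts_law (iu : 'I_n * T) (x : X) : R := / INR n * pvx (V iu.1) iu.1 iu.2 x.

Let n0 : 0 < INR n. Proof. by apply: lt_0_INR; apply/leP. Qed.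
Let i0 : 0 < / INR n. Proof. exact: Rinv_0_lt_compat. Qed.

Let ts_ge0 iu x : 0 <= ts_law iu x.
Proof. by apply: Rmult_le_pos; [lra | apply: pvx_ge0]. Qed.

Let ts_X x : \sum_iu ts_law iu x = \sum_i / INR n * pX i x.
Proof.
rewrite -(pair_bigA _ (fun i u => / INR n * pvx (V i) i u x)) /=.
by apply: eq_bigr => i _; rewrite sumR_mull sum_pvx.
Qed.

Lemma ts_pmf : is_pmf2 ts_law.
Proof.
split=> //; rewrite /rsum exchange_big /=.
under eq_bigr => x _ do rewrite ts_X.
rewrite exchange_big /=; under eq_bigr => i _ do rewrite sumR_mull pX_sum1.
by rewrite sumR_const card_ord; field; lra.
Qed.

Let ts_ent j : \sum_iu ent (marg W j) (ts_law iu) = / INR n * \sum_i cond_ent j (V i) i.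
Proof.
rewrite -(pair_bigA _ (fun i u => ent (marg W j) (fun x => / INR n * pvx (V i) i u x))) /=.
rewrite -sumR_mull; apply: eq_bigr => i _; rewrite /cond_ent -sumR_mull; apply: eq_bigr => u _.
by rewrite ent_scale //; [lra | move=> x; apply: pvx_ge0].
Qed.

(** The unconditional entropy is the one quantity that averaging changes; concavity changes it in
    the favourable direction. *)
Let ts_entX j : / INR n * \sum_i ent (marg W j) (pX i) <=
  ent (marg W j) (fun x => \sum_iu ts_law iu x).
Proof.
rewrite (functional_extensionality _ _ ts_X).
apply: Rle_trans (ent_superadd _ _ _) => //; last first.
  by move=> i x; apply: Rmult_le_pos; [lra | apply: pX_ge0].
rewrite -sumR_mull; apply: leR_sum => i _; rewrite ent_scale //; try lra.
by move=> x; apply: pX_ge0.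
Qed.

Let ts_row j : \sum_x (\sum_iu ts_law iu x) * rowent (marg W j) x =
  / INR n * \sum_i \sum_x pX i x * rowent (marg W j) x.
Proof.
under eq_bigr => x _ do rewrite ts_X -sumR_mulr.
rewrite exchange_big -sumR_mull; apply: eq_bigr => i _; rewrite -sumR_mull.
by apply: eq_bigr => x _; ring.
Qed.

Lemma ts_rate_bounds r2 r12 :
  (forall k : 'I_K, rcv k = K ->
     r2 <= \sum_i ent (marg W k) (pX i) - \sum_i cond_ent k (V i) i) ->
  (forall j k : 'I_K, (rcv j <= K.-1)%N -> rcv k = K ->
     r12 <= \sum_i cond_ent j (V i) i - \sum_i \sum_x pX i x * rowent (marg W j) x
            + (\sum_i ent (marg W k) (pX i) - \sum_i cond_ent k (V i) i)) ->
  (forall s : 'I_K, rcv s = K.-1 ->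
     r12 <= \sum_i ent (marg W s) (pX i) - \sum_i \sum_x pX i x * rowent (marg W s) x) ->
  rate_bounds W ts_law (/ INR n * r2) (/ INR n * r12).
Proof.
move=> h1 h2 h3; split=> [k e|]; last split=> [j k e e'|s e].
- rewrite (I_UYE HW _ ts_pmf) ts_ent; have := ts_entX k.
  by have := Rmult_le_compat_l (/ INR n) _ _ (Rlt_le _ _ i0) (h1 k e); lra.
- rewrite (I_UYE HW _ ts_pmf) (I_XY_given_UE HW _ ts_pmf) !ts_ent ts_row; have := ts_entX k.
  by have := Rmult_le_compat_l (/ INR n) _ _ (Rlt_le _ _ i0) (h2 j k e e'); lra.
- rewrite (I_XYE HW _ (pmf2_marg ts_pmf)) ts_row; have := ts_entX s.
  by have := Rmult_le_compat_l (/ INR n) _ _ (Rlt_le _ _ i0) (h3 s e); lra.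
Qed.

End TimeSharing.

(** * Fano's inequalities and the converse for one code *)

Let L1 := log2 (INR N1).
Let L2 := log2 (INR N2).
Let e := Pe W c.
Let HZ j := Hc (obs (allof j)).
Let HZ1 j := Hc (fun w => (w.1.1, obs (allof j) w)).
Let HZ2 j := Hc (fun w => (w.1.2, obs (allof j) w)).
(** H(Y_j^n | X^n), which is also H(Y_j^n | M1, M2). *)
Let F j := \sum_i \sum_x pX i x * rowent (marg W j) x.

Let fano2 k : req2 k -> HZ2 k - HZ k <= 1 + e * L2.
Proof.
move=> rk; have := @fano_message2 k _ (fun=> tt) rk; rewrite H_trivial.
suff -> : Hc (fun w => (w.1.2, (tt, obs (allof k) w))) = HZ2 k by [].
by apply: H_kernel => w w'; rewrite !xpair_eqE eqxx.
Qed.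

Let fano1 s : req1 s -> HZ1 s - HZ s <= 1 + e * L1.
Proof.
move=> rs; have := @fano_message1 s _ (fun=> tt) rs; rewrite H_trivial.
suff -> : Hc (fun w => (w.1.1, (tt, obs (allof s) w))) = HZ1 s by [].
by apply: H_kernel => w w'; rewrite !xpair_eqE eqxx.
Qed.

(** H(M1 | M2, Y_j^n) <= 1 + e L1, with the joint entropy rewritten by [H_all_messages]; M2 is given
    to receiver [j] for free. *)
Let fano1_given2 j : req1 j -> L1 + L2 + F j - HZ2 j <= 1 + e * L1.
Proof.
move=> rj; have := @fano_message1 j _ (fun m => m.2) rj; rewrite /L1 /L2 -H_all_messages.
suff -> : Hc (fun w => (w.1.1, (w.1.2, obs (allof j) w))) = Hc (fun w => (w.1, obs (allof j) w)) by [].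
by apply: H_kernel => -[[a b] y] [[a' b'] y']; rewrite !xpair_eqE andbA.
Qed.

Let fano2_given1 k : req2 k -> L1 + L2 + F k - HZ1 k <= 1 + e * L2.
Proof.
move=> rk; have := @fano_message2 k _ (fun m => m.1) rk; rewrite /L1 /L2 -H_all_messages.
suff -> : Hc (fun w => (w.1.2, (w.1.1, obs (allof k) w))) = Hc (fun w => (w.1, obs (allof k) w)) by [].
by apply: H_kernel => -[[a b] y] [[a' b'] y']; rewrite !xpair_eqE andbA (andbC (b == b')).
Qed.

(** The subtracted 1 and 2 count the Fano inequalities used, one bit each. *)
Lemma converse_code : (2 < K)%N -> (0 < n)%N -> classA W \/ classB W ->
  exists (U : finType) (p : U -> X -> R), is_pmf2 p /\
    rate_bounds W p (/ INR n * (log2 (INR N2) * (1 - Pe W c) - 1))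
      (/ INR n * ((log2 (INR N1) + log2 (INR N2)) * (1 - Pe W c) - 2)).
Proof.
move=> K3 npos hcl; rewrite -/L1 -/L2 -/e.
have K0 : (0 < K)%N by apply: leq_trans K3.
have kK : (K.-1 < K)%N by rewrite prednK.
have sK : (K.-2 < K)%N by rewrite (leq_ltn_trans _ kK) // leq_pred.
pose k := Ordinal kK; pose s := Ordinal sK.
have rk : rcv k = K by rewrite /rcv /= prednK.
have rs : rcv s = K.-1 by rewrite /rcv /= prednK // -ltnS prednK // ltnW.
have ks (k' : 'I_K) : rcv k' = K -> k' = k by move=> h; apply/val_inj; move: (congr1 predn h).
have ss (s' : 'I_K) : rcv s' = K.-1 -> s' = s by move=> h; apply/val_inj; move: (congr1 predn h).
have KK : K != K.-1 by rewrite neq_ltn kK orbT.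
have req2k : req2 k by rewrite /req2 rk.
have req1j (j : 'I_K) : (rcv j <= K.-1)%N -> req1 j.
  by move=> h; rewrite /req1 (ltn_eqF (leq_ltn_trans h kK)).
have req1s : req1 s by apply: req1j; rewrite rs.
have f2 := fano2 req2k; have f1 := fano1 req1s.
have f21 := fano2_given1 req2k.
have zk := H_all_le k; have zs := H_all_le s.
have ch2 j : HZ2 j = L2 + \sum_(i < n) cond_ent j (fun w => (w.1.2, obs (past j i) w)) i.
  have h : HZ2 j - Hc (fun w => w.1.2) =
      \sum_(i < n) cond_ent j (fun w => (w.1.2, obs (past j i) w)) i := @chain_rule _ (fun m => m.2) j.
  by rewrite H_message2 -/L2 in h; lra.
case: hcl => [[hA1 hA2]|hB].
  have mc (j : 'I_K) : (rcv j <= K.-1)%N -> j = s \/ more_capable W j s.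
    rewrite leq_eqVlt => /orP[/eqP /ss -> |h]; [by left | right; apply: hA1 => //].
    by rewrite subn2 -ltnS prednK // -ltnS prednK // ltnW.
  pose V i (w : Om) := (w.1.2, obs (hybrid k s i) w).
  exists ('I_n * ('I_N2 * zT))%type, (ts_law V); split; first exact: ts_pmf.
  have hr : HZ2 k - HZ2 s = \sum_i cond_ent k (V i) i - \sum_i cond_ent s (V i) i.
    by rewrite -sumRB; apply: (@hybrid_rule _ (fun m => m.2) k s).
  apply: ts_rate_bounds => // [k' /ks ->|j k' hj /ks ->|s' /ss ->].
  (* The chain rule for Y_K conditions on its past alone; adding the future of Y_{K-1} can only
     lower the entropy. *)
  - have : \sum_i cond_ent k (V i) i <= \sum_(i < n) cond_ent k (fun w => (w.1.2, obs (past k i) w)) i.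
      apply: leR_sum => i _; apply: (@cond_ent_restrict _ _ (fun m => m.2)) => t.
      by rewrite /past /hybrid; case: ifP; [right | left].
    by have := ch2 k; rewrite -/(HZ k) in zk; lra.
  (* Receiver K finds M2 and receiver K-1 finds M1 given M2; [hr] trades H(Y_{K-1}^n, M2) for
     H(Y_K^n, M2). The more capable order then passes from K-1 to [j]. *)
  - have f12 := fano1_given2 req1s.
    have : \sum_i cond_ent s (V i) i - F s <= \sum_i cond_ent j (V i) i - F j.
      case: (mc _ hj) => [->|mcj]; first lra.
      rewrite -!sumRB; apply: leR_sum => i _; exact: cond_ent_more_capable.
    by rewrite -/(F j) -/(HZ k) in zk *; lra.
  (* The messages swap roles: receiver K-1 finds M1 and receiver K finds M2 given M1. The hybrid
     identity given M1 yields I(M2;Y_K^n|M1) <= I(M2;Y_{K-1}^n|M1), as Y_{K-1} is more capable at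
     every time. *)
  - pose V' i (w : Om) := (w.1.1, obs (hybrid k s i) w).
    have hr1 : HZ1 k - HZ1 s = \sum_i (cond_ent k (V' i) i - cond_ent s (V' i) i).
      exact: (@hybrid_rule _ (fun m => m.1) k s).
    have : HZ1 k - HZ1 s <= F k - F s.
      rewrite hr1 -sumRB; apply: leR_sum => i _.
      by have := @cond_ent_more_capable s k _ (V' i) i (hA2 _ _ rs rk); lra.
    by rewrite -/(F s) -/(HZ s) in zs *; lra.
have ln (j : 'I_K) : (rcv j <= K.-1)%N -> less_noisy W j k by move=> h; apply: hB.
pose V (i : 'I_n) (w : Om) := (w.1.2, obs (past k i) w).
have chk : HZ2 k = L2 + \sum_i cond_ent k (V i) i := ch2 k.
have lo (j : 'I_K) : (rcv j <= K.-1)%N ->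
    (L1 + L2) * (1 - e) - 2 <= \sum_i cond_ent j (V i) i - F j +
      (\sum_i ent (marg W k) (pX i) - \sum_i cond_ent k (V i) i).
  move=> hj; have f12 := fano1_given2 (req1j _ hj).
  (* The chain rule for Y_j conditions on its own past, but U must be the same for all [j]; less
     noisiness allows the past of Y_K instead. *)
  have : HZ2 j <= L2 + \sum_i cond_ent j (V i) i.
    rewrite ch2; apply: Rplus_le_compat_l; apply: leR_sum => i _.
    by apply: (@cond_ent_past_less_noisy _ _ _ (fun m => m.2)); apply: ln.
  by rewrite -/(HZ k) in zk; lra.
exists ('I_n * ('I_N2 * zT))%type, (ts_law V); split; first exact: ts_pmf.
apply: ts_rate_bounds => // [k' /ks ->|j k' hj /ks ->|s' /ss ->].
- by rewrite -/(HZ k) in zk; lra.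
- exact: lo.
(* The bound for j = K-1 suffices, because I(U;Y_K) <= I(U;Y_{K-1}) at each time. *)
have hs : (rcv s <= K.-1)%N by rewrite rs.
have : \sum_i ent (marg W k) (pX i) - \sum_i cond_ent k (V i) i <=
       \sum_i ent (marg W s) (pX i) - \sum_i cond_ent s (V i) i.
  rewrite -!sumRB; apply: leR_sum => i _; rewrite -!cond_ent_unit.
  by apply: (@cond_ent_less_noisy _ _ (fun=> tt)) => //; apply: ln.
by have := lo _ hs; rewrite /F; lra.
Qed.

End Converse.

(** * Marginals of product laws *)

Lemma prod_marg1 (I T : finType) (mu : I -> T -> R) (i : I) (g : T -> R) :
  (forall k, \sum_t mu k t = 1) ->
  \sum_(f : {ffun I -> T}) (\prod_k mu k (f k)) * g (f i) = \sum_t mu i t * g t.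
Proof.
move=> h; rewrite (@prod_resample _ _ _ _ (fun _ b => g b)) //.
by rewrite sumR_mulr sum_prod_ffun1 // Rmult_1_l.
Qed.

Lemma prod_marg2 (I T : finType) (mu : I -> T -> R) (i i' : I) (g : T -> T -> R) :
  (forall k, \sum_t mu k t = 1) -> i != i' ->
  \sum_(f : {ffun I -> T}) (\prod_k mu k (f k)) * g (f i) (f i') =
  \sum_t \sum_t' mu i t * mu i' t' * g t t'.
Proof.
move=> h ne; rewrite (@prod_resample _ _ _ _ (fun f b => g b (f i'))) //; last first.
  by move=> f z b; rewrite upd_neq // eq_sym.
rewrite (@prod_marg1 _ _ _ i' (fun t' => \sum_b mu i b * g b t')) // exchange_big.
by apply: eq_bigr => t' _; rewrite -sumR_mull; apply: eq_bigr => t _; ring.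
Qed.

Lemma sum_ffun_pair (I A B : finType) (G : {ffun I -> A * B} -> R) :
  \sum_f G f = \sum_(a : {ffun I -> A}) \sum_(b : {ffun I -> B}) G [ffun t => (a t, b t)].
Proof.
rewrite pair_bigA /=.
rewrite (reindex (fun ab : {ffun I -> A} * {ffun I -> B} => [ffun t => (ab.1 t, ab.2 t)])) //=.
exists (fun f => ([ffun t => (f t).1], [ffun t => (f t).2])) => [[a b]|f] _ /=.
  by congr pair; apply/ffunP => t; rewrite !ffunE.
by apply/ffunP => t; rewrite !ffunE /= -surjective_pairing.
Qed.

Definition indic (b : bool) : R := if b then 1 else 0.

Lemma indic_ge0 b : 0 <= indic b.
Proof. by case: b; rewrite /indic; lra. Qed.

Lemma indic_le1 b : indic b <= 1.
Proof. by case: b; rewrite /indic; lra. Qed.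

(** * Chebyshev's inequality for information densities *)

Section Chebyshev.
Variables (A : finType) (P : A -> R).
Hypothesis P0 : forall a, 0 <= P a.
Hypothesis P1 : \sum_a P a = 1.

Definition mean (g : A -> R) : R := \sum_a P a * g a.
Definition variance (g : A -> R) : R := \sum_a P a * ((g a - mean g) * (g a - mean g)).

(** The deviations are centred and independent, so the cross terms vanish. *)
Lemma sum_sq_dev n (g : A -> R) :
  \sum_(f : {ffun 'I_n -> A}) (\prod_t P (f t)) *
    ((\sum_t (g (f t) - mean g)) * (\sum_t (g (f t) - mean g))) = INR n * variance g.
Proof.
pose h a := g a - mean g.
have hm : \sum_a P a * h a = 0.
  rewrite /h; under eq_bigr => a _ do rewrite Rmult_minus_distr_l.
  by rewrite sumRB sumR_mulr P1 /mean; lra.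
transitivity (\sum_(t < n) \sum_(s < n) \sum_(f : {ffun 'I_n -> A})
    (\prod_t P (f t)) * (h (f t) * h (f s))).
  under [RHS]eq_bigr => t _ do rewrite exchange_big.
  rewrite [RHS]exchange_big; apply: eq_bigr => f _; rewrite -sumR_mulr -sumR_mull.
  by apply: eq_bigr => t _; rewrite -sumR_mull -sumR_mull.
have -> : INR n * variance g = \sum_(t < n) variance g by rewrite sumR_const card_ord.
apply: eq_bigr => t _; rewrite (bigD1 t) //=.
rewrite (@prod_marg1 _ _ (fun=> P) t (fun a => h a * h a)) // [X in _ + X = _]big1 ?Rplus_0_r // => s st.
rewrite (@prod_marg2 _ _ (fun=> P) t s (fun a b => h a * h b)) //; last by rewrite eq_sym.
transitivity (\sum_a (P a * h a) * \sum_b P b * h b); last by rewrite sumR_mulr hm; lra.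
by apply: eq_bigr => a _; rewrite -sumR_mull; apply: eq_bigr => b _; ring.
Qed.

Lemma chebyshev n (g : A -> R) d : (0 < n)%N -> 0 < d ->
  \sum_(f : {ffun 'I_n -> A}) (\prod_t P (f t)) *
    indic (Rle_dec (\sum_t g (f t)) (INR n * (mean g - d))) <= variance g / (d * d) / INR n.
Proof.
move=> n0 d0; have N0 : 0 < INR n by apply: lt_0_INR; apply/leP.
pose k := / (INR n * d * (INR n * d)).
have nd : 0 < INR n * d by apply: Rmult_lt_0_compat.
have k0 : 0 < k by apply: Rinv_0_lt_compat; apply: Rmult_lt_0_compat.
apply: (@Rle_trans _ (\sum_(f : {ffun 'I_n -> A}) (\prod_t P (f t)) *
    ((\sum_t (g (f t) - mean g)) * (\sum_t (g (f t) - mean g))) * k)); last first.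
  by rewrite sumR_mulr sum_sq_dev /k; right; field; lra.
apply: leR_sum => f _; rewrite Rmult_assoc; apply: Rmult_le_compat_l.
  exact: prodR_ge0.
rewrite sumRB sumR_const card_ord; set S := \sum_t g (f t).
case: Rle_dec => h /=; last by apply: Rmult_le_pos; [apply: Rle_0_sqr | lra].
have h1 : INR n * d <= - (S - INR n * mean g) by lra.
apply: (@Rle_trans _ (INR n * d * (INR n * d) * k)); first by rewrite /k /indic /=; right; field; lra.
by apply: Rmult_le_compat_r; [lra | nra].
Qed.

Lemma log2_prod n (v : 'I_n -> R) : (forall t, 0 < v t) ->
  log2 (\prod_t v t) = \sum_t log2 (v t).
Proof.
move=> v0; suff [] : 0 < \prod_t v t /\ log2 (\prod_t v t) = \sum_t log2 (v t) by [].
apply: (big_ind2 (fun x y => 0 < x /\ log2 x = y)) => [|x1 x2 y1 y2 [a <-] [b <-]|t _].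
- by rewrite log2_1; split; lra.
- by split; [apply: Rmult_lt_0_compat | rewrite log2_mult].
- by split.
Qed.

(** The test is multiplicative, hence meaningful at zero likelihood. On sequences of positive
    probability all factors are positive, and the logarithm turns failure of the test into the event
    of Chebyshev's inequality. *)
Lemma information_spectrum n (v r : A -> R) d : (0 < n)%N -> 0 < d ->
  (forall a, 0 < P a -> 0 < v a /\ 0 < r a) ->
  \sum_(f : {ffun 'I_n -> A}) (\prod_t P (f t)) *
    indic (~~ Rlt_dec (Rpower 2 (INR n * (mean (fun a => log2 (v a / r a)) - d)) *
             \prod_t r (f t)) (\prod_t v (f t)))
  <= variance (fun a => log2 (v a / r a)) / (d * d) / INR n.
Proof.
move=> n0 d0 hP; set g := fun a => log2 (v a / r a).
apply: Rle_trans (chebyshev g n0 d0); apply: leR_sum => f _.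
case: (pickP (fun t => ~~ Rlt_dec 0 (P (f t)))) => [t|hf].
  case: Rlt_dec => // h _; have z : P (f t) = 0 by have := P0 (f t); lra.
  by rewrite (@prodR_eq0 _ (fun t => P (f t)) t z); lra.
have pf t : 0 < P (f t) by have := hf t; case: Rlt_dec.
apply: Rmult_le_compat_l; first exact: prodR_ge0.
case: Rlt_dec => h /=; first exact: indic_ge0.
have vp : 0 < \prod_t v (f t) by apply: prodR_gt0 => t; case: (hP _ (pf t)).
have rp : 0 < \prod_t r (f t) by apply: prodR_gt0 => t; case: (hP _ (pf t)).
have pw : 0 < Rpower 2 (INR n * (mean g - d)) by apply: exp_pos.
have := log2_le vp (Rnot_lt_le _ _ h); rewrite log2_mult // log2_Rpower !log2_prod //;
  try by move=> t; case: (hP _ (pf t)).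
have -> : \sum_t log2 (v (f t)) = \sum_t g (f t) + \sum_t log2 (r (f t)).
  rewrite -big_split; apply: eq_bigr => t _ /=; case: (hP _ (pf t)) => a b.
  by rewrite /g log2_div //; lra.
by move=> h1; case: Rle_dec => h2; rewrite /indic /=; [lra | case: h2; apply: Rplus_le_reg_r h1].
Qed.

End Chebyshev.

(** * One-shot superposition coding *)

Lemma sumR_neq_const (I : finType) (i0 : I) c :
  \sum_(i | i != i0) c = INR #|I|.-1 * c.
Proof.
rewrite (eq_bigl (mem (predC1 i0))) // big_const cardC1.
elim: #|I|.-1 => [|k IH]; first by rewrite /=; ring.
by rewrite iterS IH S_INR; ring.
Qed.

(** Any message that passes the test may be picked, so an error requires that the true one fails or
    that a wrong one passes; then the union bound. *)
Lemma pick_error (M : finType) (t : pred M) (d m : M) :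
  indic (odflt d [pick m' | t m'] != m) <= indic (~~ t m) + \sum_(m' | m' != m) indic (t m').
Proof.
have s0 : 0 <= \sum_(m' | m' != m) indic (t m') by apply: sumR_ge0 => m' _; apply: indic_ge0.
case tm : (t m); last first.
  have e1 : indic (~~ false) = 1 by [].
  by rewrite e1; have := indic_le1 (odflt d [pick m' | t m'] != m); lra.
case: pickP => [m1 tm1|/(_ m)] /=; last by rewrite tm.
case: eqP => [_|/eqP ne] /=; first lra.
have := @le_sumR _ (fun m' => m' != m) (fun m' => indic (t m')) m1 ne (fun _ _ => indic_ge0 _).
by rewrite tm1 /indic; lra.
Qed.

(** Derandomisation: some codebook is at least as good as the average one. *)
Lemma exists_le_mean (T : finType) (w f : T -> R) c :
  (forall t, 0 <= w t) -> \sum_t w t = 1 -> \sum_t w t * f t <= c -> exists t, f t <= c.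
Proof.
move=> w0 w1 h; case: (pickP (fun t => Rle_dec (f t) c : bool)) => [t|hf].
  by case: Rle_dec => // ? _; exists t.
have fc t : c < f t by have := hf t; case: Rle_dec => //= ? _; lra.
have d0 t : 0 <= w t * (f t - c) by apply: Rmult_le_pos => //; have := fc t; lra.
have e : \sum_t w t * (f t - c) = \sum_t w t * f t - c.
  rewrite -[in RHS](Rmult_1_l c) -w1 -sumR_mulr -sumRB; apply: eq_bigr => t _; ring.
have s0 : 0 <= \sum_t w t * (f t - c) by apply: sumR_ge0.
have z : \sum_t w t * (f t - c) = 0 by lra.
have wz t : w t = 0.
  have := @sumR_eq0 _ xpredT _ (fun t _ => d0 t) z t isT.
  by case/Rmult_integral => //; have := fc t; lra.
by move: w1; rewrite big1 //; lra.
Qed.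

Section OneShot.
Variables (M0 Mp CU CX CY : finType).
Variables (PU : CU -> R) (Q : CU -> CX -> R) (V : CX -> CY -> R).
Hypothesis PU0 : forall u, 0 <= PU u.
Hypothesis PU1 : \sum_u PU u = 1.
Hypothesis Q0 : forall u x, 0 <= Q u x.
Hypothesis Q1 : forall u, \sum_x Q u x = 1.
Hypothesis V0 : forall x y, 0 <= V x y.
Hypothesis V1 : forall x, \sum_y V x y = 1.

Local Notation cloud := (CU * {ffun Mp -> CX})%type.
Local Notation book := {ffun M0 -> cloud}.

(** A cloud centre with satellites that are i.i.d. given the centre. *)
Definition cloud_law (b : cloud) : R := PU b.1 * \prod_i Q b.1 (b.2 i).
Definition book_law (w : book) : R := \prod_i cloud_law (w i).

Lemma cloud_law_ge0 b : 0 <= cloud_law b.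
Proof. by apply: Rmult_le_pos => //; apply: prodR_ge0. Qed.

Lemma book_law_ge0 w : 0 <= book_law w.
Proof. by apply: prodR_ge0 => i; apply: cloud_law_ge0. Qed.

Lemma cloud_law_sum1 : \sum_b cloud_law b = 1.
Proof.
rewrite sumR_pair /cloud_law /= -[RHS]PU1; apply: eq_bigr => u _.
by rewrite sumR_mull (@sum_prod_ffun1 _ _ (fun=> Q u)) // Rmult_1_r.
Qed.

Lemma book_law_sum1 : \sum_w book_law w = 1.
Proof. by apply: (@sum_prod_ffun1 _ _ (fun=> cloud_law)) => _; apply: cloud_law_sum1. Qed.

Lemma cloud_marg1 i (g : CU -> CX -> R) :
  \sum_b cloud_law b * g b.1 (b.2 i) = \sum_u \sum_x PU u * Q u x * g u x.
Proof.
rewrite sumR_pair /cloud_law /=; apply: eq_bigr => u _.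
under eq_bigr => b _ do rewrite Rmult_assoc.
rewrite sumR_mull (@prod_marg1 _ _ (fun=> Q u) i (g u)) // -sumR_mull.
by apply: eq_bigr => x _; ring.
Qed.

Lemma cloud_marg2 i i' (g : CU -> CX -> CX -> R) : i != i' ->
  \sum_b cloud_law b * g b.1 (b.2 i) (b.2 i') =
  \sum_u \sum_x \sum_x' PU u * Q u x * Q u x' * g u x x'.
Proof.
move=> ne; rewrite sumR_pair /cloud_law /=; apply: eq_bigr => u _.
under eq_bigr => b _ do rewrite Rmult_assoc.
rewrite sumR_mull (@prod_marg2 _ _ (fun=> Q u) i i' (g u)) // -sumR_mull.
apply: eq_bigr => x _; rewrite -sumR_mull.
by apply: eq_bigr => x' _; ring.
Qed.

Definition outU (u : CU) (y : CY) : R := \sum_x Q u x * V x y.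
Definition outY (y : CY) : R := \sum_u PU u * outU u y.

Lemma outU_ge0 u y : 0 <= outU u y.
Proof. by apply: sumR_ge0 => x _; apply: Rmult_le_pos. Qed.

Lemma outU_sum1 u : \sum_y outU u y = 1.
Proof. by rewrite /outU out_mass. Qed.

Section BothLayers.
Variables (g1 g2 : R).
Hypotheses (g1pos : 0 < g1) (g2pos : 0 < g2).

(** One threshold for each kind of wrong candidate: against the output law given the centre for a
    wrong satellite of the right cloud, against the overall output law for a wrong cloud. *)
Definition test2 (u : CU) (x : CX) (y : CY) : bool :=
  Rlt_dec (g1 * outU u y) (V x y) && Rlt_dec (g2 * outY y) (V x y).

Definition dec2 (d : M0 * Mp) (w : book) (y : CY) : M0 * Mp :=
  odflt d [pick m | test2 (w m.1).1 ((w m.1).2 m.2) y].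

Definition miss2 : R := \sum_u \sum_x \sum_y PU u * Q u x * V x y * indic (~~ test2 u x y).

(** Change of measure: where the test passes, the reference law is below the likelihood divided by
    [g1]. Summation over [y] bounds the false alarms by 1 / g1. *)
Lemma test2_le1 u x y : g1 * (outU u y * indic (test2 u x y)) <= V x y.
Proof.
rewrite /test2; case: Rlt_dec => h1; case: Rlt_dec => h2 /=; rewrite /indic;
  have := V0 x y; lra.
Qed.

Lemma test2_le2 u x y : g2 * (outY y * indic (test2 u x y)) <= V x y.
Proof.
rewrite /test2; case: Rlt_dec => h1; case: Rlt_dec => h2 /=; rewrite /indic;
  have := V0 x y; lra.
Qed.

(** Given the centre, a wrong satellite is independent of the received word, whose law is then
    [outU]. *)
Lemma same_cloud_bound : \sum_u \sum_x \sum_x' PU u * Q u x * Q u x' *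
    (\sum_y V x y * indic (test2 u x' y)) <= / g1.
Proof.
have -> : / g1 = \sum_u PU u * \sum_x' Q u x' * (\sum_y V x' y * / g1).
  under eq_bigr => u _ do under eq_bigr => x' _ do rewrite sumR_mulr V1.
  under eq_bigr => u _ do rewrite sumR_mulr Q1.
  by rewrite sumR_mulr PU1; ring.
apply: leR_sum => u _.
have -> : \sum_x \sum_x' PU u * Q u x * Q u x' * (\sum_y V x y * indic (test2 u x' y)) =
    PU u * \sum_x' Q u x' * (\sum_y outU u y * indic (test2 u x' y)).
  rewrite exchange_big -sumR_mull; apply: eq_bigr => x' _.
  have -> : \sum_y outU u y * indic (test2 u x' y) =
      \sum_x Q u x * \sum_y V x y * indic (test2 u x' y).
    under [RHS]eq_bigr => x _ do rewrite -sumR_mull.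
    rewrite [RHS]exchange_big; apply: eq_bigr => y _; rewrite /outU -sumR_mulr.
    by apply: eq_bigr => x _; ring.
  by rewrite -!sumR_mull; apply: eq_bigr => x _; ring.
apply: Rmult_le_compat_l => //; apply: leR_sum => x' _; apply: Rmult_le_compat_l => //.
apply: leR_sum => y _; have := test2_le1 u x' y => h.
apply: (Rmult_le_reg_l g1) => //; have -> : g1 * (V x' y * / g1) = V x' y by field; lra.
exact: h.
Qed.

(** A codeword of another cloud is independent of the received word, whose law is [outY]. *)
Lemma other_cloud_bound : \sum_u \sum_x \sum_u' \sum_x' PU u * Q u x * (PU u' * Q u' x' *
    (\sum_y V x y * indic (test2 u' x' y))) <= / g2.
Proof.
have -> : / g2 = \sum_u' PU u' * \sum_x' Q u' x' * (\sum_y V x' y * / g2).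
  under eq_bigr => u _ do under eq_bigr => x' _ do rewrite sumR_mulr V1.
  under eq_bigr => u _ do rewrite sumR_mulr Q1.
  by rewrite sumR_mulr PU1; ring.
have -> : \sum_u \sum_x \sum_u' \sum_x' PU u * Q u x * (PU u' * Q u' x' *
    (\sum_y V x y * indic (test2 u' x' y))) =
    \sum_u' PU u' * \sum_x' Q u' x' * (\sum_y outY y * indic (test2 u' x' y)).
  under eq_bigr => u _ do rewrite exchange_big.
  rewrite exchange_big; apply: eq_bigr => u' _.
  rewrite -sumR_mull; under eq_bigr => u _ do rewrite exchange_big.
  rewrite exchange_big; apply: eq_bigr => x' _.
  have -> : \sum_y outY y * indic (test2 u' x' y) =
      \sum_u \sum_x PU u * Q u x * \sum_y V x y * indic (test2 u' x' y).
    under [RHS]eq_bigr => u _ do under eq_bigr => x _ do rewrite -sumR_mull.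
    under [RHS]eq_bigr => u _ do rewrite exchange_big.
    rewrite [RHS]exchange_big; apply: eq_bigr => y _; rewrite /outY -sumR_mulr.
    apply: eq_bigr => u _; rewrite /outU Rmult_assoc -sumR_mulr -sumR_mull.
    by apply: eq_bigr => x _; ring.
  rewrite -!sumR_mull; apply: eq_bigr => u _; rewrite -!sumR_mull.
  by apply: eq_bigr => x _; ring.
apply: leR_sum => u' _.
apply: Rmult_le_compat_l => //; apply: leR_sum => x' _; apply: Rmult_le_compat_l => //.
apply: leR_sum => y _; have := test2_le2 u' x' y => h.
apply: (Rmult_le_reg_l g2) => //; have -> : g2 * (V x' y * / g2) = V x' y by field; lra.
exact: h.
Qed.

Lemma dec2_error (d : M0 * Mp) (m : M0 * Mp) :
  \sum_w book_law w * (\sum_y V ((w m.1).2 m.2) y * indic (dec2 d w y != m)) <=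
  miss2 + INR (#|Mp|.-1) * / g1 + INR (#|M0|.-1) * INR #|Mp| * / g2.
Proof.
case: m => m0 mp /=.
pose tst (w : book) m0' mp' y := test2 (w m0').1 ((w m0').2 mp') y.
pose a (w : book) := \sum_y V ((w m0).2 mp) y * indic (~~ tst w m0 mp y).
pose b (w : book) mp' := \sum_y V ((w m0).2 mp) y * indic (tst w m0 mp' y).
pose e (w : book) m0' mp' := \sum_y V ((w m0).2 mp) y * indic (tst w m0' mp' y).
apply: (@Rle_trans _ (\sum_w book_law w * a w + \sum_(mp' | mp' != mp) \sum_w book_law w * b w mp'
   + \sum_(m0' | m0' != m0) \sum_mp' \sum_w book_law w * e w m0' mp')).
  rewrite [X in _ <= _ + X + _]exchange_big /=.
  under [X in _ <= _ + X]eq_bigr => m0' _ do rewrite exchange_big.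
  rewrite [X in _ <= _ + X]exchange_big -!big_split /=; apply: leR_sum => w _.
  rewrite sumR_mull; under [X in _ <= _ + X]eq_bigr => m0' _ do rewrite sumR_mull.
  rewrite sumR_mull -!Rmult_plus_distr_l; apply: Rmult_le_compat_l; first exact: book_law_ge0.
  rewrite /a /b /e exchange_big /=.
  under [X in _ <= _ + X]eq_bigr => m0' _ do rewrite exchange_big.
  rewrite [X in _ <= _ + X]exchange_big -!big_split /=; apply: leR_sum => y _.
  rewrite sumR_mull; under [X in _ <= _ + X]eq_bigr => m0' _ do rewrite sumR_mull.
  rewrite sumR_mull -!Rmult_plus_distr_l; apply: Rmult_le_compat_l => //.
  apply: Rle_trans (pick_error _ _ _) _; rewrite Rplus_assoc; apply: Rplus_le_compat_l.
  (* The wrong messages are split into those of the same cloud and those of other clouds. *)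
  right; rewrite (bigID (fun m' : M0 * Mp => m'.1 == m0)) /=; congr (_ + _).
    rewrite (eq_bigl (fun m' : M0 * Mp => (m'.1 == m0) && (m'.2 != mp))); last first.
      by case=> i j /=; rewrite xpair_eqE; case: eqP; rewrite ?andbF ?andbT.
    rewrite -(pair_big (pred1 m0) (fun j => j != mp) (fun i j => indic (tst w i j y))) /=.
    by rewrite big_pred1_eq.
  rewrite (eq_bigl (fun m' : M0 * Mp => (m'.1 != m0) && true)); last first.
    by case=> i j /=; rewrite xpair_eqE andbT; case: eqP => //= _; rewrite ?andbT ?andbF.
  by rewrite -(pair_big (fun i => i != m0) xpredT (fun i j => indic (tst w i j y))).
apply: Rplus_le_compat; [apply: Rplus_le_compat|].
- right; rewrite /a /book_law /tst.
  rewrite (@prod_marg1 _ _ (fun=> cloud_law) m0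
    (fun b => \sum_y V (b.2 mp) y * indic (~~ test2 b.1 (b.2 mp) y))); last first.
    by move=> _; apply: cloud_law_sum1.
  rewrite (cloud_marg1 mp (fun u x => \sum_y V x y * indic (~~ test2 u x y))) /miss2.
  apply: eq_bigr => u _; apply: eq_bigr => x _; rewrite -sumR_mull.
  by apply: eq_bigr => y _; ring.
- apply: (@Rle_trans _ (\sum_(mp' | mp' != mp) / g1)).
    apply: leR_sum => mp' ne; rewrite /b /book_law /tst.
    rewrite (@prod_marg1 _ _ (fun=> cloud_law) m0
      (fun b => \sum_y V (b.2 mp) y * indic (test2 b.1 (b.2 mp') y))); last first.
      by move=> _; apply: cloud_law_sum1.
    rewrite (@cloud_marg2 mp mp' (fun u x x' => \sum_y V x y * indic (test2 u x' y))); last first.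
      by rewrite eq_sym.
    exact: same_cloud_bound.
  by right; rewrite sumR_neq_const -?Rmult_assoc.
- apply: (@Rle_trans _ (\sum_(m0' | m0' != m0) INR #|Mp| * / g2)).
    apply: leR_sum => m0' ne; rewrite -sumR_const; apply: leR_sum => mp' _.
    rewrite /e /book_law /tst.
    rewrite (@prod_marg2 _ _ (fun=> cloud_law) m0 m0'
      (fun b b' => \sum_y V (b.2 mp) y * indic (test2 b'.1 (b'.2 mp') y))); first last.
    - by rewrite eq_sym.
    - by move=> _; apply: cloud_law_sum1.
    apply: Rle_trans other_cloud_bound; right.
    transitivity (\sum_b cloud_law b * \sum_u' \sum_x' PU u' * Q u' x' *
        (\sum_y V (b.2 mp) y * indic (test2 u' x' y))).
      apply: eq_bigr => b1 _.
      rewrite -(cloud_marg1 mp' (fun u' x' => \sum_y V (b1.2 mp) y * indic (test2 u' x' y))).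
      by rewrite -sumR_mull; apply: eq_bigr => b' _; ring.
    rewrite (cloud_marg1 mp (fun u x => \sum_u' \sum_x' PU u' * Q u' x' *
        (\sum_y V x y * indic (test2 u' x' y)))).
    apply: eq_bigr => u _; apply: eq_bigr => x _; rewrite -sumR_mull.
    by apply: eq_bigr => u' _; rewrite -sumR_mull.
  by right; rewrite sumR_neq_const -?Rmult_assoc.
Qed.

End BothLayers.

Section CloudLayer.
Variable g0 : R.
Hypothesis g0pos : 0 < g0.

(** The satellites are averaged out: only the cloud is decoded, through the law of the output given
    its centre. *)
Definition test1 (u : CU) (y : CY) : bool := Rlt_dec (g0 * outY y) (outU u y).

Definition dec1 (d : M0) (w : book) (y : CY) : M0 := odflt d [pick m | test1 (w m).1 y].

Definition miss1 : R := \sum_u \sum_x \sum_y PU u * Q u x * V x y * indic (~~ test1 u y).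

Lemma cloud_bound : \sum_u \sum_x \sum_u' PU u * Q u x * (PU u' *
    (\sum_y V x y * indic (test1 u' y))) <= / g0.
Proof.
have -> : / g0 = \sum_u' PU u' * (\sum_y outU u' y * / g0).
  under eq_bigr => u _ do rewrite sumR_mulr outU_sum1.
  by rewrite sumR_mulr PU1; ring.
have -> : \sum_u \sum_x \sum_u' PU u * Q u x * (PU u' *
    (\sum_y V x y * indic (test1 u' y))) =
    \sum_u' PU u' * (\sum_y outY y * indic (test1 u' y)).
  under eq_bigr => u _ do rewrite exchange_big.
  rewrite exchange_big; apply: eq_bigr => u' _.
  have -> : \sum_y outY y * indic (test1 u' y) =
      \sum_u \sum_x PU u * Q u x * \sum_y V x y * indic (test1 u' y).
    under [RHS]eq_bigr => u _ do under eq_bigr => x _ do rewrite -sumR_mull.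
    under [RHS]eq_bigr => u _ do rewrite exchange_big.
    rewrite [RHS]exchange_big; apply: eq_bigr => y _; rewrite /outY -sumR_mulr.
    apply: eq_bigr => u _; rewrite /outU Rmult_assoc -sumR_mulr -sumR_mull.
    by apply: eq_bigr => x _; ring.
  rewrite -!sumR_mull; apply: eq_bigr => u _; rewrite -!sumR_mull.
  by apply: eq_bigr => x _; ring.
apply: leR_sum => u' _; apply: Rmult_le_compat_l => //; apply: leR_sum => y _.
apply: (Rmult_le_reg_l g0) => //; have -> : g0 * (outU u' y * / g0) = outU u' y by field; lra.
by rewrite /test1; case: Rlt_dec => h /=; rewrite /indic; have := outU_ge0 u' y; lra.
Qed.

Lemma dec1_error (d : M0) (m : M0 * Mp) :
  \sum_w book_law w * (\sum_y V ((w m.1).2 m.2) y * indic (dec1 d w y != m.1)) <=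
  miss1 + INR (#|M0|.-1) * / g0.
Proof.
case: m => m0 mp /=.
pose a (w : book) := \sum_y V ((w m0).2 mp) y * indic (~~ test1 (w m0).1 y).
pose e (w : book) m0' := \sum_y V ((w m0).2 mp) y * indic (test1 (w m0').1 y).
apply: (@Rle_trans _ (\sum_w book_law w * a w +
   \sum_(m0' | m0' != m0) \sum_w book_law w * e w m0')).
  rewrite [X in _ <= _ + X]exchange_big /=.
  rewrite -!big_split /=; apply: leR_sum => w _.
  rewrite sumR_mull -!Rmult_plus_distr_l; apply: Rmult_le_compat_l; first exact: book_law_ge0.
  rewrite /a /e exchange_big /= -!big_split /=; apply: leR_sum => y _.
  rewrite sumR_mull -!Rmult_plus_distr_l; apply: Rmult_le_compat_l => //.
  exact: pick_error.
apply: Rplus_le_compat.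
- right; rewrite /a /book_law.
  rewrite (@prod_marg1 _ _ (fun=> cloud_law) m0
    (fun b => \sum_y V (b.2 mp) y * indic (~~ test1 b.1 y))); last first.
    by move=> _; apply: cloud_law_sum1.
  rewrite (cloud_marg1 mp (fun u x => \sum_y V x y * indic (~~ test1 u y))) /miss1.
  apply: eq_bigr => u _; apply: eq_bigr => x _; rewrite -sumR_mull.
  by apply: eq_bigr => y _; ring.
- apply: (@Rle_trans _ (\sum_(m0' | m0' != m0) / g0)).
    apply: leR_sum => m0' ne; rewrite /e /book_law.
    rewrite (@prod_marg2 _ _ (fun=> cloud_law) m0 m0'
      (fun b b' => \sum_y V (b.2 mp) y * indic (test1 b'.1 y))); first last.
    - by rewrite eq_sym.
    - by move=> _; apply: cloud_law_sum1.
    apply: Rle_trans cloud_bound; right.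
    transitivity (\sum_b cloud_law b * \sum_u' PU u' *
        (\sum_y V (b.2 mp) y * indic (test1 u' y))).
      apply: eq_bigr => b _.
      have -> : \sum_u' PU u' * (\sum_y V (b.2 mp) y * indic (test1 u' y)) =
          \sum_u' \sum_x' PU u' * Q u' x' * (\sum_y V (b.2 mp) y * indic (test1 u' y)).
        by apply: eq_bigr => u' _; rewrite sumR_mulr sumR_mull Q1 Rmult_1_r.
      rewrite -(cloud_marg1 mp (fun u' x' => \sum_y V (b.2 mp) y * indic (test1 u' y))).
      by rewrite -sumR_mull; apply: eq_bigr => b' _; ring.
    rewrite (cloud_marg1 mp (fun u x => \sum_u' PU u' *
        (\sum_y V x y * indic (test1 u' y)))).
    by apply: eq_bigr => u _; apply: eq_bigr => x _; rewrite -sumR_mull.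
  by right; rewrite sumR_neq_const -?Rmult_assoc.
Qed.

End CloudLayer.
End OneShot.

(** * Memoryless extensions *)

Section Letters.
Variables (U X B : finType) (pU : U -> R) (q : U -> X -> R) (V : X -> B -> R).
Hypothesis pU0 : forall u, 0 <= pU u.
Hypothesis pU1 : \sum_u pU u = 1.
Hypothesis q0 : forall u x, 0 <= q u x.
Hypothesis q1 : forall u, \sum_x q u x = 1.
Hypothesis V0 : forall x y, 0 <= V x y.
Hypothesis V1 : forall x, \sum_y V x y = 1.

Definition ext1 (A : finType) (f : A -> R) n (a : {ffun 'I_n -> A}) : R := \prod_t f (a t).
Definition ext2 (A C : finType) (f : A -> C -> R) n (a : {ffun 'I_n -> A})
  (c : {ffun 'I_n -> C}) : R := \prod_t f (a t) (c t).

Lemma ext1_ge0 (A : finType) (f : A -> R) n a : (forall a, 0 <= f a) -> 0 <= @ext1 A f n a.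
Proof. by move=> h; apply: prodR_ge0. Qed.

Lemma ext2_ge0 (A C : finType) (f : A -> C -> R) n a c :
  (forall a c, 0 <= f a c) -> 0 <= @ext2 A C f n a c.
Proof. by move=> h; apply: prodR_ge0. Qed.

Lemma ext1_sum1 (A : finType) (f : A -> R) n : \sum_a f a = 1 -> \sum_a @ext1 A f n a = 1.
Proof. by move=> h; apply: (@sum_prod_ffun1 _ _ (fun=> f)). Qed.

Lemma ext2_sum1 (A C : finType) (f : A -> C -> R) n a :
  (forall a, \sum_c f a c = 1) -> \sum_c @ext2 A C f n a c = 1.
Proof. by move=> h; apply: (@sum_prod_ffun1 _ _ (fun t => f (a t))). Qed.

(** Averaging a product over independent letters factorises; hence the block densities are sums of
    letter densities. *)
Lemma outU_ext n u y :
  outU (@ext2 U X q n) (@ext2 X B V n) u y = \prod_t outU q V (u t) (y t).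
Proof.
rewrite /outU -(@sum_prod_ffun _ _ (fun t x => q (u t) x * V x (y t))).
by apply: eq_bigr => x _; rewrite /ext2 -big_split.
Qed.

Lemma outY_ext n y :
  outY (@ext1 U pU n) (@ext2 U X q n) (@ext2 X B V n) y = \prod_t outY pU q V (y t).
Proof.
rewrite /outY -(@sum_prod_ffun _ _ (fun t u => pU u * outU q V u (y t))).
by apply: eq_bigr => u _; rewrite outU_ext /ext1 -big_split.
Qed.

Definition joint (a : U * X * B) : R := pU a.1.1 * q a.1.1 a.1.2 * V a.1.2 a.2.

Lemma joint_ge0 a : 0 <= joint a.
Proof. by apply: Rmult_le_pos => //; apply: Rmult_le_pos. Qed.

Lemma sum_joint (F : U -> X -> B -> R) :
  \sum_a joint a * F a.1.1 a.1.2 a.2 = \sum_u \sum_x \sum_y pU u * q u x * V x y * F u x y.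
Proof. by rewrite !sumR_pair. Qed.

Lemma joint_sum1 : \sum_a joint a = 1.
Proof.
rewrite !sumR_pair /joint /= -[RHS]pU1; apply: eq_bigr => u _.
under eq_bigr => x _ do rewrite sumR_mull V1 Rmult_1_r.
by rewrite sumR_mull q1 Rmult_1_r.
Qed.

Lemma joint_pos a : 0 < joint a ->
  0 < V a.1.2 a.2 /\ 0 < outU q V a.1.1 a.2 /\ 0 < outY pU q V a.2.
Proof.
case: a => [[u x] y]; rewrite /joint /= => h.
have pu : 0 < pU u by case: (pU0 u) => // e; move: h; rewrite -e !Rmult_0_l; lra.
have qu : 0 < q u x by case: (q0 u x) => // e; move: h; rewrite -e Rmult_0_r Rmult_0_l; lra.
have v : 0 < V x y by case: (V0 x y) => // e; move: h; rewrite -e Rmult_0_r; lra.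
have o0 u' : 0 <= outU q V u' y by apply: outU_ge0.
have r : 0 < outU q V u y.
  apply: Rlt_le_trans (@le_sumR _ xpredT (fun x => q u x * V x y) x isT _).
    exact: Rmult_lt_0_compat.
  by move=> x' _; apply: Rmult_le_pos.
split=> //; split=> //.
apply: Rlt_le_trans (@le_sumR _ xpredT (fun u => pU u * outU q V u y) u isT _).
  exact: Rmult_lt_0_compat.
by move=> u' _; apply: Rmult_le_pos.
Qed.

Lemma sum_ext_joint n (F : {ffun 'I_n -> U} -> {ffun 'I_n -> X} -> {ffun 'I_n -> B} -> R) :
  \sum_u \sum_x \sum_y ext1 pU u * ext2 q u x * ext2 V x y * F u x y =
  \sum_(f : {ffun 'I_n -> U * X * B}) (\prod_t joint (f t)) *
     F [ffun t => (f t).1.1] [ffun t => (f t).1.2] [ffun t => (f t).2].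
Proof.
rewrite !sum_ffun_pair; apply: eq_bigr => u _; apply: eq_bigr => x _; apply: eq_bigr => y _.
congr (_ * _).
  by rewrite /ext1 /ext2 -!big_split; apply: eq_bigr => t _; rewrite /joint !ffunE.
by congr F; apply/ffunP => t; rewrite !ffunE.
Qed.

(** [dens12], [dens2] and [dens1] are the information densities i(x;y|u), i(x;y) and i(u;y). *)
Definition dens12 (a : U * X * B) : R := log2 (V a.1.2 a.2 / outU q V a.1.1 a.2).
Definition dens2 (a : U * X * B) : R := log2 (V a.1.2 a.2 / outY pU q V a.2).
Definition dens1 (a : U * X * B) : R := log2 (outU q V a.1.1 a.2 / outY pU q V a.2).

(** Union bound over the two thresholds, each placed below its mean density by a margin that
    Chebyshev's inequality turns into O(1/n). *)
Lemma miss2_bound n d1 d2 : (0 < n)%N -> 0 < d1 -> 0 < d2 ->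
  miss2 (@ext1 U pU n) (@ext2 U X q n) (@ext2 X B V n)
    (Rpower 2 (INR n * (mean joint dens12 - d1))) (Rpower 2 (INR n * (mean joint dens2 - d2)))
  <= (variance joint dens12 / (d1 * d1) + variance joint dens2 / (d2 * d2)) / INR n.
Proof.
move=> n0 d10 d20; rewrite Rdiv_plus_distr.
have s1 := @information_spectrum _ _ joint_ge0 joint_sum1 n
  (fun a => V a.1.2 a.2) (fun a => outU q V a.1.1 a.2) d1 n0 d10.
have s2 := @information_spectrum _ _ joint_ge0 joint_sum1 n
  (fun a => V a.1.2 a.2) (fun a => outY pU q V a.2) d2 n0 d20.
apply: Rle_trans (Rplus_le_compat _ _ _ _ (s1 _) (s2 _)); first last.
- by move=> a /joint_pos [? [? ?]].
- by move=> a /joint_pos [? [? ?]].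
rewrite /miss2 sum_ext_joint -big_split; apply: leR_sum => f _ /=.
rewrite -Rmult_plus_distr_l; apply: Rmult_le_compat_l.
  by apply: prodR_ge0 => t; apply: joint_ge0.
rewrite /test2 outU_ext outY_ext /ext2.
have -> : \prod_t V ([ffun t0 => (f t0).1.2] t) ([ffun t0 => (f t0).2] t) =
          \prod_t V (f t).1.2 (f t).2 by apply: eq_bigr => t _; rewrite !ffunE.
have -> : \prod_t outU q V ([ffun t0 => (f t0).1.1] t) ([ffun t0 => (f t0).2] t) =
          \prod_t outU q V (f t).1.1 (f t).2 by apply: eq_bigr => t _; rewrite !ffunE.
have -> : \prod_t outY pU q V ([ffun t0 => (f t0).2] t) = \prod_t outY pU q V (f t).2.
  by apply: eq_bigr => t _; rewrite !ffunE.
rewrite negb_and -/dens12 -/dens2.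
by case: (~~ _) => /=; case: (~~ _); rewrite /indic /=; lra.
Qed.

Lemma miss1_bound n d0 : (0 < n)%N -> 0 < d0 ->
  miss1 (@ext1 U pU n) (@ext2 U X q n) (@ext2 X B V n)
    (Rpower 2 (INR n * (mean joint dens1 - d0)))
  <= variance joint dens1 / (d0 * d0) / INR n.
Proof.
move=> n0 d00.
have s1 := @information_spectrum _ _ joint_ge0 joint_sum1 n
  (fun a => outU q V a.1.1 a.2) (fun a => outY pU q V a.2) d0 n0 d00.
apply: Rle_trans (s1 _); last by move=> a /joint_pos [? [? ?]].
rewrite /miss1 sum_ext_joint; right; apply: eq_bigr => f _ /=.
rewrite /test1 outU_ext outY_ext -/dens1.
have -> : \prod_t outU q V ([ffun t0 => (f t0).1.1] t) ([ffun t0 => (f t0).2] t) =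
          \prod_t outU q V (f t).1.1 (f t).2 by apply: eq_bigr => t _; rewrite !ffunE.
have -> // : \prod_t outY pU q V ([ffun t0 => (f t0).2] t) = \prod_t outY pU q V (f t).2.
by apply: eq_bigr => t _; rewrite !ffunE.
Qed.

Variable p : U -> X -> R.
Hypothesis pE : forall u x, pU u * q u x = p u x.

Let p0 u x : 0 <= p u x.
Proof. by rewrite -pE; apply: Rmult_le_pos. Qed.

Let pUE u : \sum_x p u x = pU u.
Proof. by under eq_bigr => x _ do rewrite -pE; rewrite sumR_mull q1 Rmult_1_r. Qed.

Let outUE u y : \sum_x p u x * V x y = pU u * outU q V u y.
Proof. by rewrite /outU -sumR_mull; apply: eq_bigr => x _; rewrite -pE; ring. Qed.

Let outYE y : \sum_x (\sum_u p u x) * V x y = outY pU q V y.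
Proof.
rewrite /outY; under [RHS]eq_bigr => u _ do rewrite -outUE.
by rewrite exchange_big; apply: eq_bigr => x _; rewrite sumR_mulr.
Qed.

Lemma mean_dens12 : mean joint dens12 = cmutinf (fun u x y => p u x * V x y).
Proof.
rewrite /mean /dens12 (sum_joint (fun u x y => log2 (V x y / outU q V u y))) /cmutinf /rsum.
apply: eq_bigr => u _; apply: eq_bigr => x _; apply: eq_bigr => y _ /=.
rewrite plogqE pE sumR_mull V1 outUE.
have -> : \sum_x' \sum_y' p u x' * V x' y' = pU u.
  by rewrite -pUE; apply: eq_bigr => x' _; rewrite sumR_mull V1 Rmult_1_r.
case: (Rmult_le_pos _ _ (p0 u x) (V0 x y)) => [h|<-]; last by rewrite !Rmult_0_l.
have h' : 0 < joint (u, x, y) by rewrite /joint /= pE.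
have [v [r _]] := joint_pos h'.
have pux : 0 < p u x by case: (p0 u x) => // e; move: h; rewrite -e Rmult_0_l; lra.
have pu : 0 < pU u by case: (pU0 u) => // e; move: pux; rewrite -pE -e Rmult_0_l; lra.
congr (_ * log2 _); move: v r => /= v r; by field; lra.
Qed.

Lemma mean_dens2 : mean joint dens2 = mutinf (fun x y => (\sum_u p u x) * V x y).
Proof.
rewrite /mean /dens2 (sum_joint (fun u x y => log2 (V x y / outY pU q V y))) /mutinf /rsum.
rewrite exchange_big; apply: eq_bigr => x _.
rewrite exchange_big; apply: eq_bigr => y _ /=.
rewrite sumR_mulr plogqE sumR_mull V1 outYE.
have -> : \sum_u pU u * q u x * V x y = (\sum_u p u x) * V x y.
  by rewrite -sumR_mulr; apply: eq_bigr => u _; rewrite pE.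
have s0 : 0 <= \sum_u p u x by apply: sumR_ge0.
case: s0 => [s0|<-]; last by rewrite !Rmult_0_l.
case: (V0 x y) => [v|<-]; last by rewrite !Rmult_0_r !Rmult_0_l.
have o : 0 < outY pU q V y.
  rewrite -outYE; apply: Rlt_le_trans (@le_sumR _ xpredT (fun x => (\sum_u p u x) * V x y) x isT _).
    exact: Rmult_lt_0_compat.
  by move=> x' _; apply: Rmult_le_pos => //; apply: sumR_ge0.
by congr (_ * log2 _); field; lra.
Qed.

Lemma mean_dens1 : mean joint dens1 = mutinf (fun u y => \sum_x p u x * V x y).
Proof.
rewrite /mean /dens1 (sum_joint (fun u x y => log2 (outU q V u y / outY pU q V y))) /mutinf /rsum.
apply: eq_bigr => u _; rewrite exchange_big; apply: eq_bigr => y _ /=.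
rewrite sumR_mulr plogqE.
have -> : \sum_x pU u * q u x * V x y = pU u * outU q V u y.
  by rewrite -outUE; apply: eq_bigr => x _; rewrite pE.
have -> : \sum_a \sum_x p a x * V x y = outY pU q V y.
  by apply: eq_bigr => a _; rewrite outUE.
have -> : \sum_b \sum_x p u x * V x b = pU u by rewrite out_mass // pUE.
rewrite outUE; case: (pU0 u) => [pu|<-]; last by rewrite !Rmult_0_l.
have o0 u' : 0 <= outU q V u' y by apply: outU_ge0.
case: (o0 u) => [r|<-]; last by rewrite !Rmult_0_r !Rmult_0_l.
have o : 0 < outY pU q V y.
  apply: Rlt_le_trans (@le_sumR _ xpredT (fun u => pU u * outU q V u y) u isT _).
    exact: Rmult_lt_0_compat.
  by move=> u' _; apply: Rmult_le_pos.
by congr (_ * log2 _); field; lra.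
Qed.

End Letters.

(** * Random codes *)

Section RandomCode.
Variables (K : nat) (X : finType) (Y : 'I_K -> finType) (W : X -> outT Y -> R).
Hypothesis HW : is_channel W.
Let V0 j := @marg_ge0 _ _ _ _ HW j.
Let V1 j := @marg_sum1 _ _ _ _ HW j.

(** The outputs of the other receivers are summed out letter by letter, so correlation between
    receivers does not enter the error of a single one. *)
Lemma sum_joint_outputs n (x : {ffun 'I_n -> X}) j (G : {ffun 'I_n -> Y j} -> R) :
  \sum_(yn : {ffun 'I_n -> outT Y}) (\prod_t W (x t) (yn t)) * G [ffun t => yn t j] =
  \sum_z ext2 (marg W j) x z * G z.
Proof.
rewrite (sumR_fiber (fun yn : {ffun 'I_n -> outT Y} => [ffun t => yn t j])).
apply: eq_bigr => z _.
rewrite /ext2; under [in RHS]eq_bigr => t _ do rewrite margE big_mkcond.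
rewrite -(@sum_prod_ffun _ _ (fun t (ya : outT Y) => if ya j == z t then W (x t) ya else 0)).
rewrite big_mkcond -sumR_mulr; apply: eq_bigr => yn _ /=.
case: eqP => [<-|ne].
  by congr (_ * _); apply: eq_bigr => t _; rewrite ffunE eqxx.
case: (pickP (fun t => yn t j != z t)) => [t /negbTE h|h].
  by rewrite (@prodR_eq0 _ _ t) ?Rmult_0_l // h.
by case: ne; apply/ffunP => t; rewrite ffunE; apply/eqP; move: (h t) => /negbFE.
Qed.

Variables (U : finType) (p : U -> X -> R).
Hypothesis hp : is_pmf2 p.

Definition margU (u : U) : R := \sum_x p u x.
(* Where [margU u = 0] the conditional law is irrelevant; any pmf will do. *)
Definition condX (u : U) (x : X) : R :=
  if Req_dec_T (margU u) 0 then \sum_u p u x else p u x / margU u.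

Let p0 u x : 0 <= p u x. Proof. by case: hp. Qed.

Lemma margU_ge0 u : 0 <= margU u.
Proof. exact: sumR_ge0. Qed.

Lemma margU_sum1 : \sum_u margU u = 1.
Proof. by case: hp. Qed.

Lemma condX_ge0 u x : 0 <= condX u x.
Proof.
rewrite /condX; case: Req_dec_T => [_|h] /=; first exact: sumR_ge0.
apply: Rmult_le_pos => //; apply/Rlt_le/Rinv_0_lt_compat.
by have := margU_ge0 u; lra.
Qed.

Lemma condX_sum1 u : \sum_x condX u x = 1.
Proof.
rewrite /condX; case: Req_dec_T => [_|h] /=; first by rewrite exchange_big; case: hp.
by rewrite sumR_mulr -/(margU u); field.
Qed.

Lemma margU_condX u x : margU u * condX u x = p u x.
Proof.
rewrite /condX; case: Req_dec_T => [h|h] /=; last by field.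
rewrite h Rmult_0_l; symmetry.
exact: (@sumR_eq0 _ xpredT (p u)).
Qed.

Let j3 j := joint margU condX (marg W j).
Let v12 j := variance (@j3 j) (dens12 condX (marg W j)).
Let v2 j := variance (@j3 j) (dens2 margU condX (marg W j)).
Let v1 j := variance (@j3 j) (dens1 margU condX (marg W j)).

Section FixedSize.
Variables (k : 'I_K) (g0 : R) (g1 g2 : 'I_K -> R).
Hypothesis rk : rcv k = K.
Hypothesis hg0 : g0 < I_UY W p k.
Hypothesis hg1 : forall j, j != k -> g1 j < I_XY_given_U W p j.
Hypothesis hg2 : forall j, j != k -> g2 j < I_XY W (fun x => \sum_u p u x) j.
(** [a] counts the values of M2. M1 is split into a part with [b] values, sent with M2 in the cloud,
    and a part with [d] values, sent by the satellite. *)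
Variables (n a b d : nat).
Hypotheses (npos : (0 < n)%N) (apos : (0 < a)%N) (bpos : (0 < b)%N) (dpos : (0 < d)%N).

Local Notation M0 := ('I_a * 'I_b)%type.
Local Notation Mp := 'I_d.
Local Notation N1 := #|{: 'I_b * 'I_d}|.
Local Notation book := {ffun M0 -> {ffun 'I_n -> U} * {ffun Mp -> {ffun 'I_n -> X}}}.

Let d0 := I_UY W p k - g0.
Let d1 j := I_XY_given_U W p j - g1 j.
Let d2 j := I_XY W (fun x => \sum_u p u x) j - g2 j.
Let PU := @ext1 U margU n.
Let Q := @ext2 U X condX n.
Let V j (x : {ffun 'I_n -> X}) (y : {ffun 'I_n -> Y j}) := ext2 (marg W j) x y.
Let e0 : M0 := (Ordinal apos, Ordinal bpos).
Let ep : Mp := Ordinal dpos.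
Let dK j (w : book) y := dec1 PU Q (@V j) (Rpower 2 (INR n * g0)) e0 w y.
Let dJ j (w : book) y :=
  dec2 PU Q (@V j) (Rpower 2 (INR n * g1 j)) (Rpower 2 (INR n * g2 j)) (e0, ep) w y.
Let word (w : book) (m : M0 * Mp) := (w m.1).2 m.2.
Let eK w m := \sum_y @V k (word w m) y * indic (@dK k w y != m.1).
Let eJ j w m := \sum_y @V j (word w m) y * indic (@dJ j w y != m).

Let PUge u : 0 <= PU u. Proof. by apply: ext1_ge0; apply: margU_ge0. Qed.
Let PUs : \sum_u PU u = 1. Proof. by apply: ext1_sum1; apply: margU_sum1. Qed.
Let Qge u x : 0 <= Q u x. Proof. by apply: ext2_ge0; apply: condX_ge0. Qed.
Let Qs u : \sum_x Q u x = 1. Proof. by apply: ext2_sum1; apply: condX_sum1. Qed.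
Let Vge j x y : 0 <= @V j x y. Proof. exact: ext2_ge0. Qed.
Let Vs j x : \sum_y @V j x y = 1. Proof. exact: ext2_sum1. Qed.
Let Gp r : 0 < Rpower 2 r. Proof. exact: exp_pos. Qed.
Let Gi r : / Rpower 2 r = Rpower 2 (- r). Proof. by rewrite Rpower_Ropp. Qed.

Let cM0 : #|{: M0}| = (a * b)%N. Proof. by rewrite card_prod !card_ord. Qed.

Let mean_eK m : \sum_w book_law PU Q w * eK w m <=
  v1 k / (d0 * d0) / INR n + INR (a * b).-1 * Rpower 2 (- (INR n * g0)).
Proof.
apply: Rle_trans (dec1_error PUge PUs Qge Qs (@Vge k) (@Vs k) (Gp _) e0 m) _.
rewrite cM0 Gi; apply: Rplus_le_compat_r.
have -> : g0 = mean (@j3 k) (dens1 margU condX (marg W k)) - d0.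
  rewrite (mean_dens1 margU_ge0 condX_ge0 condX_sum1 (@V0 k) (@V1 k) margU_condX).
  by rewrite /d0 /I_UY /rsum; ring.
apply: miss1_bound => //; [exact: margU_ge0|exact: margU_sum1|exact: condX_ge0|exact: condX_sum1|].
by rewrite /d0; lra.
Qed.

Let mean_eJ j m : j != k -> \sum_w book_law PU Q w * eJ j w m <=
  (v12 j / (d1 j * d1 j) + v2 j / (d2 j * d2 j)) / INR n +
  (INR d.-1 * Rpower 2 (- (INR n * g1 j)) + INR (a * b).-1 * INR d * Rpower 2 (- (INR n * g2 j))).
Proof.
move=> jk.
apply: Rle_trans (dec2_error PUge PUs Qge Qs (@Vge j) (@Vs j) (Gp _) (Gp _) (e0, ep) m) _.
rewrite cM0 card_ord !Gi Rplus_assoc; apply: Rplus_le_compat_r.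
have -> : g1 j = mean (@j3 j) (dens12 condX (marg W j)) - d1 j.
  rewrite (mean_dens12 margU_ge0 condX_ge0 condX_sum1 (@V0 j) (@V1 j) margU_condX).
  by rewrite /d1 /I_XY_given_U; ring.
have -> : g2 j = mean (@j3 j) (dens2 margU condX (marg W j)) - d2 j.
  rewrite (mean_dens2 margU_ge0 condX_ge0 (@V0 j) (@V1 j) margU_condX).
  by rewrite /d2 /I_XY; ring.
apply: miss2_bound => //; [exact: margU_ge0|exact: margU_sum1|exact: condX_ge0|exact: condX_sum1| |].
  by rewrite /d1; have := hg1 jk; lra.
by rewrite /d2; have := hg2 jk; lra.
Qed.

(** Sum of the Chebyshev constants of all receivers; it depends neither on the block length nor on
    the codebook sizes. *)
Definition codeC : R :=
  v1 k / (d0 * d0) + \sum_(j | j != k) (v12 j / (d1 j * d1 j) + v2 j / (d2 j * d2 j)).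

Let tot := codeC / INR n + INR (a * b).-1 * Rpower 2 (- (INR n * g0)) +
  \sum_(j | j != k) (INR d.-1 * Rpower 2 (- (INR n * g1 j)) +
                     INR (a * b).-1 * INR d * Rpower 2 (- (INR n * g2 j))).

Let NN := INR a * INR b * INR d.

Let NNp : 0 < NN.
Proof. by rewrite /NN; do ?apply: Rmult_lt_0_compat; apply: lt_0_INR; apply/leP. Qed.

(** The errors of all receivers and messages are added before a book is chosen, so that one book
    serves them all. *)
Let good_book : exists w : book, \sum_m (eK w m + \sum_(j | j != k) eJ j w m) <= NN * tot.
Proof.
apply: (@exists_le_mean _ (book_law PU Q)).
- by move=> w; apply: book_law_ge0.
- exact: book_law_sum1.
under eq_bigr => w _ do rewrite -sumR_mull.
rewrite exchange_big /=.
have -> : NN * tot = \sum_(m : M0 * Mp) tot.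
  by rewrite sumR_const card_prod cM0 card_ord !mult_INR.
apply: leR_sum => m _.
have -> : \sum_w book_law PU Q w * (eK w m + \sum_(j | j != k) eJ j w m) =
    \sum_w book_law PU Q w * eK w m + \sum_(j | j != k) \sum_w book_law PU Q w * eJ j w m.
  rewrite [X in _ = _ + X]exchange_big -big_split; apply: eq_bigr => w _.
  by rewrite sumR_mull /= -Rmult_plus_distr_l.
have hK := mean_eK m.
have hJ := leR_sum (fun j => @mean_eJ j m); rewrite big_split /= sumR_mulr in hJ.
apply: Rle_trans (Rplus_le_compat _ _ _ _ hK hJ) _; right.
by rewrite /tot /codeC -Rplus_assoc; congr (_ + _); set A := \sum_(j | _) _; rewrite /Rdiv; ring.
Qed.

Let idx (m1 : 'I_N1) (m2 : 'I_a) : M0 * Mp := ((m2, (enum_val m1).1), (enum_val m1).2).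

Let book_code (w : book) : code X Y n N1 a :=
  @Code K X Y n N1 a
    (fun m1 m2 t => word w (idx m1 m2) t)
    (fun i f =>
       (* Receiver K gets a constant as its estimate of M1, which it does not require. *)
       if i == k then (enum_rank (Ordinal bpos, Ordinal dpos), (@dK i w [ffun t => f t]).1)
       else let m := @dJ i w [ffun t => f t] in (enum_rank (m.1.2, m.2), m.1.1)).

Let err_le w m1 m2 (yn : {ffun 'I_n -> outT Y}) :
  (if err_event (book_code w) m1 m2 yn then 1 else 0) <=
  indic (@dK k w [ffun t => yn t k] != (idx m1 m2).1) +
  \sum_(j | j != k) indic (@dJ j w [ffun t => yn t j] != idx m1 m2).
Proof.
set S := \sum_(j | _) _.
have s0 : 0 <= S by apply: sumR_ge0 => j _; apply: indic_ge0.
have ne i : i != k -> @dJ i w [ffun t => yn t i] != idx m1 m2 -> 1 <= S.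
  move=> ik h; have := @le_sumR _ (fun j => j != k)
    (fun j => indic (@dJ j w [ffun t => yn t j] != idx m1 m2)) i ik (fun _ _ => indic_ge0 _).
  by rewrite h.
have i0 := indic_ge0 (@dK k w [ffun t => yn t k] != (idx m1 m2).1).
have e1 : indic true = 1 by [].
clearbody S; case: ifP => [/existsP [i]|_]; last lra.
rewrite /book_code [dec _ _ _]/=; case: (eqVneq i k) => [->|ik].
  rewrite /req1 rk eqxx /= => /andP [_ h].
  suff -> : @dK k w [ffun t => yn t k] != (idx m1 m2).1 by rewrite e1; lra.
  by apply: contraNneq h => ->.
case/orP => /andP [_ h].
  suff /(ne _ ik) : @dJ i w [ffun t => yn t i] != idx m1 m2 by lra.
  by apply: contraNneq h => ->; rewrite /idx /= -surjective_pairing enum_valK.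
suff /(ne _ ik) : @dJ i w [ffun t => yn t i] != idx m1 m2 by lra.
by apply: contraNneq h => ->.
Qed.

Let sum_err_le w m1 m2 : \sum_(yn : {ffun 'I_n -> outT Y})
    (\prod_t W (enc (book_code w) m1 m2 t) (yn t)) *
      (if err_event (book_code w) m1 m2 yn then 1 else 0) <=
  eK w (idx m1 m2) + \sum_(j | j != k) eJ j w (idx m1 m2).
Proof.
have -> : \sum_(j | j != k) eJ j w (idx m1 m2) = \sum_(j | j != k)
   \sum_(yn : {ffun 'I_n -> outT Y}) (\prod_t W (word w (idx m1 m2) t) (yn t)) *
     indic (@dJ j w [ffun t => yn t j] != idx m1 m2).
  apply: eq_bigr => j _.
  by rewrite (sum_joint_outputs _ (fun z => indic (@dJ j w z != idx m1 m2))).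
rewrite /eK -(sum_joint_outputs _ (fun z => indic (@dK k w z != (idx m1 m2).1))).
rewrite exchange_big -big_split; apply: leR_sum => yn _ /=.
rewrite sumR_mull -Rmult_plus_distr_l; apply: Rmult_le_compat_l; last exact: err_le.
by apply: prodR_ge0 => t; apply: (proj1 (HW _)).
Qed.

Lemma random_code : exists c : code X Y n N1 a, Pe W c <=
  codeC / INR n + INR (a * b).-1 * Rpower 2 (- (INR n * g0)) +
  \sum_(j | j != k) (INR d.-1 * Rpower 2 (- (INR n * g1 j)) +
                     INR (a * b).-1 * INR d * Rpower 2 (- (INR n * g2 j))).
Proof.
have [w hw] := good_book; exists (book_code w); rewrite -/tot.
rewrite /Pe /rsum /rprod.
have -> : INR N1 * INR a = NN.
  by rewrite card_prod !card_ord mult_INR /NN; ring.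
apply: (Rmult_le_reg_r NN) => //; rewrite /Rdiv Rmult_assoc Rinv_l; last by have := NNp; lra.
rewrite Rmult_1_r (Rmult_comm tot); apply: Rle_trans hw.
apply: Rle_trans (leR_sum (fun m1 _ => leR_sum (fun m2 _ => sum_err_le w m1 m2))) _; right.
pose G m := eK w m + \sum_(j | j != k) eJ j w m.
transitivity (\sum_m1 \sum_m2 G (idx m1 m2)); first by [].
rewrite (reindex (@enum_rank _)) /=; last exact: onW_bij (@enum_rank_bij _).
rewrite [RHS](reindex (fun m : 'I_b * 'I_d * 'I_a => ((m.2, m.1.1), m.1.2))) /=; last first.
  by exists (fun m : M0 * Mp => ((m.1.2, m.2), m.1.1)) => [[[x y] z]|[[x y] z]].
rewrite [RHS]sumR_pair; apply: eq_bigr => m _; apply: eq_bigr => m2 _.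
by rewrite /idx enum_rankK.
Qed.

End FixedSize.
End RandomCode.

(** * Codebook sizes and error exponents *)

Lemma pow2_bounded (x : R) : exists N : nat, Rle_dec (Rpower 2 x) (INR N) : bool.
Proof.
have p0 : 0 < Rpower 2 x by apply: exp_pos.
have [N [h N0]] := archimed_cor1 (/ Rpower 2 x) (Rinv_0_lt_compat _ p0).
have {}N0 := lt_0_INR N N0.
exists N; case: Rle_dec => //= hn; case: hn; apply: Rlt_le.
rewrite -(Rinv_inv (Rpower 2 x)) -(Rinv_inv (INR N)); apply: Rinv_lt_contravar => //.
by apply: Rmult_lt_0_compat; apply: Rinv_0_lt_compat.
Qed.

(** Minimality matters at rate zero: the size is then exactly 1 and there are no wrong codewords. *)
Definition ceilpow (x : R) : nat := ex_minn (pow2_bounded x).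

Lemma ceilpow_ge x : Rpower 2 x <= INR (ceilpow x).
Proof. by rewrite /ceilpow; case: ex_minnP => N; case: Rle_dec. Qed.

Lemma ceilpow_gt0 x : (0 < ceilpow x)%N.
Proof.
have := ceilpow_ge x; case: (ceilpow x) => //=.
by have : 0 < Rpower 2 x := exp_pos _; lra.
Qed.

Lemma ceilpow_pred x : INR (ceilpow x).-1 <= Rpower 2 x.
Proof.
have := ceilpow_gt0 x; rewrite /ceilpow; case: ex_minnP => N _ mn N0.
case: (Rle_lt_dec (INR N.-1) (Rpower 2 x)) => // h.
have := mn N.-1; case: Rle_dec => [_ /(_ isT)|]; last by move=> ?; lra.
by rewrite leqNgt prednK // leqnn.
Qed.

Lemma ceilpow0 : ceilpow 0 = 1%N.
Proof.
have := ceilpow_gt0 0; rewrite /ceilpow; case: ex_minnP => N _ mn N0.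
apply/eqP; rewrite eqn_leq N0 andbT; apply: mn.
by rewrite Rpower_O /=; [case: Rle_dec => //=; lra | lra].
Qed.

Lemma ceilpow_le x : 0 <= x -> INR (ceilpow x) <= 2 * Rpower 2 x.
Proof.
move=> x0; have h := ceilpow_pred x.
have : 1 <= Rpower 2 x by rewrite -(Rpower_O 2); [apply: Rle_Rpower; lra | lra].
by rewrite -(prednK (ceilpow_gt0 x)) S_INR; lra.
Qed.

Definition Oinv (f : nat -> R) : Prop :=
  exists C, forall n, (0 < n)%N -> f n <= C / INR n.

Lemma Oinv_add f g : Oinv f -> Oinv g -> Oinv (fun n => f n + g n).
Proof.
move=> [C hC] [D hD]; exists (C + D) => n n0; rewrite Rdiv_plus_distr.
by apply: Rplus_le_compat; [apply: hC | apply: hD].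
Qed.

Lemma Oinv_sum (I : finType) (P : pred I) (t : I -> nat -> R) :
  (forall i, P i -> Oinv (t i)) -> Oinv (fun n => \sum_(i | P i) t i n).
Proof.
move=> h; elim: (index_enum I) => [|i s [C hC]].
  by exists 0 => n _; rewrite big_nil /Rdiv Rmult_0_l; lra.
case Pi : (P i); last by exists C => n n0; rewrite big_cons Pi; apply: hC.
have [D hD] := h i Pi; exists (D + C) => n n0; rewrite big_cons Pi Rdiv_plus_distr.
by apply: Rplus_le_compat; [apply: hD | apply: hC].
Qed.

Lemma Oinv_cv0 f : (forall n, (0 < n)%N -> 0 <= f n) -> Oinv f -> Un_cv f 0.
Proof.
move=> f0 [C hC] e e0.
have [N [hN N0]] := archimed_cor1 (e / (Rabs C + 1)) ltac:(by apply: Rdiv_lt_0_compat => //;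
  have := Rabs_pos C; lra).
exists N => n nN; have n0 : (0 < n)%N by apply/ltP; apply: PeanoNat.Nat.lt_le_trans nN.
have nr : 0 < INR n by apply: lt_0_INR; apply/leP.
rewrite /Rdist Rminus_0_r Rabs_right; last by apply/Rle_ge/f0.
apply: Rle_lt_trans (hC n n0) _.
have c1 : 0 < Rabs C + 1 by have := Rabs_pos C; lra.
apply: (@Rle_lt_trans _ ((Rabs C + 1) * / INR N)).
  apply: (@Rle_trans _ ((Rabs C + 1) * / INR n)).
    apply: Rmult_le_compat_r; first by apply/Rlt_le/Rinv_0_lt_compat.
    by have := Rle_abs C; lra.
  apply: Rmult_le_compat_l; first lra.
  by apply: Rinv_le_contravar; [apply: lt_0_INR | apply: le_INR].
have -> : e = (Rabs C + 1) * (e / (Rabs C + 1)) by field; lra.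
exact: Rmult_lt_compat_l.
Qed.

Lemma pow2_neg_le h n : 0 < h -> (0 < n)%N -> Rpower 2 (- (INR n * h)) <= / (h * ln 2) / INR n.
Proof.
move=> h0 n0; have nr : 0 < INR n by apply: lt_0_INR; apply/leP.
have l0 := ln2_gt0.
have x0 : 0 < INR n * h * ln 2 by do ?apply: Rmult_lt_0_compat.
rewrite Rpower_Ropp; have -> : / (h * ln 2) / INR n = / (INR n * h * ln 2) by field; lra.
apply: Rinv_le_contravar => //; rewrite /Rpower.
by have := exp_ineq1_le (INR n * h * ln 2); lra.
Qed.

(** A gap between [g] and [c * r] gives exponential decay, weakened here to 1/n. The factor 8 is 4 *
    2: the cloud indices number at most 4 and the satellites at most 2 times the intended power. At
    [r = 0] the exponent may have the wrong sign, and the prefactor must vanish. *)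
Lemma exponent_Oinv (s : nat -> R) (c r g : R) :
  (r = 0 -> forall n, s n = 0) -> (r <> 0 -> c * r < g) ->
  (forall n, s n <= 8 * Rpower 2 (INR n * (c * r))) ->
  Oinv (fun n => s n * Rpower 2 (- (INR n * g))).
Proof.
move=> h0 h1 h2; case: (Req_dec r 0) => [e|ne].
  by exists 0 => n _; rewrite h0 // /Rdiv !Rmult_0_l; lra.
have hg : 0 < g - c * r by have := h1 ne; lra.
exists (8 * / ((g - c * r) * ln 2)) => n n0.
apply: (@Rle_trans _ (8 * Rpower 2 (INR n * (c * r)) * Rpower 2 (- (INR n * g)))).
  by apply: Rmult_le_compat_r; [apply/Rlt_le/exp_pos | apply: h2].
rewrite Rmult_assoc -Rpower_plus.
have -> : INR n * (c * r) + - (INR n * g) = - (INR n * (g - c * r)) by ring.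
have := pow2_neg_le hg n0; rewrite /Rdiv; lra.
Qed.

(** The midpoint of [c * r] and [i]. At [r = 0] the information [i] may be 0 and leave no room in
    between; any threshold below [i] then does, as there are no wrong codewords to reject. *)
Definition gsel (c r i : R) : R := if Req_dec_T r 0 then i - 1 else (c * r + i) / 2.

Lemma gsel_lt c r i : 0 < c < 1 -> 0 <= r <= i -> gsel c r i < i.
Proof. by move=> hc hr; rewrite /gsel; case: Req_dec_T => h /=; nra. Qed.

Lemma gsel_gt c r i : 0 < c < 1 -> 0 <= r <= i -> r <> 0 -> c * r < gsel c r i.
Proof. by move=> hc hr h; rewrite /gsel; case: Req_dec_T => //= _; nra. Qed.

(** * The capacity region *)

Section Capacity.
Variables (K : nat) (X : finType) (Y : 'I_K -> finType) (W : X -> outT Y -> R).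
Hypothesis HW : is_channel W.

Lemma Pe_ge0 n N1 N2 (c : code X Y n N1 N2) : (0 < N1)%N -> (0 < N2)%N -> 0 <= Pe W c.
Proof.
move=> h1 h2; rewrite Pe_law; apply: sumR_ge0 => w _; exact: law_ge0.
Qed.

Lemma Pe_le1 n N1 N2 (c : code X Y n N1 N2) : (0 < N1)%N -> (0 < N2)%N -> Pe W c <= 1.
Proof.
move=> h1 h2; rewrite Pe_law -(law_sum1 HW c h1 h2).
by apply: sumR_subset => w; apply: law_ge0.
Qed.

Lemma cond_info_ge0 (U : finType) (p : U -> X -> R) j : is_pmf2 p -> 0 <= I_XY_given_U W p j.
Proof.
move=> hp; have [p0 _] := hp; rewrite I_XY_given_UE //.
have -> : \sum_x (\sum_u p u x) * rowent (marg W j) x =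
          \sum_u \sum_x p u x * rowent (marg W j) x.
  by rewrite exchange_big; apply: eq_bigr => x _; rewrite sumR_mulr.
rewrite -sumRB; apply: sumR_ge0 => u _.
have := @rowent_le_ent _ _ (marg W j) (@marg_ge0 _ _ _ _ HW j) (@marg_sum1 _ _ _ _ HW j) (p u) (p0 u).
lra.
Qed.

(** [r2 + r10] is the cloud rate and [r11] the satellite rate. The factor [c] makes every weak
    inequality at a positive rate strict. *)
Lemma superposition_achievable (U : finType) (p : U -> X -> R) (k : 'I_K) (c r2 r10 r11 : R) :
  is_pmf2 p -> rcv k = K -> 0 < c < 1 -> 0 <= r2 -> 0 <= r10 -> 0 <= r11 ->
  r2 + r10 <= I_UY W p k ->
  (forall j, j != k -> r11 <= I_XY_given_U W p j) ->
  (forall j, j != k -> r2 + r10 + r11 <= I_XY W (fun x => \sum_u p u x) j) ->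
  achievable W (c * (r10 + r11)) (c * r2).
Proof.
move=> hp rk hc h2 h10 h11 H0 H1 H2.
split; first by apply: Rmult_le_pos; lra.
split; first by apply: Rmult_le_pos; lra.
pose a n := ceilpow (INR n * (c * r2)).
pose b n := ceilpow (INR n * (c * r10)).
pose d n := ceilpow (INR n * (c * r11)).
pose g0 := gsel c (r2 + r10) (I_UY W p k).
pose g1 j := gsel c r11 (I_XY_given_U W p j).
pose g2 j := gsel c (r2 + r10 + r11) (I_XY W (fun x => \sum_u p u x) j).
pose C := codeC W p k g0 g1 g2.
pose bnd n := C / INR n + INR (a n * b n).-1 * Rpower 2 (- (INR n * g0)) +
   \sum_(j | j != k) (INR (d n).-1 * Rpower 2 (- (INR n * g1 j)) +
                      INR (a n * b n).-1 * INR (d n) * Rpower 2 (- (INR n * g2 j))).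
have exn n : exists cd : code X Y n #|{: 'I_(b n) * 'I_(d n)}| (a n),
    (0 < n)%N -> Pe W cd <= bnd n.
  case: n => [|n].
    (* At block length zero there is nothing to encode; only the message counts matter. *)
    exists (@Code K X Y 0 _ _ (fun _ _ t => False_rect X (notF (ltn_ord t)))
      (fun _ _ => (enum_rank (Ordinal (ceilpow_gt0 _), Ordinal (ceilpow_gt0 _)),
                   Ordinal (ceilpow_gt0 _)))) => //.
  have [] := @random_code _ _ _ _ HW _ _ hp k g0 g1 g2 rk _ _ _ n.+1 (a n.+1) (b n.+1) (d n.+1)
     (ltn0Sn n) (ceilpow_gt0 _) (ceilpow_gt0 _) (ceilpow_gt0 _).
  - by apply: gsel_lt => //; lra.
  - by move=> j jk; apply: gsel_lt => //; have := H1 j jk; lra.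
  - by move=> j jk; apply: gsel_lt => //; have := H2 j jk; lra.
  by move=> cd hcd; exists cd.
exists (fun n => #|{: 'I_(b n) * 'I_(d n)}|), a,
  (fun n => proj1_sig (constructive_indefinite_description _ (exn n))); split; [|split].
- move=> n; rewrite card_prod !card_ord mult_INR.
  have -> : INR n * (c * (r10 + r11)) = INR n * (c * r10) + INR n * (c * r11) by ring.
  rewrite Rpower_plus; apply: Rmult_le_compat; try exact: ceilpow_ge;
    by apply/Rlt_le/exp_pos.
- by move=> n; apply: ceilpow_ge.
apply: Oinv_cv0 => [n _|].
  by apply: Pe_ge0; [rewrite card_prod !card_ord muln_gt0 !ceilpow_gt0 | apply: ceilpow_gt0].
suff [D hD] : Oinv bnd.
  exists D => n n0; apply: Rle_trans (hD n n0).
  by case: constructive_indefinite_description => cd /=; apply.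
have c0 n r : 0 <= r -> 0 <= INR n * (c * r).
  by move=> r0; apply: Rmult_le_pos; [apply: pos_INR | apply: Rmult_le_pos; lra].
have p0 x : 0 < Rpower 2 x by apply: exp_pos.
have sab n : INR (a n * b n).-1 <= 4 * Rpower 2 (INR n * (c * (r2 + r10))).
  apply: (@Rle_trans _ (INR (a n * b n))); first by apply: le_INR; apply/leP/leq_pred.
  have -> : INR n * (c * (r2 + r10)) = INR n * (c * r2) + INR n * (c * r10) by ring.
  rewrite mult_INR Rpower_plus.
  have ha := ceilpow_le (c0 n _ h2); have hb := ceilpow_le (c0 n _ h10).
  have := Rmult_le_compat _ _ _ _ (pos_INR _) (pos_INR _) ha hb.
  by rewrite /a /b; lra.
have sd n : INR (d n) <= 2 * Rpower 2 (INR n * (c * r11)) by apply: ceilpow_le; apply: c0.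
have zero n r : r = 0 -> ceilpow (INR n * (c * r)) = 1%N.
  by move=> ->; rewrite !Rmult_0_r ceilpow0.
have zab n : r2 + r10 = 0 -> INR (a n * b n).-1 = 0.
  by move=> e; rewrite /a /b !zero //=; lra.
apply: Oinv_add; first (apply: Oinv_add; first by exists C => n _; lra).
- apply: (@exponent_Oinv _ c (r2 + r10)) => [e n|ne|n]; first exact: zab.
    by apply: gsel_gt => //; lra.
  by have := sab n; have := p0 (INR n * (c * (r2 + r10))); lra.
apply: Oinv_sum => j jk; apply: Oinv_add.
- apply: (@exponent_Oinv _ c r11) => [e n|ne|n].
  + by rewrite /d zero.
  + by apply: gsel_gt => //; have := H1 j jk; lra.
  + by have := ceilpow_pred (INR n * (c * r11)); have := p0 (INR n * (c * r11)); rewrite -/(d n); lra.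
apply: (@exponent_Oinv _ c (r2 + r10 + r11)) => [e n|ne|n].
- by rewrite zab ?Rmult_0_l; lra.
- by apply: gsel_gt => //; have := H2 j jk; lra.
have -> : INR n * (c * (r2 + r10 + r11)) = INR n * (c * (r2 + r10)) + INR n * (c * r11) by ring.
rewrite Rpower_plus.
by have := Rmult_le_compat _ _ _ _ (pos_INR _) (pos_INR _) (sab n) (sd n); lra.
Qed.

Hypothesis K3 : (3 <= K)%N.
Hypothesis Hclass : classA W \/ classB W.

Let K0 : (0 < K)%N. Proof. exact: leq_trans K3. Qed.

Lemma region_sub_capacity R1 R2 : region W R1 R2 -> capacity_region W R1 R2.
Proof.
move=> [R10 [R20 [U [p [hp [h1 [h2 h3]]]]]]] eps eps0.
have kK : (K.-1 < K)%N by rewrite prednK.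
have sK : (K.-2 < K)%N by rewrite (leq_ltn_trans _ kK) // leq_pred.
pose k := Ordinal kK; pose s := Ordinal sK.
have rk : rcv k = K by rewrite /rcv /= prednK.
have rs : rcv s = K.-1 by rewrite /rcv /= prednK // -ltnS prednK // ltnW.
have rj (j : 'I_K) : j != k -> (rcv j <= K.-1)%N.
  have jle : (j <= K.-1)%N by rewrite -ltnS prednK.
  by move=> jk; rewrite /rcv ltn_neqAle jle andbT.
pose I0 := I_UY W p k.
have hI0 : R2 <= I0 by apply: h1.
have hI1 (j : 'I_K) : j != k -> R2 + R1 <= I_XY_given_U W p j + I0.
  by move=> jk; apply: h2 => //; apply: rj.
have hI2 (j : 'I_K) : j != k -> R2 + R1 <= I_XY W (fun x => \sum_u p u x) j.
  (* The satellite decoders need R1 + R2 <= I(X;Y_j) for all j below K. Class A carries the bound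
     from K-1 to the others; class B bounds I(X;Y_j|U) + I(U;Y_K) by I(X;Y_j). *)
  move=> jk; have pX := pmf2_marg hp; case: Hclass => [[hA _]|hB].
    have hs : R2 + R1 <= I_XY W (fun x => \sum_u p u x) s by apply: h3.
    case: (eqVneq (rcv j) K.-1) => [e|ne].
      by rewrite (_ : j = s) //; apply/val_inj; move: (congr1 predn e).
    apply: Rle_trans hs _; apply: (hA j s) => //.
    have : (rcv j < K.-1)%N by rewrite ltn_neqAle ne rj.
    by move=> lt; rewrite subn2 -ltnS prednK // -ltnS prednK // ltnW.
  apply: Rle_trans (hI1 j jk) _.
  have := hB j k (rj j jk) rk U p hp; rewrite /I0 I_XYE // I_XY_given_UE // !I_UYE //; lra.
(* The cloud takes as much of the first message as receiver K can bear. The remainder is 0 or R1 +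
   R2 - I(U;Y_K), and I(X;Y_j|U) covers both. *)
pose r10 := Rmin R1 (I0 - R2); pose r11 := R1 - r10.
have m1 : r10 <= R1 by apply: Rmin_l.
have m2 : r10 <= I0 - R2 by apply: Rmin_r.
have m0 : 0 <= r10 by apply: Rmin_glb; lra.
have h11 (j : 'I_K) : j != k -> r11 <= I_XY_given_U W p j.
  move=> jk; have := hI1 j jk; have := @cond_info_ge0 U p j hp.
  by rewrite /r11 /r10 /Rmin; case: Rle_dec => _; lra.
(* This choice gives [dl < 1] and [dl * (R1 + R2) < eps]. *)
pose dl := eps / (eps + R1 + R2 + 1).
have den : 0 < eps + R1 + R2 + 1 by lra.
have dl0 : 0 < dl by apply: Rdiv_lt_0_compat.
have dlE : dl * (eps + R1 + R2 + 1) = eps by rewrite /dl; field; lra.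
have dl1 : dl < 1 by apply: (Rmult_lt_reg_r (eps + R1 + R2 + 1)) => //; lra.
have small r : 0 <= r -> r <= R1 + R2 -> Rabs ((1 - dl) * r - r) < eps.
  move=> r0 rle; have -> : (1 - dl) * r - r = - (dl * r) by ring.
  rewrite Rabs_Ropp Rabs_right; last by apply/Rle_ge/Rmult_le_pos; lra.
  rewrite -[X in _ < X]dlE; apply: Rmult_lt_compat_l => //; lra.
exists ((1 - dl) * (r10 + r11)), ((1 - dl) * R2); split; last first.
  by rewrite (_ : r10 + r11 = R1); [split; apply: small; lra | rewrite /r11; ring].
apply: (@superposition_achievable U p k) => //; rewrite ?/r11; try lra.
  by rewrite -/I0; lra.
by move=> j jk; have := hI2 j jk; lra.
Qed.

Lemma rate_bounds_le (U : finType) (p : U -> X -> R) r2 r12 r2' r12' :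
  r2' <= r2 -> r12' <= r12 -> rate_bounds W p r2 r12 -> rate_bounds W p r2' r12'.
Proof.
move=> l1 l2 [h1 [h2 h3]]; split=> [k e|]; last split=> [j k e e'|s e].
- by have := h1 k e; lra.
- by have := h2 j k e e'; lra.
- by have := h3 s e; lra.
Qed.

Lemma capacity_sub_region R1 R2 : capacity_region W R1 R2 -> region W R1 R2.
Proof.
move=> cap.
have R10 : 0 <= R1.
  (* A negative rate keeps a positive distance from all achievable ones. *)
  case: (Rle_lt_dec 0 R1) => // h; have [|a [b [[a0 _] [ha _]]]] := cap (- R1); first lra.
  by move: ha => /Rabs_def2; lra.
have R20 : 0 <= R2.
  case: (Rle_lt_dec 0 R2) => // h; have [|a [b [[_ [b0 _]] [_ hb]]]] := cap (- R2); first lra.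
  by move: hb => /Rabs_def2; lra.
split=> //; split=> //; apply: (rate_bounds_closed HW) => dl dl0.
(* Loss budget for the sum rate: dl/8 for each approximated rate, dl/4 for the error probability,
   and 2/n <= dl/4 for the two Fano bits, which stays below dl. *)
have [|a [b [[a0 [b0 [N1 [N2 [c [hN1 [hN2 cv]]]]]]] [ha hb]]]] := cap (dl / 8); first lra.
have {ha}ha := Rabs_def2 _ _ ha; have {hb}hb := Rabs_def2 _ _ hb.
have den : 0 < 4 * (a + b + 1) by lra.
have [|M hM] := cv (dl / (4 * (a + b + 1))); first by apply: Rdiv_lt_0_compat.
have [M' [hM' M'0]] := archimed_cor1 (dl / 8) ltac:(lra).
pose n := maxn M M'.
have nM : (n >= M)%coq_nat by apply/leP/leq_maxl.
have nM' : (n >= M')%coq_nat by apply/leP/leq_maxr.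
have n0 : (0 < n)%N by apply/ltP; apply: PeanoNat.Nat.lt_le_trans nM'.
have nr : 0 < INR n by apply: lt_0_INR; apply/leP.
have in_ : / INR n <= dl / 8.
  by apply/Rlt_le; apply: Rle_lt_trans hM'; apply: Rinv_le_contravar;
    [apply: lt_0_INR | apply: le_INR].
have N1p : (0 < N1 n)%N.
  rewrite lt0n; apply/eqP => e; have := hN1 n; rewrite e /=.
  by have : 0 < Rpower 2 (INR n * a) := exp_pos _; lra.
have N2p : (0 < N2 n)%N.
  rewrite lt0n; apply/eqP => e; have := hN2 n; rewrite e /=.
  by have : 0 < Rpower 2 (INR n * b) := exp_pos _; lra.
have e0 := Pe_ge0 (c n) N1p N2p; have e1 := Pe_le1 (c n) N1p N2p.
have := hM n nM; rewrite /Rdist Rminus_0_r Rabs_right; last lra.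
set e := Pe W (c n) in e0 e1 * => he.
have hab : (a + b + 1) * e <= dl / 4.
  have := Rmult_lt_compat_l _ _ _ den he.
  have -> : 4 * (a + b + 1) * (dl / (4 * (a + b + 1))) = dl by field; lra.
  lra.
have [U [p [hp rb]]] := converse_code HW (c n) N1p N2p K3 n0 Hclass.
exists U, p; split=> //; apply: rate_bounds_le rb; rewrite -/e.
  have l2 : INR n * b <= log2 (INR (N2 n)).
    by rewrite -(log2_Rpower (INR n * b)); apply: log2_le => //; apply: exp_pos.
  apply: (@Rle_trans _ (/ INR n * (INR n * b * (1 - e) - 1))).
    have -> : / INR n * (INR n * b * (1 - e) - 1) = b * (1 - e) - / INR n by field; lra.
    have ae : 0 <= a * e by apply: Rmult_le_pos; lra.
    lra.
  apply: Rmult_le_compat_l; first by apply/Rlt_le/Rinv_0_lt_compat.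
  have : INR n * b * (1 - e) <= log2 (INR (N2 n)) * (1 - e) by apply: Rmult_le_compat_r; lra.
  lra.
have l2 : INR n * (a + b) <= log2 (INR (N1 n)) + log2 (INR (N2 n)).
  rewrite Rmult_plus_distr_l -{1}(log2_Rpower (INR n * a)) -{1}(log2_Rpower (INR n * b)).
  by apply: Rplus_le_compat; apply: log2_le => //; apply: exp_pos.
apply: (@Rle_trans _ (/ INR n * (INR n * (a + b) * (1 - e) - 2))).
  have -> : / INR n * (INR n * (a + b) * (1 - e) - 2) = (a + b) * (1 - e) - 2 * / INR n.
    by field; lra.
  lra.
apply: Rmult_le_compat_l; first by apply/Rlt_le/Rinv_0_lt_compat.
have : INR n * (a + b) * (1 - e) <= (log2 (INR (N1 n)) + log2 (INR (N2 n))) * (1 - e).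
  by apply: Rmult_le_compat_r; lra.
lra.
Qed.

End Capacity.

(* R1 = R_{bar K}, R2 = R_{bar (K-1)}; receivers numbered 1..K via rcv *)
Theorem theorem2 (K : nat) (hK : (3 <= K)%N)
  (X : finType) (Y : 'I_K -> finType) (W : X -> outT Y -> R)
  (HW : is_channel W) (Hclass : classA W \/ classB W) (R1 R2 : R) :
  capacity_region W R1 R2 <-> region W R1 R2.
Proof. by split; [apply: capacity_sub_region | apply: region_sub_capacity]. Qed.
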